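(* Let $\varphi$ be a real-valued smooth function on the hyperbolic $m$-space $\mathbb{H}^{m}(-1)$ of sectional curvature $-1$, and let $1<p<\infty$. Let $M$ be an $n$-dimensional ($n\geq2$) complete noncompact $\varphi$-minimal submanifold of the weighted manifold $\left(\mathbb{H}^{m}(-1),e^{-\varphi}dv\right)$. If $\sup_{M}\|\bar{\nabla}\varphi\|<n-1$, then $$\lambda_{1,p}(M)\geq\left(\frac{n-1-\sup_{M}\|\bar{\nabla}\varphi\|}{p}\right)^{p}>0.$$
   Context: $dv$ is the Riemannian volume element and $\bar\nabla$ the gradient operator on $\mathbb{H}^m(-1)$. The $\varphi$-mean curvature vector field of $M$ is $H_{\varphi}:=H+(\bar{\nabla}\varphi)^{\perp}$, where $\perp$ is the projection onto the normal bundle of $M$ and $H$ is the mean curvature vector of $M$, i.e. the unnormalized trace $\sum_{i=1}^n\alpha(e_i,e_i)$ of the second fundamental form $\alpha$. $M$ is called $\varphi$-minimal if $H_\varphi$ vanishes everywhere. For a domain $\Omega\subset M$, $$\lambda_{1,p}(\Omega)=\inf\left\{\frac{\int_{\Omega}\|\nabla f\|^{p}}{\int_{\Omega}|f|^{p}} : f\in W^{1,p}_{0}(\Omega),\ f\neq0\right\},$$ with integrals with respect to the (unweighted) Riemannian volume of $M$ and $W^{1,p}_0(\Omega)$ the completion of $C_0^\infty(\Omega)$ under $\|u\|_{1,p}=\{\int_\Omega(|u|^p+\|\nabla u\|^p)\}^{1/p}$. For complete noncompact $M$, $\lambda_{1,p}(M):=\lim_{\ell\to\infty}\lambda_{1,p}(B_M(q,\ell))$,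 where $B_M(q,\ell)$ is the geodesic ball of $M$; the limit is independent of $q\in M$. *)

(* Defs.v *)
From HB Require Import structures.
From mathcomp Require Import all_boot all_order all_algebra.
From mathcomp Require Import all_classical all_reals all_analysis.

Set Implicit Arguments.
Unset Strict Implicit.
Unset Printing Implicit Defensive.

Import Order.TTheory GRing.Theory Num.Theory.
Import numFieldNormedType.Exports.

Local Open Scope classical_set_scope.
Local Open Scope ring_scope.

Section Smooth.
Context {R : realType}.

(* [U] is meant to be open; [V] is meant to be finite-dimensional. *)
Fixpoint Ck_on {V W : normedModType R} (k : nat) (U : set V) (f : V -> W) : Prop :=
  if k is k'.+1 then
    (forall x, U x -> differentiable f x) /\ (forall v, Ck_on k' U ('D_v f))
  else forall x, U x -> {for x, continuous f}.

Definition smooth_on {V W : normedModType R} (U : set V) (f : V -> W) : Prop :=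
  forall k, Ck_on k U f.

Definition partial {V : normedModType R} {n : nat} (i : 'I_n) (f : 'rV[R]_n -> V)
  : 'rV[R]_n -> V := 'D_(delta_mx 0 i) f.

(* Integral over R^n with respect to n-dimensional Lebesgue measure, as an
   iterated integral; by Tonelli this is the usual integral for nonnegative
   Borel functions, the only ones it is applied to. *)
Fixpoint leb_int (n : nat) : ('rV[R]_n -> \bar R) -> \bar R :=
  if n is n'.+1 then fun h =>
    (\int[lebesgue_measure]_(t in [set: R])
       leb_int (fun y : 'rV[R]_n' =>
                  h (row_mx (const_mx t : 'rV[R]_1) y : 'rV[R]_(n'.+1))))%E
  else fun h => h 0.

End Smooth.

(* Riemannian metrics on open subsets of R^k, as fields [G] of Gram matrices. *)
Section Metric.
Context {R : realType} {k : nat}.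
Implicit Types (G : 'rV[R]_k -> 'M[R]_k) (x u v : 'rV[R]_k).

Definition inner (S : 'M[R]_k) u v : R := (u *m S *m v^T) 0 0.

Definition gnorm (S : 'M[R]_k) u : R := Num.sqrt (inner S u u).

Definition gradient G (phi : 'rV[R]_k -> R) x : 'rV[R]_k :=
  (\row_j partial j phi x) *m invmx (G x).

(* [christoffel G x l a b] is $\Gamma^l_{ab}(x)$. *)
Definition christoffel G x (l a b : 'I_k) : R :=
  2^-1 * \sum_(c < k) invmx (G x) l c *
    (partial a (fun y => G y b c) x + partial b (fun y => G y a c) x
       - partial c (fun y => G y a b) x).

End Metric.

(* The upper half-space model of H^(m+1)(-1), m >= 0: the last coordinate is positive,
   and the metric is |dx|^2 divided by the square of the last coordinate. *)
Section Hyperbolic.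
Context {R : realType} {m : nat}.

Definition half_space : set 'rV[R]_m.+1 := [set x | 0 < x 0 ord_max].

Definition hyp_metric (x : 'rV[R]_m.+1) : 'M[R]_m.+1 := (x 0 ord_max ^- 2)%:M.

End Hyperbolic.

(* A chart is given by total functions, only relevant on [chart_dom] and on
   [chart_img] respectively. *)
Record chart (R : realType) (n : nat) (T : Type) := Chart {
  chart_dom : set T;
  chart_map : T -> 'rV[R]_n;
  chart_inv : 'rV[R]_n -> T }.

Definition chart_img (R : realType) (n : nat) (T : Type) (c : chart R n T)
  : set 'rV[R]_n := chart_map c @` chart_dom c.

Definition is_chart (R : realType) (n : nat) (T : topologicalType)
    (c : chart R n T) : Prop :=
  [/\ open (chart_dom c), open (chart_img c),
      (forall q, chart_dom c q -> chart_inv c (chart_map c q) = q),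
      (forall q, chart_dom c q -> {for q, continuous (chart_map c)}) &
      (forall x, chart_img c x -> {for x, continuous (chart_inv c)})].

Record smooth_manifold (R : realType) (n : nat) := SmoothManifold {
  carrier :> ptopologicalType;
  atlas : set (chart R n carrier);
  atlas_chart : forall c, atlas c -> is_chart c;
  atlas_cover : forall q : carrier, exists2 c, atlas c & chart_dom c q;
  atlas_smooth : forall c c', atlas c -> atlas c' ->
    smooth_on (chart_map c @` (chart_dom c `&` chart_dom c'))
              (chart_map c' \o chart_inv c);
  manifold_hausdorff : hausdorff_space carrier;
  manifold_second_countable : @second_countable carrier;
  manifold_connected : connected [set: carrier] }.

Definition chart_at (R : realType) (n : nat) (M : smooth_manifold R n) (q : M)
  : chart R n M := sval (cid2 (atlas_cover q)).

Definition borel (R : realType) (n : nat) (M : smooth_manifold R n) :=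
  g_sigma_algebraType (@open M).

Definition smooth_map (R : realType) (n : nat) (M : smooth_manifold R n)
    (W : normedModType R) (f : M -> W) : Prop :=
  forall c, atlas c -> smooth_on (chart_img c) (f \o chart_inv c).

Definition smooth_curve (R : realType) (n : nat) (M : smooth_manifold R n)
    (gamma : R -> M) : Prop :=
  continuous gamma /\
  forall c, atlas c -> smooth_on (gamma @^-1` chart_dom c) (chart_map c \o gamma).

(* Local geometry of a parametrized n-submanifold [Y] of (an open subset of) R^k
   with the metric [G]. Tangent vectors are row vectors of R^k; row [i] of
   [jacobian Y x] is the coordinate field $\partial_i Y$ at [x]. *)
Section Parametrized.
Context {R : realType} {n k : nat}.
Variables (G : 'rV[R]_k -> 'M[R]_k) (Y : 'rV[R]_n -> 'rV[R]_k).

Definition first_form (x : 'rV[R]_n) : 'M[R]_n :=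
  jacobian Y x *m G (Y x) *m (jacobian Y x)^T.

(* Orthogonal projection onto the tangent space,
   $v \mapsto \sum_{i,j} <v, \partial_j Y> g^{ji} \partial_i Y$. *)
Definition tangent_part (x : 'rV[R]_n) (v : 'rV[R]_k) : 'rV[R]_k :=
  v *m G (Y x) *m (jacobian Y x)^T *m invmx (first_form x) *m jacobian Y x.

Definition normal_part (x : 'rV[R]_n) (v : 'rV[R]_k) : 'rV[R]_k :=
  v - tangent_part x v.

(* The ambient Levi-Civita derivative of $\partial_j Y$ along $\partial_i Y$. *)
Definition cov_deriv (x : 'rV[R]_n) (i j : 'I_n) : 'rV[R]_k :=
  partial i (partial j Y) x +
  \row_l \sum_(a < k) \sum_(b < k)
    christoffel G (Y x) l a b * jacobian Y x i a * jacobian Y x j b.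

Definition second_form (x : 'rV[R]_n) (i j : 'I_n) : 'rV[R]_k :=
  normal_part x (cov_deriv x i j).

(* The (unnormalized) trace $\sum_{i,j} g^{ij} \alpha(\partial_i, \partial_j)$
   of the second fundamental form, i.e. the sum of the $\alpha(e_i, e_i)$ over any
   orthonormal basis of the tangent space. *)
Definition mean_curvature (x : 'rV[R]_n) : 'rV[R]_k :=
  \sum_(i < n) \sum_(j < n) invmx (first_form x) i j *: second_form x i j.

End Parametrized.

(* Submanifolds: immersions [X] of an n-manifold [M] into an open subset [D] of
   R^k with metric [G]; [M] carries the induced metric. *)
Section Submanifold.
Context {R : realType} {n k : nat} {M : smooth_manifold R n}.
Variables (G : 'rV[R]_k -> 'M[R]_k) (X : M -> 'rV[R]_k).

Definition immersion (D : set 'rV[R]_k) : Prop :=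
  [/\ smooth_map X, (forall q, D (X q)) &
      forall c, atlas c -> forall x, chart_img c x ->
        row_free (jacobian (X \o chart_inv c) x)].

Definition phi_mean_curvature (phi : 'rV[R]_k -> R) (c : chart R n M)
    (x : 'rV[R]_n) : 'rV[R]_k :=
  let Y := X \o chart_inv c in
  mean_curvature G Y x + normal_part G Y x (gradient G phi (Y x)).

Definition phi_minimal (phi : 'rV[R]_k -> R) : Prop :=
  forall c, atlas c -> forall x, chart_img c x -> phi_mean_curvature phi c x = 0.

Definition curve_length (gamma : R -> M) : \bar R :=
  (\int[lebesgue_measure]_(t in `[0%R, 1%R])
     (gnorm (G (X (gamma t))) (derive1 (X \o gamma) t))%:E)%E.

(* Piecewise smooth paths, as chains of smooth curves restricted to [0, 1]. *)
Fixpoint joins (q : M) (s : seq (R -> M)) (q' : M) : Prop :=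
  if s is gamma :: s' then
    [/\ smooth_curve gamma, gamma 0 = q & joins (gamma 1) s' q']
  else q = q'.

Definition riem_dist (q q' : M) : \bar R :=
  ereal_inf [set (\sum_(gamma <- s) curve_length gamma)%E
            | s in [set s | joins q s q']].

Definition geodesic_ball (q : M) (l : R) : set M :=
  [set q' | (riem_dist q q' < l%:E)%E].

Definition riem_complete : Prop :=
  forall u : nat -> M,
    (forall e : R, 0 < e -> exists N : nat, forall i j : nat,
       (N <= i)%N -> (N <= j)%N -> (riem_dist (u i) (u j) < e%:E)%E) ->
    exists q : M, riem_dist (u i) q @[i --> \oo] --> 0%E.

(* The Riemannian volume, determined on Borel subsets of chart domains (hence,
   by second countability, on all Borel sets) by the density
   $\sqrt{\det (g_{ij})}$. *)
Definition riemannian_volume (mu : {measure set (borel M) -> \bar R}) : Prop :=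
  forall c, atlas c -> forall A : set (borel M), measurable A ->
    A `<=` chart_dom c ->
    mu A = leb_int (fun x => (\1_(chart_map c @` A) x *
             Num.sqrt (\det (first_form G (X \o chart_inv c) x)))%:E).

(* The gradient of [f] for the induced metric, as a vector of R^k through the
   differential of [X]. *)
Definition grad (f : M -> R) (q : M) : 'rV[R]_k :=
  let c := chart_at q in
  let x := chart_map c q in
  let Y := X \o chart_inv c in
  (\row_j partial j (f \o chart_inv c) x) *m invmx (first_form G Y x) *m
    jacobian Y x.

Definition test_function (Omega : set M) (f : M -> R) : Prop :=
  [/\ smooth_map f, compact (closure [set q | f q != 0]) &
      closure [set q | f q != 0] `<=` Omega].

Section Lambda.
Variables (mu : {measure set (borel M) -> \bar R}) (p : R).

Definition Lp_fun (Omega : set M) (f : M -> R) : \bar R :=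
  (\int[mu]_(q in Omega) (`|f q| `^ p)%:E)%E.

Definition Lp_field (Omega : set M) (F : M -> 'rV[R]_k) : \bar R :=
  (\int[mu]_(q in Omega) (gnorm (G (X q)) (F q) `^ p)%:E)%E.

(* [f] is in $W^{1,p}_0(\Omega)$ with (weak) gradient [F]: the completion of the
   test functions is realized as the closure of the set of pairs (u, grad u) in
   the (complete) space of pairs of an L^p function and an L^p vector field. *)
Definition W0 (Omega : set M) (f : M -> R) (F : M -> 'rV[R]_k) : Prop :=
  [/\ measurable_fun [set: borel M] (f : borel M -> R),
      (forall i, measurable_fun [set: borel M] (fun q : borel M => F q 0 i)),
      (Lp_fun Omega f < +oo)%E, (Lp_field Omega F < +oo)%E &
      exists2 u : nat -> M -> R, (forall j, test_function Omega (u j)) &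
        Lp_fun Omega (fun q => u j q - f q) @[j --> \oo] --> 0%E /\
        Lp_field Omega (fun q => grad (u j) q - F q) @[j --> \oo] --> 0%E].

Definition lambda1 (Omega : set M) : \bar R :=
  ereal_inf [set r | exists f F, [/\ W0 Omega f F, Lp_fun Omega f != 0%E &
    r = (fine (Lp_field Omega F) / fine (Lp_fun Omega f))%:E]].

Definition lambda1_total (q : M) : \bar R :=
  lim (lambda1 (geodesic_ball q l) @[l --> +oo%R]).

End Lambda.

Definition sup_grad (phi : 'rV[R]_k -> R) : \bar R :=
  ereal_sup [set (gnorm (G (X q)) (gradient G phi (X q)))%:E | q in [set: M]].

End Submanifold.

(* Main.v *)
Require Import Defs.
From HB Require Import structures.
From mathcomp Require Import all_boot all_order all_algebra.
From mathcomp Require Import perm.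
From mathcomp Require Import ring lra.
From mathcomp Require Import all_classical all_reals all_analysis.
From mathcomp Require Import measurable_realfun.
Set Implicit Arguments.
Unset Strict Implicit.
Unset Printing Implicit Defensive.
Import Order.TTheory GRing.Theory Num.Theory.
Import numFieldNormedType.Exports.
Local Open Scope classical_set_scope.
Local Open Scope ring_scope.

(** The function b = - ln(height) of the upper half-space has unit gradient, and its Hessian is the
    metric minus the square of its differential. Restricted to an n-dimensional submanifold M it
    therefore satisfies
      div (grad b) = (n - 1) + |normal part of the ambient gradient of b|^2 + <H, grad b>,
    where H is the mean curvature vector. If M is phi-minimal then H is minus the normal part of the
    gradient of phi, so that, with s = sup |grad phi|,
      div (grad b) >= n - 1 - s =: c0 > 0                                                       (1)
    while |grad b| <= 1 on M. From (1) the eigenvalue bound follows as in McKean's theorem. For h >= 0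
    of class C1 with compact support, the divergence theorem gives
      c0 int h + int <grad h, grad b> <= 0                                                       (2)
    and for h = |f|^p Young's inequality, applied to |grad h| <= p |f|^(p-1) |grad f|, turns this into
    (c0/p)^p int |f|^p <= int |grad f|^p for every test function f.

    Inequality (1) is proved in a chart, as [divergence_ge]. Its two ingredients are an identity for
    the coordinate divergence of sqrt(det g) (grad b) which only involves the first and second
    derivatives of the parametrization ([divergence_formula], resting on Jacobi's formula for the
    derivative of a determinant and on the symmetry of second derivatives), and the expression of the
    second fundamental form by the Christoffel symbols of the half-space ([mean_curvature_nu]).

    The divergence theorem is only used in the form: the partial derivatives of a compactly supported C1
    function on R^n have integral zero ([integral_derive_eq0]), by translation invariance of Lebesgue
    measure. This proves (2) for h supported in a chart; the general case is [drift_le0_compact], by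
    cutting h into such pieces with finitely many C1 cutoff functions.

    Two points remain for W^{1,p}_0. An approximation by test functions is turned into inequalities by
    (a + b)^p <= k a^p + L b^p with k > 1 arbitrarily close to 1 ([powR_add_le]). And a geodesic ball
    may a priori fail to be measurable, so the integrals over it are first replaced by integrals over
    a measurable part which carries the function, its gradient and all the approximating test
    functions ([W0_measurable_part]). Extension by zero from such a part also makes the eigenvalue
    antitone in the domain, so that its limit over growing balls exists and is at least (c0/p)^p. *)

(** * Lebesgue measure on R^n *)

Section BorelBasics.

Lemma borel_continuous_measurable (T T' : ptopologicalType) (D : set T) (f : T -> T') :
  open D -> (forall x, D x -> {for x, continuous f}) ->
  measurable_fun (D : set (g_sigma_algebraType (@open T)))
    (f : _ -> g_sigma_algebraType (@open T')).
Proof.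
move=> oD cf; apply: (@measurability _ _ (g_sigma_algebraType (@open T)) (g_sigma_algebraType (@open T')) D f (@open T')) => //.
move=> _ [B oB <-]; apply: sub_sigma_algebra.
rewrite openE => x [Dx Bfx]; rewrite /interior.
apply: filterI; first exact: open_nbhs_nbhs.
by apply: cf => //; exact: open_nbhs_nbhs.
Qed.

Lemma borel_id_measurable (R : realType) :
  measurable_fun setT (id : g_sigma_algebraType (@open R) -> measurableTypeR R).
Proof.
apply: (measurability _ (RGenOpens.measurableE R)).
move=> _ [_ [a [b ->]] <-]; rewrite setTI; apply: sub_sigma_algebra.
exact: interval_open.
Qed.

Lemma borel_continuous_measurable_real (R : realType) (T : ptopologicalType)
    (D : set T) (f : T -> R) :
  open D -> (forall x, D x -> {for x, continuous f}) ->
  measurable_fun (D : set (g_sigma_algebraType (@open T)))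
    (f : _ -> measurableTypeR R).
Proof.
move=> oD cf.
exact: (@measurableT_comp _ _ _ (g_sigma_algebraType (@open T)) (g_sigma_algebraType (@open R))
  (measurableTypeR R) id D f (@borel_id_measurable R) (borel_continuous_measurable oD cf)).
Qed.

End BorelBasics.

Definition borelV (R : realType) (n : nat) := g_sigma_algebraType (@open 'rV[R]_n).

Section ConsRow.
Context {R : realType} {n : nat}.

(** Prepends a coordinate, as in the recursion that defines [leb_int]. *)
Definition consv (ty : R * 'rV[R]_n) : 'rV[R]_n.+1 :=
  row_mx (const_mx ty.1 : 'rV[R]_1) ty.2.

Lemma consv0 ty : consv ty 0 0 = ty.1.
Proof.
rewrite /consv mxE; case: splitP => /= j; last by [].
by rewrite mxE.
Qed.

Lemma consvS ty j : consv ty 0 (lift ord0 j) = ty.2 0 j.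
Proof.
rewrite /consv mxE; case: splitP => /= k; rewrite /bump /=.
  by case: k => [[]].
by rewrite add1n => -[] e; congr (_ _ _); apply: val_inj.
Qed.

Lemma consvD ty ty' : consv (ty.1 + ty'.1, ty.2 + ty'.2) = consv ty + consv ty'.
Proof.
apply/rowP => j; case: (unliftP ord0 j) => [k|] ->.
  by rewrite [RHS]mxE !consvS [LHS]mxE.
by rewrite [RHS]mxE !consv0.
Qed.

Lemma consv_eta (v : 'rV[R]_n.+1) : consv (v 0 0, \row_j v 0 (lift ord0 j)) = v.
Proof.
apply/rowP => j; case: (unliftP ord0 j) => [k|] ->.
  by rewrite consvS mxE.
by rewrite consv0.
Qed.

Lemma consv_ball ty ty' e :
  ball (consv ty) e (consv ty') <-> ball ty.1 e ty'.1 /\ ball ty.2 e ty'.2.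
Proof.
split=> [[e0 H]|[H1 [e0 H2]]].
  split; first by have := H 0 0; rewrite !consv0.
  split=> // i j; rewrite (ord1 i).
  by have := H 0 (lift ord0 j); rewrite !consvS.
split=> // i j; rewrite (ord1 i); case: (unliftP ord0 j) => [k|] ->.
  by rewrite !consvS; exact: H2.
by rewrite !consv0.
Qed.

End ConsRow.

Section RatBalls.
Context {R : realType} {n : nat}.

(** Only countably many balls are needed, so that the Borel sets of R^(n+1) are measurable for the
    product of the sigma-algebras of R and R^n. *)
Lemma open_rV_bigcup_ball (U : set 'rV[R]_n) : open U ->
  exists P : set ('rV[rat]_n * rat),
  U = \bigcup_(qe in P) ball (map_mx ratr qe.1 : 'rV[R]_n) (ratr qe.2).
Proof.
move=> oU; exists [set qe | ball (map_mx ratr qe.1 : 'rV[R]_n) (ratr qe.2 : R) `<=` U].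
rewrite eqEsubset; split; last by move=> x [qe /= ]; apply.
move=> x Ux; have /nbhs_ballP[e e0 xeU] := open_nbhs_nbhs (conj oU Ux).
have [r] := rat_in_itvoo (divr_gt0 e0 (ltr0n R 2)).
rewrite in_itv/= => /andP[r0 re].
have Hq (i : 'I_n) : exists q : rat, `|x 0 i - ratr q| < ratr r.
  have [q] : exists q : rat, (ratr q : R) \in `]x 0 i - ratr r, x 0 i + ratr r[.
    by apply: rat_in_itvoo; lra.
  by rewrite in_itv/= => Hq; exists q; rewrite ltr_norml; lra.
pose q : 'rV[rat]_n := \row_i sval (cid (Hq i)).
have xq : ball (map_mx ratr q : 'rV[R]_n) (ratr r) x.
  split => // i j; rewrite (ord1 i) /ball/= !mxE distrC.
  by case: cid.
exists (q, r) => //= y qy; apply: xeU.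
apply: (@le_ball _ _ x (ratr r + ratr r)); first by lra.
by apply: ball_triangle qy; exact: ball_sym.
Qed.

End RatBalls.

Lemma consv_measurable (R : realType) n :
  measurable_fun setT (consv : measurableTypeR R * borelV R n -> borelV R n.+1).
Proof.
apply: (@measurability _ _ (measurableTypeR R * borelV R n)%type (borelV R n.+1) setT consv (@open 'rV[R]_n.+1)) => //.
move=> _ [U oU <-]; rewrite setTI.
have [P ->] := open_rV_bigcup_ball oU.
rewrite preimage_bigcup.
rewrite [X in measurable X](_ : _ = \bigcup_(qe : 'rV[rat]_n.+1 * rat)
   (if qe \in P then (consv @^-1` ball (map_mx ratr qe.1 : 'rV[R]_n.+1) (ratr qe.2)) else set0)); last first.
  rewrite eqEsubset; split=> [ty [qe Pqe H]|ty [qe _]].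
    by exists qe => //; rewrite mem_set.
  by case: ifPn => // /set_mem Pqe H; exists qe.
apply: countable_bigcupT_measurable => //.
move=> [q e] /=; case: ifPn => // _.
rewrite -(consv_eta (map_mx ratr q)).
rewrite [X in measurable X](_ : _ = ball (ratr (q 0 0) : R) (ratr e) `*`
   ball (\row_j ratr (q 0 (lift ord0 j)) : 'rV[R]_n) (ratr e)); last first.
  apply/seteqP; split=> [ty /=|ty /= H].
    by move/consv_ball; rewrite /= !mxE; under eq_mx do rewrite mxE.
  by apply/consv_ball; rewrite /= !mxE; under eq_mx do rewrite mxE.
apply: measurableX; first exact: measurable_ball.
by apply: sub_sigma_algebra; exact: ball_open.
Qed.

Section LebesgueRow.
Context {R : realType}.
Local Open Scope ereal_scope.

(** Finiteness on balls is carried along the induction on n: it gives the sigma-finiteness that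
    Tonelli's theorem asks for at the next step. *)
Definition computes_leb_int n (mu : {sigma_finite_measure set (borelV R n) -> \bar R}) :=
  (forall h : borelV R n -> \bar R, measurable_fun setT h -> (forall x, 0 <= h x) ->
     leb_int h = \int[mu]_x h x) /\
  (forall r : R, (0 < r)%R -> mu (ball (0%R : 'rV[R]_n) r : set (borelV R n)) < +oo).

Lemma computes_leb_int0 : exists mu, @computes_leb_int 0 mu.
Proof.
exists (\d_(0%R : borelV R 0)); split=> [h mh h0|r r0] /=.
  by rewrite integral_dirac// diracE in_setT mul1e.
by rewrite diracE; case: (_ \in _); rewrite /= ltry.
Qed.

(** A name on which a canonical sigma-finite structure can be declared from a proof of
    sigma-finiteness. *)
Definition sigma_finite_copy d (T : measurableType d) (m : {measure set T -> \bar R})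
  (_ : sigma_finite setT m) : set T -> \bar R := m.

Section SigmaFiniteCopy.
Context d (T : measurableType d) (m : {measure set T -> \bar R}) (sf : sigma_finite setT m).
Let m' := sigma_finite_copy sf.
Let m'0 : m' set0 = 0. Proof. exact: measure0. Qed.
Let m'ge0 A : 0 <= m' A. Proof. exact: measure_ge0. Qed.
Let m'sigma : semi_sigma_additive m'. Proof. exact: measure_semi_sigma_additive. Qed.
HB.instance Definition _ := isMeasure.Build _ _ _ m' m'0 m'ge0 m'sigma.
HB.instance Definition _ := Measure_isSigmaFinite.Build _ _ _ m' sf.

Lemma sigma_finite_pack : exists m' : {sigma_finite_measure set T -> \bar R},
    m' = m :> (set T -> \bar R).
Proof. by exists m'. Qed.
End SigmaFiniteCopy.

(** The measure in dimension n+1 is the image by [consv] of the product with Lebesgue measure, and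
    the recursion of [leb_int] is Tonelli's theorem for it. *)
Lemma computes_leb_intS n (mu : {sigma_finite_measure set (borelV R n) -> \bar R}) :
  computes_leb_int mu -> exists mu', @computes_leb_int n.+1 mu'.
Proof.
move=> [muE muB].
pose la : {sigma_finite_measure set (measurableTypeR R) -> \bar R} := @lebesgue_measure R.
pose nu : {measure set _ -> \bar R} := (la \x mu).
pose m : {measure set (borelV R n.+1) -> \bar R} :=
  measure_function_pushforward__canonical__measure_function_Measure nu (@consv_measurable R n).
have mE A : m A = nu (consv @^-1` A) by [].
have mB r : (0 < r)%R -> m (ball (0%R : 'rV[R]_n.+1) r) < +oo.
  move=> r0; rewrite mE.
  have -> : consv @^-1` ball (0%R : 'rV[R]_n.+1) r =
     ball (0%R:R) r `*` ball (0%R : 'rV[R]_n) r.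
    have e0 : (0%R : 'rV[R]_n.+1) = consv (0%R, 0%R).
      by rewrite -[LHS]consv_eta; congr (consv (_, _)); [rewrite mxE|apply/rowP => j; rewrite !mxE].
    by apply/seteqP; rewrite e0; split=> ty; rewrite /= consv_ball.
  have mb : measurable (ball (0%R : 'rV[R]_n) r : set (borelV R n)).
    by apply: sub_sigma_algebra; exact: ball_open.
  have mr : measurable (ball (0%R : R) r : set (measurableTypeR R)).
    exact: measurable_ball.
  have -> : nu (ball (0%R:R) r `*` ball (0%R : 'rV[R]_n) r) =
      la (ball (0%R:R) r) * mu (ball (0%R : 'rV[R]_n) r) by exact: product_measure1E.
  rewrite lte_mul_pinfty//; last exact: muB.
  by rewrite /la /= lebesgue_measure_ball ?ltW.
have sf : sigma_finite setT m.
  exists (fun k => ball (0%R : 'rV[R]_n.+1) k.+1%:R).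
    rewrite eqEsubset; split=> // x _; exists (Num.truncn `|x|) => //.
    by rewrite -ball_normE /ball_/= sub0r normrN truncnS_gt.
  move=> k; split; last exact: mB.
  by apply: sub_sigma_algebra; exact: ball_open.
have [m' m'E] := sigma_finite_pack sf.
exists m'; split; last by move=> r r0; rewrite m'E; exact: mB.
move=> h mh h0.
transitivity (\int[m]_x h x); last by apply: eq_measure_integral => A _ _; exact: (esym (congr1 (fun f => f A) m'E)).
rewrite [RHS](_ : _ = \int[nu]_ty h (consv ty)); last first.
  rewrite -(@ge0_integral_pushforward _ _ _ _ _ _ (@consv_measurable R n) nu setT h)//.
rewrite /nu fubini_tonelli1//=; last exact: (measurableT_comp mh (@consv_measurable R n)).
apply: eq_integral => t _; rewrite /fubini_F -muE//.
apply: (measurableT_comp mh) => //.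
exact: (measurableT_comp (@consv_measurable R n) (pair1_measurable t)).
Qed.

Lemma leb_measure_exists n : exists mu, @computes_leb_int n mu.
Proof.
elim: n => [|n [mu Hmu]]; first exact: computes_leb_int0.
exact: (computes_leb_intS Hmu).
Qed.

Definition lebV n : {sigma_finite_measure set (borelV R n) -> \bar R} :=
  sval (cid (leb_measure_exists n)).

Lemma leb_intE n (h : borelV R n -> \bar R) : measurable_fun setT h -> (forall x, 0 <= h x) ->
     leb_int h = \int[lebV n]_x h x.
Proof. by move=> mh h0; rewrite /lebV; case: cid => mu [H _] /=; exact: H. Qed.

Lemma lebV_ball n (r : R) : (0 < r)%R -> lebV n (ball (0%R : 'rV[R]_n) r : set (borelV R n)) < +oo.
Proof. by move=> r0; rewrite /lebV; case: cid => mu [_ H] /=; exact: H. Qed.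

(** Translations preserve the length of intervals, which determines Lebesgue measure. *)
Lemma lebesgue_measure_shift (a : R) (A : set (measurableTypeR R)) : measurable A ->
  pushforward lebesgue_measure (fun x : measurableTypeR R => (x + a)%R : measurableTypeR R) A = lebesgue_measure A.
Proof.
have ms : measurable_fun setT (fun x : measurableTypeR R => (x + a)%R : measurableTypeR R).
  by apply: measurable_funD => //; exact: measurable_id.
pose m : {measure set (measurableTypeR R) -> \bar R} :=
  measure_function_pushforward__canonical__measure_function_Measure
    (@lebesgue_measure R) ms.
move=> mA; apply/esym/(lebesgue_measure_unique (mu := m)) => //= _ [[c d]] _ <-.
rewrite /pushforward (_ : _ @^-1` _ = `](c - a)%R, (d - a)%R]%classic); last first.
  by apply/seteqP; split=> x /=; rewrite !in_itv/= ltrBlDr lerBrDr.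
rewrite !lebesgue_measure_itv/= !lte_fin ltrD2r.
by case: ifP => // _; rewrite -!EFinB; congr (_%:E); ring.
Qed.

Lemma ge0_integral_shift (a : R) (f : R -> \bar R) : measurable_fun setT f ->
  (forall x, 0 <= f x) ->
  \int[lebesgue_measure]_x f (x + a)%R = \int[lebesgue_measure]_x f x.
Proof.
move=> mf f0.
have ms : measurable_fun setT (fun x : measurableTypeR R => (x + a)%R : measurableTypeR R).
  by apply: measurable_funD => //; exact: measurable_id.
transitivity (\int[pushforward lebesgue_measure (fun x : measurableTypeR R => (x + a)%R : measurableTypeR R)]_x f x).
  by rewrite (@ge0_integral_pushforward _ _ _ _ _ _ ms (@lebesgue_measure R) setT f).
by apply: eq_measure_integral => A mA _; exact: lebesgue_measure_shift.
Qed.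

(** Translate the first coordinate after the others, inside the iterated integral. *)
Lemma ge0_integral_lebV_shift n (v : 'rV[R]_n) (h : borelV R n -> \bar R) :
  measurable_fun setT h -> (forall x, 0 <= h x) ->
  \int[lebV n]_x h (x + v)%R = \int[lebV n]_x h x.
Proof.
move=> mh h0; rewrite -!leb_intE//; last first.
  apply: (@measurableT_comp _ _ _ (borelV R n) (borelV R n) _ h setT (fun x => (x + v)%R : borelV R n) mh).
  apply: (@borel_continuous_measurable _ _ setT (fun x : 'rV[R]_n => (x + v)%R : 'rV[R]_n)); first exact: openT.
  by move=> x _; apply: continuousD; [exact: cvg_id|exact: cst_continuous].
elim: n v h mh h0 => [|n IH] v h mh h0 /=.
  by congr h; apply/rowP => -[].
pose v' : 'rV[R]_n := \row_j v 0%R (lift ord0 j).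
have mt t : measurable_fun setT (fun y : borelV R n => h (consv (t, y))).
  apply: (measurableT_comp mh) => //.
  exact: (measurableT_comp (@consv_measurable R n) (pair1_measurable t)).
pose F t := leb_int (fun y : 'rV[R]_n => h (consv (t, y))).
transitivity (\int[lebesgue_measure]_t F (t + v 0%R 0%R)%R).
  apply: eq_integral => t _; rewrite /F.
  rewrite -(IH v' (fun y : 'rV[R]_n => h (consv ((t + v 0%R 0%R)%R, y))))//.
  congr leb_int; apply/funext => y; congr h.
  by rewrite -[v in LHS]consv_eta -[row_mx _ _]/(consv (t, y)) -consvD.
rewrite ge0_integral_shift//.
- have -> : F = fun t => \int[lebV n]_y h (consv (t, y)).
    by apply/funext => t; rewrite /F leb_intE.
  apply: (@measurable_fun_fubini_tonelli_F _ _ _ _ _ (lebV n) (h \o consv)); last by move=> ?; exact: h0.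
  exact: (measurableT_comp mh (@consv_measurable R n)).
- by move=> t; rewrite /F leb_intE//; apply: integral_ge0.
Qed.

End LebesgueRow.

(** * Integrals of derivatives *)

Section DerivativeIntegral.
Context {R : realType}.

Lemma is_derive_line (V W : normedModType R) (f : V -> W) (x v : V) (t : R) :
  derivable f (t *: v + x) v ->
  is_derive t 1 (fun s => f (s *: v + x)) ('D_v f (t *: v + x)).
Proof.
have E : (fun h : R => h^-1 *: (((fun s => f (s *: v + x)) \o shift t) (h *: (1 : R)) - f (t *: v + x)))
       = (fun h : R => h^-1 *: ((f \o shift (t *: v + x)) (h *: v) - f (t *: v + x))).
  by apply/funext => h /=; rewrite scalerDl addrA [h *: 1]mulr1.
by move=> df; split; rewrite /derivable/derive E.
Qed.

Lemma continuous_borelV_measurable n (g : 'rV[R]_n -> R) : continuous g ->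
  measurable_fun setT (g : borelV R n -> measurableTypeR R).
Proof.
by move=> cg; apply: (@borel_continuous_measurable_real R _ setT g openT) => x _; exact: cg.
Qed.

Lemma closed_norm_le n (r : R) : compact [set x : 'rV[R]_n | `|x| <= r].
Proof.
apply: bounded_closed_compact.
  by exists r; split; [exact: num_real|move=> M rM x /= xr; exact: le_trans xr (ltW rM)].
have -> : [set x : 'rV[R]_n | `|x| <= r] = (fun x => `|x|) @^-1` [set t | t <= r] by [].
by apply: preimage_closed; [move=> x _; exact: norm_continuous|exact: closed_le].
Qed.

Lemma continuous_compact_support_bounded n (f : 'rV[R]_n -> R) (r : R) :
  continuous f -> (forall x, r < `|x| -> f x = 0) ->
  exists2 M : R, 0 <= M & forall x, `|f x| <= M.
Proof.
move=> cf f0.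
have : compact (f @` [set x | `|x| <= r]).
  apply: (@continuous_compact _ _ f [set x | `|x| <= r] _ (@closed_norm_le n r)).
  exact: continuous_subspaceT.
move=> /compact_bounded [M [_ HM]].
exists (`|M| + 1) => [|x]; first by rewrite addr_ge0.
have [xr|xr] := leP `|x| r; last by rewrite f0// normr0 addr_ge0.
by apply: (HM (`|M| + 1)); [rewrite ltr_pwDr// ler_norm|exists x].
Qed.

Lemma continuous_compact_support_integrable n (g : 'rV[R]_n -> R) (r : R) :
  continuous g -> (forall x, r < `|x| -> g x = 0) ->
  (lebV n).-integrable setT (EFin \o g : borelV R n -> _).
Proof.
move=> cg g0; have [K K0 gK] := continuous_compact_support_bounded cg g0.
pose B : set (borelV R n) := ball (0 : 'rV[R]_n) (`|r| + 1).
have mB : measurable B by apply: sub_sigma_algebra; exact: ball_open.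
have fB : (lebV n B < +oo)%E by apply: lebV_ball; rewrite ltr_wpDl.
have : (lebV n).-integrable B (EFin \o g).
  apply: measurable_bounded_integrable => //.
    apply: (@measurable_funS _ _ _ _ setT) => //.
    exact: continuous_borelV_measurable.
  by exists K; split; [exact: num_real|move=> L KL x _; rewrite /= (le_trans (gK x))// ltW].
rewrite (integrable_mkcond _ mB)/=; congr integrable.
apply/funext => x; rewrite /patch; case: ifPn => // /negP xB.
rewrite /= g0//; rewrite ltNge; apply/negP => xr; apply: xB; apply/mem_set.
rewrite /B -ball_normE /ball_/= sub0r normrN; apply: le_lt_trans xr _.
by rewrite (le_lt_trans (ler_norm r))// ltrDl.
Qed.

Lemma derive_out n (V : 'rV[R]_n -> R) (v : 'rV[R]_n) (r : R) :
  (forall x, r < `|x| -> V x = 0) -> forall x, r < `|x| -> 'D_v V x = 0.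
Proof.
move=> V0 x rx.
have -> : 'D_v V x = 'D_v (cst 0) x; last exact: derive_cst.
apply: near_eq_derive.
have : \forall y \near x, r < `|y|.
  have oA : open [set y : 'rV[R]_n | r < `|y|].
    apply: (@open_comp _ _ (fun y : 'rV[R]_n => `|y|) [set t | r < t]); last exact: open_gt.
    by move=> ? _; exact: norm_continuous.
  exact: (open_nbhs_nbhs (conj oA rx)).
by apply: filterS => y; exact: V0.
Qed.

Lemma integral_lebV_shift n (V : 'rV[R]_n -> R) (w : 'rV[R]_n) : continuous V ->
  (\int[lebV n]_x (V (x + w))%:E = \int[lebV n]_x (V x)%:E)%E.
Proof.
move=> cV.
have mV : measurable_fun setT (fun x : borelV R n => (V x)%:E).
  by apply/measurable_EFinP; exact: continuous_borelV_measurable.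
rewrite integralE [RHS]integralE; congr (_ - _)%E.
  rewrite -(@ge0_integral_lebV_shift R n w (fun x : borelV R n => (V x)%:E)^\+%E)//.
    by apply: eq_integral => x _; rewrite !funeposE.
  exact: measurable_funepos mV.
rewrite -(@ge0_integral_lebV_shift R n w (fun x : borelV R n => (V x)%:E)^\-%E)//.
  by apply: eq_integral => x _; rewrite !funenegE.
exact: measurable_funeneg mV.
Qed.

(** The difference quotients of V along v have integral zero by translation invariance. By the mean
    value theorem they are bounded by the supremum of |D_v V|, on a ball which does not depend on the
    step; so dominated convergence applies. *)
Lemma integral_derive_eq0 n (V : 'rV[R]_n -> R) (v : 'rV[R]_n) (r : R) :
  continuous V -> (forall x, derivable V x v) -> continuous ('D_v V) ->
  (forall x, r < `|x| -> V x = 0) ->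
  (lebV n).-integrable setT (fun x : borelV R n => ('D_v V x)%:E) /\
  (\int[lebV n]_x ('D_v V x)%:E = 0)%E.
Proof.
move=> cV dV cDV V0.
have [M M0 HM] := continuous_compact_support_bounded cDV (@derive_out _ V v _ V0).
(* The steps v / (k + 1); the radius of B accounts for the support of the translates V (x + w k). *)
pose w k : 'rV[R]_n := k.+1%:R^-1 *: v.
have mc (g : 'rV[R]_n -> R) : continuous g -> measurable_fun setT (EFin \o g : borelV R n -> _).
  by move=> cg; apply/measurable_EFinP; exact: continuous_borelV_measurable.
have csh (g : 'rV[R]_n -> R) k : continuous g -> continuous (fun x : 'rV[R]_n => g (x + w k)).
  move=> cg x; apply: (@continuous_comp _ _ _ (fun x : 'rV[R]_n => x + w k) g); last exact: cg.
  by apply: continuousD; [exact: cvg_id|exact: cst_continuous].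
pose B : set (borelV R n) := ball (0 : 'rV[R]_n) (`|r| + `|v| + 1).
have mB : measurable B by apply: sub_sigma_algebra; exact: ball_open.
have B0 x : ~ B x -> `|r| + `|v| + 1 <= `|x|.
  by rewrite /B -ball_normE /ball_/= sub0r normrN => /negP; rewrite -leNgt.
have fB : (lebV n B < +oo)%E by apply: lebV_ball; rewrite ltr_wpDl// addr_ge0.
have wv k : `|w k| <= `|v|.
  rewrite normrZ ger0_norm ?invr_ge0// ler_piMl// invf_le1// ler1n//.
pose f k (x : borelV R n) : \bar R := (k.+1%:R * (V (x + w k) - V x))%:E.
have f0 k : (\int[lebV n]_x f k x = 0)%E.
  have iV : (lebV n).-integrable setT (EFin \o V : borelV R n -> _).
    exact: (continuous_compact_support_integrable cV V0).
  have iVw : (lebV n).-integrable setT ((fun x => (V (x + w k))%:E) : borelV R n -> _).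
    apply: (@continuous_compact_support_integrable n (fun x => V (x + w k)) (`|r| + `|v|)).
      exact: csh.
    move=> x H; apply: V0; have := ler_normB (x + w k) (w k); rewrite addrK => H1.
    have := wv k; have := ler_norm r; lra.
  rewrite /f; under eq_integral do rewrite EFinM.
  rewrite integralZl//; last first.
    by under eq_fun do rewrite EFinB; exact: integrableB.
  under eq_integral do rewrite EFinB.
  rewrite integralB//.
  suff -> : (\int[lebV n]_x (V (x + w k))%:E = \int[lebV n]_x (V x)%:E)%E.
    by rewrite subee ?mule0//; exact: integrable_fin_num.
  exact: integral_lebV_shift.
have fM k x : `|V (x + w k) - V x| <= k.+1%:R^-1 * M.
  pose g s := V (s *: v + x).
  have [|s _||] := @MVT R g (fun s => 'D_v V (s *: v + x)) 0 k.+1%:R^-1.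
  - by rewrite invr_gt0.
  - exact: is_derive_line.
  - apply: continuous_subspaceT => s; apply: (@continuous_comp _ _ _ (fun s : R => s *: v + x) V); last exact: cV.
    by apply: continuousD; [exact: scalel_continuous|exact: cst_continuous].
  move=> s _; rewrite /g scale0r add0r subr0 [_ + x]addrC => ->.
  by rewrite normrM mulrC ler_pM// ger0_norm// invr_ge0.
have ig : (lebV n).-integrable setT (fun x => (M * \1_B x)%:E).
  have : (lebV n).-integrable B (EFin \o cst M).
    apply: measurable_bounded_integrable => //.
    by exists `|M|; split; [exact: num_real|move=> L KL x _; exact: ltW].
  rewrite (integrable_mkcond _ mB)/=; congr integrable.
  apply/funext => x; rewrite /patch indicE; case: ifPn => _ /=; by rewrite ?mulr1 ?mulr0.
have fcvg (x : borelV R n) : f ^~ x @ \oo --> ('D_v V x)%:E.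
  apply: cvg_EFin => //; first by near=> k.
  have /derivableP[dVx _] := dV x.
  have H1 : (fun h : R => h^-1 *: ((V \o shift (x : 'rV[R]_n)) (h *: v) - V x)) @ 0^' --> 'D_v V x by exact: dV.
  have H2 : (fun k : nat => k.+1%:R^-1 : R) @ \oo --> 0^'.
    move=> A [e /= e0 He]; have : \forall k \near \oo, ball (0 : R) e (@harmonic R k).
      by apply: cvg_harmonic; exact: nbhsx_ballx.
    apply: filterS => k Hk; apply: (He _ Hk); by rewrite invr_eq0 pnatr_eq0.
  have := cvg_comp _ _ H2 H1; apply: cvg_trans; apply: near_eq_cvg; near=> k.
  by rewrite /f /= invrK [X in V X]addrC.
have mf k : measurable_fun setT (f k).
  apply/(@measurable_EFinP _ (borelV R n)).
  apply: (@continuous_borelV_measurable n (fun x => k.+1%:R * (V (x + w k) - V x))).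
  move=> x; have c1 : {for x, continuous (fun x : 'rV[R]_n => V (x + w k))} by exact: csh.
  exact: (continuousM (@cst_continuous _ _ (k.+1%:R : R) x) (continuousB c1 (cV x))).
have [||i _ c] := @dominated_convergence _ _ _ (lebV n) setT measurableT f (fun x => ('D_v V x)%:E)
   (fun x => (M * \1_B x)%:E) mf (mc _ cDV) _ ig _.
- exact: aeW.
- apply: aeW => x k _; rewrite /f /= lee_fin indicE.
  have [/set_mem xB|/negP xB] := boolP (x \in B).
    rewrite mulr1 normrM ger0_norm// -(@ler_pM2l _ k.+1%:R^-1) ?invr_gt0// mulrA mulVf ?pnatr_eq0// mul1r.
    exact: fM.
  rewrite mulr0 normr_le0 mulf_eq0; apply/orP; right.
  have H : `|r| + `|v| + 1 <= `|x| by apply: B0 => Bx; apply: xB; rewrite mem_set.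
  rewrite !V0 ?subrr//.
    by have := ler_norm r; have := normr_ge0 v; lra.
  have := ler_normB (x + w k) (w k); rewrite addrK => H1.
  by have := wv k; have := ler_norm r; lra.
split=> //.
have /cvg_lim <- // := c.
by under eq_fun do rewrite f0; exact: lim_cst.
Unshelve. all: by end_near. Qed.

End DerivativeIntegral.

(** * C1 calculus *)

Section C1Calculus.
Context {R : realType}.

(** The differential is defined by a choice, so the locality of differentiability has to come from
    the expansion at the point: a function which vanishes near x is its own remainder. *)
Lemma near0_differentiable (V W : normedModType R) (k : V -> W) (x : V) :
  (\near x, k x = 0) -> differentiable k x.
Proof.
move=> k0; have kx0 : k x = 0 by exact: nbhs_singleton k0.
have E : k \o shift x = cst (k x) + (0 : V -> W) +o_ 0 id.
  rewrite kx0; apply: eqaddoE; rewrite addr0 add0r; apply/eqoP => _/posnumP[e].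
  have : \forall y \near (0 : V), k (y + x) = 0.
    have H : {for 0, continuous (fun y : V => y + x)}.
      by apply: continuousD; [exact: cvg_id|exact: cst_continuous].
    by apply: (H [set z | k z = 0]); rewrite /= add0r.
  by apply: filterS => y /= ->; rewrite normr0 mulr_ge0.
have c0 : continuous (0 : V -> W) by exact: cst_continuous.
by apply/diff_locallyP; rewrite (@diff_unique _ _ _ k \0 x c0 E).
Unshelve. all: by end_near. Qed.

Lemma near_eq_differentiable (V W : normedModType R) (f g : V -> W) (x : V) :
  (\near x, f x = g x) -> differentiable f x -> differentiable g x.
Proof.
move=> fg df; have -> : g = f + (g - f) by apply/funext => y; rewrite /= addrC subrK.
apply: differentiableD => //; apply: near0_differentiable.
by apply: filterS fg => y fgy; rewrite -[LHS]/(g y - f y) fgy subrr.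
Qed.

Lemma near_eq_continuous (T U : topologicalType) (f g : T -> U) (x : T) :
  (\near x, f x = g x) -> {for x, continuous f} -> {for x, continuous g}.
Proof.
move=> fg cf; rewrite /prop_for /continuous_at -(nbhs_singleton fg).
by apply: cvg_trans cf; exact: near_eq_cvg.
Qed.

Lemma continuous_sum (T : topologicalType) (I : Type) (r : seq I) (P : pred I)
    (f : I -> T -> R) (x : T) : (forall i, P i -> {for x, continuous (f i)}) ->
  {for x, continuous (fun y => \sum_(i <- r | P i) f i y)}.
Proof.
move=> cf; elim: r => [|i r IH].
  have -> : (fun y => \sum_(i <- [::] | P i) f i y) = cst 0 by apply/funext => y; rewrite big_nil.
  exact: cst_continuous.
case: (boolP (P i)) => Pi.
  have -> : (fun y => \sum_(i <- i :: r | P i) f i y) = (fun y => f i y + \sum_(i <- r | P i) f i y).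
    by apply/funext => y; rewrite big_cons Pi.
  exact: (continuousD (cf i Pi) IH).
have -> : (fun y => \sum_(i <- i :: r | P i) f i y) = (fun y => \sum_(i <- r | P i) f i y) => //.
by apply/funext => y; rewrite big_cons (negbTE Pi).
Qed.

(** The pointwise form of [Ck_on 1], which composes without keeping track of open sets. *)
Variant C1_at (V W : normedModType R) (f : V -> W) (x : V) : Prop :=
  C1At of (\forall y \near x, differentiable f y) & (forall v, {for x, continuous ('D_v f)}).

Lemma C1_onP (V W : normedModType R) (U : set V) (f : V -> W) : open U ->
  Ck_on 1 U f <-> (forall x, U x -> C1_at f x).
Proof.
move=> oU; split=> [[d c] x Ux|H].
  split; last by move=> v; exact: c.
  by have := open_nbhs_nbhs (conj oU Ux); apply: filterS; exact: d.
split=> [x /H[/nbhs_singleton]//|v x /H[_]]; exact.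
Qed.

Lemma C1_at_near (V W : normedModType R) (f g : V -> W) (x : V) :
  (\near x, f x = g x) -> C1_at f x -> C1_at g x.
Proof.
move=> fg [df cf]; split.
  have := near_join fg => fg2.
  near=> y; apply: (@near_eq_differentiable _ _ f); near: y => //.
move=> v; have H : \forall y \near x, 'D_v f y = 'D_v g y.
  have := near_join fg; apply: filterS => y; exact: near_eq_derive.
exact: near_eq_continuous H (cf v).
Unshelve. all: by end_near. Qed.

Lemma C1_at_continuous (V W : normedModType R) (f : V -> W) (x : V) :
  C1_at f x -> {for x, continuous f}.
Proof. by move=> [/nbhs_singleton/differentiable_continuous]. Qed.

Lemma C1_at_derivable (V W : normedModType R) (f : V -> W) (x v : V) :
  C1_at f x -> derivable f x v.
Proof. by move=> [/nbhs_singleton/diff_derivable]. Qed.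

(** All closure properties below are proved by giving a formula for the derivatives near x. *)
Lemma C1_at_intro (V W : normedModType R) (f : V -> W) (df : V -> V -> W) (x : V) :
  (\forall y \near x, differentiable f y /\ forall v, 'D_v f y = df y v) ->
  (forall v, {for x, continuous (fun y => df y v)}) -> C1_at f x.
Proof.
move=> Hd Hc; split; first by apply: filterS Hd => y [].
move=> v; have H : \forall y \near x, df y v = 'D_v f y.
  by apply: filterS Hd => y [_ ->].
exact: near_eq_continuous H (Hc v).
Qed.

Lemma C1_at_id (V : normedModType R) (x : V) : C1_at id x.
Proof.
apply: (@C1_at_intro V V id (fun _ v => v)); last by move=> v; exact: cst_continuous.
by near=> y; split=> [|v]; [exact: ex_diff|exact: derive_id].
Unshelve. all: by end_near. Qed.

Section Scalar.
Variables (V : normedModType R).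
Implicit Types (f g : V -> R) (x : V).

Lemma C1_at_cst (a : R) x : C1_at (fun=> a) x.
Proof.
apply: (@C1_at_intro _ _ (cst a) (fun _ _ => 0)).
  by near=> y; split=> [|v]; [exact: differentiable_cst|exact: derive_cst].
by move=> v; exact: cst_continuous.
Unshelve. all: by end_near. Qed.

Lemma C1_atD f g x : C1_at f x -> C1_at g x -> C1_at (fun y => f y + g y) x.
Proof.
move=> Cf Cg; have [df cf] := Cf; have [dg cg] := Cg.
apply: (@C1_at_intro _ _ _ (fun y v => 'D_v f y + 'D_v g y)).
  near=> y.
  have dfy : differentiable f y by near: y.
  have dgy : differentiable g y by near: y.
  split=> [|v]; first exact: differentiableD.
  by apply: deriveD; exact: diff_derivable.
move=> v; exact: (continuousD (cf v) (cg v)).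
Unshelve. all: by end_near. Qed.

Lemma C1_atM f g x : C1_at f x -> C1_at g x -> C1_at (fun y => f y * g y) x.
Proof.
move=> Cf Cg; have [df cf] := Cf; have [dg cg] := Cg.
apply: (@C1_at_intro _ _ _ (fun y v => f y * 'D_v g y + g y * 'D_v f y)).
  near=> y.
  have dfy : differentiable f y by near: y.
  have dgy : differentiable g y by near: y.
  split=> [|v]; first exact: differentiableM.
  by apply: deriveM; exact: diff_derivable.
move=> v; have cfx := C1_at_continuous Cf; have cgx := C1_at_continuous Cg.
exact: (continuousD (continuousM cfx (cg v)) (continuousM cgx (cf v))).
Unshelve. all: by end_near. Qed.

Lemma C1_atZ (a : R) f x : C1_at f x -> C1_at (fun y => a * f y) x.
Proof. exact: (C1_atM (C1_at_cst a x)). Qed.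

Lemma C1_atN f x : C1_at f x -> C1_at (fun y => - f y) x.
Proof.
move=> Cf; have -> : (fun y => - f y) = (fun y => -1 * f y).
  by apply/funext => y; rewrite mulN1r.
exact: C1_atZ.
Qed.

Lemma C1_atB f g x : C1_at f x -> C1_at g x -> C1_at (fun y => f y - g y) x.
Proof. by move=> Cf /C1_atN; exact: C1_atD. Qed.

Lemma C1_at_sum (I : Type) (r : seq I) (P : pred I) (f : I -> V -> R) x :
  (forall i, P i -> C1_at (f i) x) -> C1_at (fun y => \sum_(i <- r | P i) f i y) x.
Proof.
move=> Cf; elim: r => [|i r IH].
  by under eq_fun do rewrite big_nil; exact: C1_at_cst.
under eq_fun do rewrite big_cons.
case: (boolP (P i)) => // Pi.
by apply: C1_atD => //; exact: Cf.
Qed.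

Lemma C1_at_prod (I : Type) (r : seq I) (P : pred I) (f : I -> V -> R) x :
  (forall i, P i -> C1_at (f i) x) -> C1_at (fun y => \prod_(i <- r | P i) f i y) x.
Proof.
move=> Cf; elim: r => [|i r IH].
  by under eq_fun do rewrite big_nil; exact: C1_at_cst.
under eq_fun do rewrite big_cons.
case: (boolP (P i)) => // Pi.
by apply: C1_atM => //; exact: Cf.
Qed.

Lemma C1_at_comp1 (psi : R -> R) f x : C1_at psi (f x) -> C1_at f x ->
  C1_at (fun y => psi (f y)) x.
Proof.
move=> [dp cp] Cf; have [df cf] := Cf.
have cfx := C1_at_continuous Cf.
apply: (@C1_at_intro _ _ _ (fun y v => 'D_1 psi (f y) * 'D_v f y)).
  have H : \forall y \near x, differentiable psi (f y) by exact: (cfx [set z | differentiable psi z] dp).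
  near=> y.
  have dfy : differentiable f y by near: y.
  have dpy : differentiable psi (f y) by near: y.
  have dc := differentiable_comp dfy dpy.
  split=> [//|v]; rewrite (deriveE _ dc) (diff_comp dfy dpy) /= !deriveE//.
  by rewrite -[in LHS](mulr1 ('d f y v)) -[_ * 1]/('d f y v *: (1 : R)) linearZ /= mulrC.
move=> v; have c1 : {for x, continuous ('D_1 psi \o f)}.
  exact: (continuous_comp cfx (cp 1)).
exact: (continuousM c1 (cf v)).
Unshelve. all: by end_near. Qed.

Lemma C1_atV f x : f x != 0 -> C1_at f x -> C1_at (fun y => (f y)^-1) x.
Proof.
move=> f0 Cf; apply: (C1_at_comp1 (psi := fun y : R => y^-1)) => //.
have nz : \forall y \near (f x), y != 0 by apply: open_nbhs_nbhs; split; [exact: open_neq|].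
apply: (@C1_at_intro R R (fun y : R => y^-1) (fun y v : R => - y ^- 2 * v)).
  near=> y; have y0 : y != 0 by near: y.
  have dy := differentiable_Rinv y0.
  by split=> [//|v]; rewrite (deriveE _ dy) (diff_Rinv y0).
move=> v; have c1 : {for f x, continuous (fun y : R => (y ^+ 2)^-1)}.
  apply: (@continuousV _ _ (fun y : R => y ^+ 2)); first by rewrite expf_neq0.
  exact: exprn_continuous.
exact: (continuousM (continuousN c1) (@cst_continuous _ _ v _)).
Unshelve. all: by end_near. Qed.

Lemma C1_at_sqrt (a : R) : 0 < a -> C1_at (@Num.sqrt R) a.
Proof.
move=> a0.
have nz : \forall y \near a, 0 < y by apply: open_nbhs_nbhs; split; [exact: open_gt|].
apply: (@C1_at_intro R R (@Num.sqrt R) (fun y v : R => v * (2 * Num.sqrt y)^-1)).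
  near=> y; have y0 : 0 < y by near: y.
  have [dy ey] := is_derive1_sqrt y0.
  have dfy : differentiable (@Num.sqrt R) y by apply/derivable1_diffP.
  split=> [//|v]; rewrite deriveE// deriveE// in ey *.
  by rewrite -[in LHS](mulr1 v) -[_ * 1]/(v *: (1 : R)) linearZ /= ey.
move=> v; have c1 : {for a, continuous (fun y : R => (2 * Num.sqrt y)^-1)}.
  apply: (@continuousV _ _ (fun y : R => 2 * Num.sqrt y)).
    by rewrite mulf_neq0 ?pnatr_eq0// gt_eqF// sqrtr_gt0.
  exact: (continuousM (@cst_continuous _ _ (2 : R) a) (@sqrt_continuous R a)).
exact: (continuousM (@cst_continuous _ _ v a) c1).
Unshelve. all: by end_near. Qed.

End Scalar.

Section IsDeriveScalar.
Variable (V : normedModType R).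

Lemma is_derive_mulr (f g : V -> R) (x v : V) (df dg : R) :
  is_derive x v f df -> is_derive x v g dg ->
  is_derive x v (fun y => f y * g y) (f x * dg + g x * df).
Proof. exact: is_deriveM. Qed.

Lemma is_derive_invr (f : V -> R) (x v : V) (df : R) : f x != 0 ->
  is_derive x v f df -> is_derive x v (fun y => (f y)^-1) (- (f x) ^- 2 * df).
Proof.
move=> f0 [d <-]; split; first exact: derivableV.
by rewrite deriveV.
Qed.

End IsDeriveScalar.

Section RowValued.
Variables (V : normedModType R) (n : nat).
Implicit Types (tau : V -> 'rV[R]_n) (x : V).

Lemma coord_is_diff (i : 'I_n) (v : 'rV[R]_n) :
  differentiable (fun N : 'rV[R]_n => N 0 i : R) v /\
  forall w, 'd (fun N : 'rV[R]_n => N 0 i : R) v w = w 0 i.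
Proof.
have @f : {linear 'rV[R]_n -> R}.
  by exists (fun N : 'rV[R]_n => N 0 i); do 2![eexists]; do ?[constructor];
     rewrite ?mxE// => ? *; rewrite ?mxE//; move=> ?; rewrite !mxE.
have cf : continuous f by exact: coord_continuous.
split; first exact: differentiable_coord.
by move=> w; have -> := @diff_lin _ _ _ f v cf.
Qed.

Lemma derive_coord tau x v (i : 'I_n) : differentiable tau x ->
  'D_v (fun y => tau y 0 i) x = ('D_v tau x) 0 i.
Proof.
move=> dt; have [dc ec] := coord_is_diff i (tau x).
have dcomp := differentiable_comp dt dc.
by rewrite (deriveE v dcomp) (diff_comp dt dc) /= ec deriveE.
Qed.

Lemma C1_at_coord tau x (i : 'I_n) : C1_at tau x -> C1_at (fun y => tau y 0 i) x.
Proof.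
move=> [dt ct]; apply: (@C1_at_intro _ _ _ (fun y v => ('D_v tau y) 0 i)).
  near=> y; have dy : differentiable tau y by near: y.
  have [dc ec] := coord_is_diff i (tau y).
  by split=> [|v]; [exact: differentiable_comp dy dc|exact: derive_coord].
move=> v; have c1 : {for 'D_v tau x, continuous (fun N : 'rV[R]_n => N 0 i)}.
  exact: coord_continuous.
exact: (continuous_comp (ct v) c1).
Unshelve. all: by end_near. Qed.

Lemma continuous_rV tau x : (forall i, {for x, continuous (fun y => tau y 0 i)}) ->
  {for x, continuous tau}.
Proof.
move=> ct A [P HP sPA]; rewrite /nbhs/= /nbhs/=.
have : \forall y \near x, forall i, P 0 i (tau y 0 i).
  apply: filter_forall => i; apply: (ct i); exact: HP.
by apply: filterS => y Hy; apply: sPA => i j; rewrite (ord1 i).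
Qed.

End RowValued.

Section Chain.
Variables (n : nat).

Lemma derive_rV_sum (f : 'rV[R]_n -> R) (x v : 'rV[R]_n) : differentiable f x ->
  'D_v f x = \sum_(j < n) v 0 j * 'D_(delta_mx 0 j) f x.
Proof.
move=> df; rewrite deriveE// {1}(row_sum_delta v) linear_sum /=.
by apply: eq_bigr => j _; rewrite linearZ /= deriveE.
Qed.

Lemma derive_comp_rV (W : normedModType R) (f : 'rV[R]_n -> R) (tau : W -> 'rV[R]_n) (x v : W) :
  differentiable tau x -> differentiable f (tau x) ->
  'D_v (f \o tau) x = \sum_(j < n) 'D_v (fun y => tau y 0 j) x * 'D_(delta_mx 0 j) f (tau x).
Proof.
move=> dt df; rewrite (deriveE v (differentiable_comp dt df)) (diff_comp dt df) /=.
rewrite -(deriveE _ df) derive_rV_sum//; apply: eq_bigr => j _.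
by rewrite (derive_coord v j dt) (deriveE v dt).
Qed.

Lemma C1_at_comp (W : normedModType R) (f : 'rV[R]_n -> R) (tau : W -> 'rV[R]_n) (x : W) :
  C1_at tau x -> C1_at f (tau x) -> C1_at (f \o tau) x.
Proof.
move=> Ct [df cf]; have [dt ct] := Ct; have ctx := C1_at_continuous Ct.
apply: (@C1_at_intro _ _ _ (fun y v => \sum_(j < n) 'D_v (fun y => tau y 0 j) y *
    'D_(delta_mx 0 j) f (tau y))).
  have H : \forall y \near x, differentiable f (tau y) by exact: (ctx [set z | differentiable f z] df).
  near=> y.
  have dty : differentiable tau y by near: y.
  have dfy : differentiable f (tau y) by near: y.
  by split=> [|v]; [exact: differentiable_comp dty dfy|exact: derive_comp_rV].
move=> v; apply: continuous_sum => j _.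
have [_ c1] := C1_at_coord j Ct.
have c2 : {for x, continuous ('D_(delta_mx 0 j) f \o tau)} by exact: (continuous_comp ctx (cf _)).
exact: (continuousM (c1 v) c2).
Unshelve. all: by end_near. Qed.

End Chain.
End C1Calculus.

(** * Derivatives of determinants and inverses, symmetry of second derivatives *)

Section DetDerivative.
Context {R : realType} {V : normedModType R}.

Lemma is_derive_prod (I : eqType) (r : seq I) (f : I -> V -> R) (df : I -> R) (x v : V) :
  uniq r -> (forall i, is_derive x v (f i) (df i)) ->
  is_derive x v (fun y => \prod_(i <- r) f i y)
    (\sum_(i <- r) df i * \prod_(j <- r | j != i) f j x).
Proof.
move=> + Hf; elim: r => [_|a r IH /= /andP[ar ur]].
  under eq_fun do rewrite big_nil; rewrite big_nil; exact: is_derive_cst.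
under eq_fun do rewrite big_cons.
apply: (is_derive_eq (is_deriveM (Hf a) (IH ur))); rewrite big_cons big_cons eqxx /= addrC; congr (_ + _).
  rewrite mulrC -[_ *: _]/(_ * _); congr (_ * _).
  rewrite big_seq_cond [RHS]big_seq_cond; apply: eq_bigl => j.
  by case: (boolP (j \in r)) => //= jr; rewrite (memPn ar).
rewrite -[_ *: _]/(_ * _) mulr_sumr; apply: eq_big_seq => i ir.
rewrite big_cons; have -> : a != i by apply: contra ar => /eqP ->.
by rewrite mulrCA.
Qed.

Lemma is_derive_bigsum (I : Type) (r : seq I) (f : I -> V -> R) (df : I -> R) (x v : V) :
  (forall i, is_derive x v (f i) (df i)) ->
  is_derive x v (fun y => \sum_(i <- r) f i y) (\sum_(i <- r) df i).
Proof.
move=> Hf; elim: r => [|a r IH].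
  under eq_fun do rewrite big_nil; rewrite big_nil; exact: is_derive_cst.
under eq_fun do rewrite big_cons; rewrite big_cons.
exact: is_deriveD.
Qed.

(** Jacobi's formula. The product rule in the Leibniz expansion gives the sum over i of the
    determinants in which row i is replaced by its derivative; expand each along that row. *)
Lemma is_derive_det n (A : V -> 'M[R]_n) (dA : 'M[R]_n) (x v : V) :
  (forall i j, is_derive x v (fun y => A y i j) (dA i j)) ->
  is_derive x v (fun y => \det (A y)) (\tr (\adj (A x) *m dA)).
Proof.
move=> HA; rewrite /determinant.
have H := is_derive_bigsum (index_enum {perm 'I_n}) (fun s : {perm 'I_n} =>
  is_deriveZ ((-1) ^+ s : R) (is_derive_prod (index_enum_uniq 'I_n) (fun i => HA i (s i)))).
apply: (is_derive_eq H); rewrite /mxtrace.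
transitivity (\sum_i \sum_j dA i j * cofactor (A x) i j); last first.
  rewrite exchange_big /=; apply: eq_bigr => i _; rewrite mxE; apply: eq_bigr => j _.
  by rewrite mxE mulrC.
transitivity (\sum_i \det (\matrix_(k, j) if k == i then dA i j else A x k j)).
  rewrite /determinant exchange_big /=; apply: eq_bigr => s _.
  rewrite -[_ *: _]/(_ * _) mulr_sumr; apply: eq_bigr => i _; congr (_ * _).
  rewrite [in RHS](bigD1 i)//= mxE eqxx; congr (_ * _).
  by apply: eq_bigr => j /negbTE ji; rewrite mxE ji.
apply: eq_bigr => i _; rewrite (expand_det_row _ i); apply: eq_bigr => j _.
rewrite mxE eqxx; congr (_ * _); rewrite /cofactor; congr (_ * \det _).
by apply/matrixP => a b; rewrite !mxE eq_sym (negbTE (neq_lift _ _)).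
Qed.

(** Differentiate [invmx (A y) *m A y = 1%:M]. *)
Lemma derive_invmx n (A : V -> 'M[R]_n) (dA : 'M[R]_n) (x v : V) :
  (forall i j, is_derive x v (fun y => A y i j) (dA i j)) ->
  (\forall y \near x, A y \in unitmx) ->
  (forall i j, derivable (fun y => invmx (A y) i j) x v) ->
  \matrix_(i, j) 'D_v (fun y => invmx (A y) i j) x = - (invmx (A x) *m dA *m invmx (A x)).
Proof.
move=> HA uA dB; set dBm := \matrix_(i, j) _.
have uAx : A x \in unitmx by exact: nbhs_singleton uA.
have HB i j : is_derive x v (fun y => invmx (A y) i j) (dBm i j).
  by split; [exact: dB|rewrite mxE].
suff E : dBm *m A x = - (invmx (A x) *m dA).
  by rewrite -[LHS](mulmxK uAx) E mulNmx.
apply/eqP; rewrite -addr_eq0; apply/eqP/matrixP => i k; rewrite !mxE -big_split/=.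
have H1 : is_derive x v (fun y => \sum_j invmx (A y) i j * A y j k)
    (\sum_j (invmx (A x) i j * dA j k + A x j k * dBm i j)).
  by apply: is_derive_bigsum => j; exact: is_deriveM (HB i j) (HA j k).
have H2 : is_derive x v (fun y => \sum_j invmx (A y) i j * A y j k) 0.
  have ic : is_derive x v (cst ((1%:M : 'M[R]_n) i k)) (0 : R) by exact: is_derive_cst.
  apply: near_eq_is_derive ic.
  by apply: filterS uA => y uAy; rewrite /cst -(mulVmx uAy) mxE.
have [_ e1] := H1; have [_ e2] := H2.
rewrite -[RHS]e2 e1; apply: eq_bigr => j _; by rewrite addrC [dBm _ _ * _]mulrC.
Qed.
End DetDerivative.

Section C1Matrix.
Context {R : realType} {V : normedModType R}.

Lemma C1_at_det n (A : V -> 'M[R]_n) (x : V) :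
  (forall i j, C1_at (fun y => A y i j) x) -> C1_at (fun y => \det (A y)) x.
Proof.
move=> HA; rewrite /determinant; apply: C1_at_sum => s _.
by apply: C1_atZ; apply: C1_at_prod => i _; exact: HA.
Qed.

Lemma near_unitmx n (A : V -> 'M[R]_n) (x : V) :
  (forall i j, C1_at (fun y => A y i j) x) -> A x \in unitmx ->
  \forall y \near x, A y \in unitmx.
Proof.
move=> HA uA; have c := C1_at_continuous (C1_at_det HA).
have nz : \forall z \near \det (A x), z != 0.
  by apply: open_nbhs_nbhs; split; [exact: open_neq|rewrite /= -unitfE -unitmxE].
have H : \forall y \near x, \det (A y) != 0 by exact: (c [set z | z != 0] nz).
by apply: filterS H => y; rewrite unitmxE unitfE.
Qed.

Lemma C1_at_invmx n (A : V -> 'M[R]_n) (x : V) :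
  (forall i j, C1_at (fun y => A y i j) x) -> A x \in unitmx ->
  forall i j, C1_at (fun y => invmx (A y) i j) x.
Proof.
move=> HA uA i j.
apply: (@C1_at_near _ _ _ (fun y => (\det (A y))^-1 * cofactor (A y) j i)).
  by apply: filterS (near_unitmx HA uA) => y uAy; rewrite /invmx uAy !mxE.
apply: C1_atM.
  by apply: C1_atV; [rewrite -unitfE -unitmxE|exact: C1_at_det].
rewrite /cofactor; apply: C1_atZ; apply: C1_at_det => a b.
apply: (@C1_at_near _ _ _ (fun y => A y (lift j a) (lift i b))); last exact: HA.
by apply: nearW => y; rewrite !mxE.
Qed.

End C1Matrix.

Section Schwarz.
Context {R : realType} {V : normedModType R}.

Lemma derive_mvt (f : V -> R) (x v : V) (s : R) : 0 < s ->
  (forall t, 0 <= t <= s -> derivable f (t *: v + x) v) ->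
  exists2 t, 0 < t < s & f (s *: v + x) - f x = s * 'D_v f (t *: v + x).
Proof.
move=> s0 df.
have H1 (t : R) : t \in `]0, s[ -> is_derive t 1 (fun t => f (t *: v + x)) ('D_v f (t *: v + x)).
  by rewrite in_itv/= => /andP[t0 ts]; apply: is_derive_line; apply: df; rewrite !ltW.
have H2 : {within `[0, s], continuous (fun t => f (t *: v + x))}.
  apply: derivable_within_continuous => t; rewrite in_itv/= => ts.
  by have [] := is_derive_line (df t ts).
have [t] := MVT s0 H1 H2.
by rewrite in_itv/= => ts; rewrite scale0r add0r subr0 mulrC => ->; exists t.
Qed.

Lemma is_derive_translate (f : V -> R) (z x v : V) (d : R) :
  is_derive (z + x) v f d -> is_derive x v (fun y => f (z + y)) d.
Proof.
have E : (fun h : R => h^-1 *: (((fun y => f (z + y)) \o shift x) (h *: v) - f (z + x)))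
       = (fun h : R => h^-1 *: ((f \o shift (z + x)) (h *: v) - f (z + x))).
  by apply/funext => h /=; rewrite addrCA.
by move=> [df ed]; split; [rewrite /derivable E|rewrite /derive E].
Qed.

(** The second difference of f over the square spanned by s v and s w, seen as the increment along v
    of the first difference along w. *)
Lemma double_mvt (f : V -> R) (x v w : V) (s : R) : 0 < s ->
  (forall t t', 0 <= t <= s -> 0 <= t' <= s ->
     derivable f (t' *: w + (t *: v + x)) v /\
     derivable ('D_v f) (t' *: w + (t *: v + x)) w) ->
  exists t t', [/\ 0 <= t <= s, 0 <= t' <= s &
    (f (s *: w + (s *: v + x)) - f (s *: v + x)) - (f (s *: w + x) - f x) =
    s * (s * 'D_w ('D_v f) (t' *: w + (t *: v + x)))].
Proof.
move=> s0 H; pose g y := f (s *: w + y) - f y.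
have ss : 0 <= s <= s by rewrite lexx ltW.
have z0 : 0 <= (0:R) <= s by rewrite lexx ltW.
have Hg t : 0 <= t <= s -> is_derive (t *: v + x) v g
    ('D_v f (s *: w + (t *: v + x)) - 'D_v f (t *: v + x)).
  move=> ts; have [d1 _] := H _ _ ts ss; have := (H _ _ ts z0).1.
  rewrite scale0r add0r => d2.
  exact: is_deriveB (is_derive_translate (derivableP d1)) (derivableP d2).
have [|t /andP[t0 ts] Eg] := @derive_mvt g x v s s0.
  by move=> t /Hg[].
have ts' : 0 <= t <= s by rewrite !ltW.
have [_ e] := Hg _ ts'; rewrite e in Eg.
have [|t' /andP[t'0 t's] Ef] := @derive_mvt ('D_v f) (t *: v + x) w s s0.
  by move=> t' t's; exact: (H _ _ ts' t's).2.
by exists t, t'; split; rewrite ?ltW// -Ef -Eg.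
Qed.

Lemma near_box (P : V -> Prop) (x v w : V) : (\forall y \near x, P y) ->
  exists2 s : R, 0 < s & forall t t', 0 <= t <= s -> 0 <= t' <= s ->
    P (t *: v + (t' *: w + x)).
Proof.
move=> /nbhs_ballP[d /= d0 Hd].
pose N := `|v| + `|w| + 1; have N0 : 0 < N by rewrite ltr_wpDl// addr_ge0.
exists (d / N) => [|t t' /andP[t0 ts] /andP[t'0 t's]]; first exact: divr_gt0.
apply: Hd; rewrite -ball_normE /ball_/= (addrA (t *: v)) (addrC _ x) opprD addrA subrr add0r normrN.
apply: (@le_lt_trans _ _ (d / N * (`|v| + `|w|))).
  rewrite mulrDr (le_trans (ler_normD _ _))// !normrZ !ger0_norm//.
  by rewrite lerD// ler_wpM2r.
rewrite -mulrA gtr_pMr// ltr_pdivrMl// mulr1 /N.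
by rewrite ltrDl.
Qed.

(** The second difference over a small square of side s equals s^2 times each of the two mixed
    derivatives, at two points of the square; both points tend to x with s. *)
Lemma schwarz (f : V -> R) (x v w : V) :
  (\forall y \near x, derivable f y v /\ derivable f y w) ->
  (\forall y \near x, derivable ('D_v f) y w /\ derivable ('D_w f) y v) ->
  {for x, continuous ('D_w ('D_v f))} -> {for x, continuous ('D_v ('D_w f))} ->
  'D_w ('D_v f) x = 'D_v ('D_w f) x.
Proof.
move=> d1 d2 c1 c2.
suff H (e : R) : 0 < e -> `|'D_w ('D_v f) x - 'D_v ('D_w f) x| <= e.
  apply/eqP; rewrite -subr_eq0 -normr_le0; apply/ler_addgt0Pr => e e0.
  by rewrite add0r; exact: H.
move=> e0; have e20 : 0 < e / 2 by rewrite divr_gt0.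
have n1 : \forall y \near x, `|'D_w ('D_v f) x - 'D_w ('D_v f) y| < e / 2.
  exact: (c1 _ (nbhsx_ballx _ _ e20)).
have n2 : \forall y \near x, `|'D_v ('D_w f) x - 'D_v ('D_w f) y| < e / 2.
  exact: (c2 _ (nbhsx_ballx _ _ e20)).
have [s s0 Hs] := near_box w v (filterI (filterI d1 d2) (filterI n1 n2)).
have [|t [t' [ts t's E1]]] := @double_mvt f x v w s s0.
  by move=> t t' ts t's; have [[[? ?] [? ?]] _] := Hs _ _ t's ts.
have [|r [r' [rs r's E2]]] := @double_mvt f x w v s s0.
  move=> t2 t2' ts2 t's2; have [[[? ?] [? ?]] _] := Hs _ _ ts2 t's2.
  have Esw : t2' *: v + (t2 *: w + x) = t2 *: w + (t2' *: v + x) by exact: addrCA.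
  by rewrite Esw.
have [_ [A1 _]] := Hs _ _ t's ts.
have [_ [_ A2]] := Hs _ _ rs r's.
have Esw2 : r *: w + (r' *: v + x) = r' *: v + (r *: w + x) by exact: addrCA.
rewrite Esw2 in A2.
have E3 : 'D_w ('D_v f) (t' *: w + (t *: v + x)) = 'D_v ('D_w f) (r' *: v + (r *: w + x)).
  apply: (mulfI (lt0r_neq0 s0)); apply: (mulfI (lt0r_neq0 s0)).
  have Esw : s *: v + (s *: w + x) = s *: w + (s *: v + x) by exact: addrCA.
  have key (a b c d a' e1 e2 : R) : a = a' -> a - b - (c - d) = e1 -> a' - c - (b - d) = e2 -> e1 = e2.
    by move=> -> <- <-; ring.
  exact: (key _ _ _ _ _ _ _ (congr1 f (esym Esw)) E1 E2).
rewrite E3 in A1; set z := 'D_v ('D_w f) (r' *: v + _) in A1 A2.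
have key (a b c d : R) : `|a - c| < d / 2 -> `|b - c| < d / 2 -> `|a - b| <= d.
  by clear; rewrite !ltr_norml ler_norml; lra.
exact: key A1 A2.
Qed.
End Schwarz.

(** * The divergence identity at a point *)

Section GramMatrix.
Context {R : realType}.

Lemma mulmx_tr_ge0 k (u : 'rV[R]_k) : 0 <= (u *m u^T) 0 0.
Proof. by rewrite mxE sumr_ge0// => i _; rewrite mxE -expr2 sqr_ge0. Qed.

Lemma mulmx_tr_eq0 k (u : 'rV[R]_k) : (u *m u^T) 0 0 = 0 -> u = 0.
Proof.
rewrite mxE => /eqP; rewrite psumr_eq0 => [/allP H|i _]; last by rewrite mxE -expr2 sqr_ge0.
apply/rowP => i; have := H i (mem_index_enum _); rewrite /= mxE -expr2 sqrf_eq0 => /eqP ->.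
by rewrite mxE.
Qed.

Lemma mulmx_tr_gt0 k (u : 'rV[R]_k) : u != 0 -> 0 < (u *m u^T) 0 0.
Proof.
by move=> u0; rewrite lt_neqAle mulmx_tr_ge0 andbT eq_sym; apply: contra u0 => /eqP/mulmx_tr_eq0->.
Qed.

Lemma posdef_unitmx n (A : 'M[R]_n) :
  (forall v : 'rV[R]_n, v != 0 -> 0 < (v *m A *m v^T) 0 0) -> A \in unitmx.
Proof.
move=> pA; rewrite -row_free_unit -kermx_eq0; apply/eqP/row_matrixP => i.
rewrite row0; apply: contraTeq isT => /pA; rewrite -row_mul mulmx_ker row0 mul0mx mxE ltxx.
by [].
Qed.

(** On the segment from the identity to A all matrices are positive definite, so the determinant does
    not vanish there and keeps the sign that it has at the identity. *)
Lemma posdef_det_gt0 n (A : 'M[R]_n) :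
  (forall v : 'rV[R]_n, v != 0 -> 0 < (v *m A *m v^T) 0 0) -> 0 < \det A.
Proof.
move=> pA; pose B (t : R) : 'M[R]_n := (1 - t)%:M + t *: A.
have pB t : 0 <= t <= 1 -> \det (B t) != 0.
  move=> /andP[t0 t1]; rewrite -unitfE -unitmxE; apply: posdef_unitmx => v v0.
  rewrite mulmxDr mulmxDl mxE mul_mx_scalar -scalemxAl -scalemxAr -scalemxAl !mxE.
  have := pA v v0; have := mulmx_tr_gt0 v0; rewrite !mxE => H1 H2.
  have [->|tn0] := eqVneq t 0; first by rewrite mul0r addr0 subr0 mul1r.
  by apply: ltr_wpDl; [rewrite mulr_ge0 ?subr_ge0// ltW|rewrite mulr_gt0// lt0r tn0].
have cB : {within `[0, 1], continuous (fun t => \det (B t))}.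
  have cBt (t : R) : C1_at (fun t : R => \det (B t)) t.
    apply: C1_at_det => i j.
    have -> : (fun t : R => B t i j) = (fun t : R => (1 - t) * (i == j)%:R + t * A i j).
      by apply/funext => s; rewrite !mxE mulr_natr.
    have C1c (a : R) := C1_at_cst (V := R) a t.
    have Cid := C1_at_id t.
    exact: (C1_atD (C1_atM (C1_atB (C1c 1) Cid) (C1c _)) (C1_atM Cid (C1c _))).
  apply: continuous_subspaceT => t; exact: C1_at_continuous (cBt t).
have [//|d0] := ltP 0 (\det A).
have B0 : \det (B 0) = 1 by rewrite /B subr0 scale0r addr0 det1.
have B1 : \det (B 1) = \det A by rewrite /B subrr scale1r (_ : 0%:M = 0) ?add0r//; apply/matrixP=> i j; rewrite !mxE mul0rn.
have [|t] := @IVT R (fun t => \det (B t)) 0 1 0 ler01 cB.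
  by rewrite B0 B1 ge_min le_max d0 ler01 orbT.
by rewrite in_itv/= => /pB /eqP.
Qed.

Lemma gram_posdef n k (J : 'M[R]_(n, k)) : row_free J ->
  forall v : 'rV[R]_n, v != 0 -> 0 < (v *m (J *m J^T) *m v^T) 0 0.
Proof.
move=> fJ v v0; rewrite mulmxA -mulmxA -trmx_mul; apply: mulmx_tr_gt0.
by apply: contra v0 => /eqP vJ; apply/eqP/(row_free_inj fJ); rewrite vJ mul0mx.
Qed.
End GramMatrix.

Lemma divergence_pointwise_scalars (R : realType) (y n t j a b c w : R) : y != 0 ->
  2^-1 * (- (2 * j / y) * n + 2 * y ^- 2 * t) * w + (- (y^-1 * a) - j / y * w - (- (2 * j / y) * w + y ^- 2 * (b + c))) =
  (1 - n) * (j / y * w) + y ^- 2 * (w * t) - y ^- 2 * b - (y^-1 * a + y ^- 2 * c).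
Proof. by move=> y0; field. Qed.

(** The linear algebra behind the divergence of grad b, b = - ln(height), at one point. The rows of J are
    the coordinate fields of the parametrization and Q i is the derivative of J in direction i; y is
    the height, g the induced metric and h its inverse, e the vertical unit vector. Then w is the
    differential of b and W its gradient, in coordinates; dg i and dw i are the derivatives of g and
    w. The matrix P is the orthogonal projection onto the normal space, nu the normal part of e and N
    the square of its Euclidean length. *)
Section Pointwise.
Context {R : realType} {n m : nat}.
Variables (J : 'M[R]_(n, m.+1)) (Q : 'I_n -> 'M[R]_(n, m.+1)) (y : R).
Hypotheses (y0 : 0 < y) (fJ : row_free J) (Qsym : forall i j, row j (Q i) = row i (Q j)).

Variables (e : 'rV[R]_m.+1) (g h : 'M[R]_n) (w W : 'rV[R]_n) (dg : 'I_n -> 'M[R]_n)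
  (dw : 'I_n -> 'rV[R]_n) (P : 'M[R]_m.+1) (nu : 'rV[R]_m.+1) (N : R).
Hypotheses (eE : e = delta_mx 0 ord_max) (gE : g = y ^- 2 *: (J *m J^T)) (hE : h = invmx g)
  (wE : w = - (y^-1 *: (e *m J^T))) (WE : W = w *m h)
  (dgE : forall i, dg i = - (2 * J i ord_max / y) *: g + y ^- 2 *: (Q i *m J^T + J *m (Q i)^T))
  (dwE : forall i, dw i = - (y^-1 *: (e *m (Q i)^T)) - (J i ord_max / y) *: w)
  (PE : P = 1%:M - y ^- 2 *: (J^T *m h *m J)) (nuE : nu = e *m P) (NE : N = (nu *m nu^T) 0 0).

Lemma gram_unit : g \in unitmx.
Proof.
apply: posdef_unitmx => v v0.
rewrite gE -scalemxAr -scalemxAl mxE mulr_gt0//; first by rewrite invr_gt0 exprn_gt0.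
exact: gram_posdef.
Qed.

Lemma gram_det_gt0 : 0 < \det g.
Proof.
apply: posdef_det_gt0 => v v0.
rewrite gE -scalemxAr -scalemxAl mxE mulr_gt0//; first by rewrite invr_gt0 exprn_gt0.
exact: gram_posdef.
Qed.

Lemma gram_sym : g^T = g.
Proof. by rewrite gE linearZ /= trmx_mul trmxK. Qed.

Lemma inv_gram_sym : h^T = h.
Proof. by rewrite hE trmx_inv gram_sym. Qed.

Lemma inv_gram_mul : h *m g = 1%:M. Proof. by rewrite hE mulVmx// gram_unit. Qed.

Lemma gram_mul_inv : g *m h = 1%:M. Proof. by rewrite hE mulmxV// gram_unit. Qed.

Lemma normal_proj_sym : P^T = P.
Proof. by rewrite PE linearB /= trmx1 linearZ /= !trmx_mul trmxK inv_gram_sym mulmxA. Qed.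

Lemma tangent_normal_proj : J *m P = 0.
Proof.
by rewrite PE mulmxBr mulmx1 -scalemxAr !mulmxA scalemxAl scalemxAl -gE gram_mul_inv mul1mx subrr.
Qed.

Lemma normal_proj_idem : P *m P = P.
Proof. by rewrite [X in X *m P]PE mulmxBl mul1mx -scalemxAl -[_ *m J *m P]mulmxA tangent_normal_proj mulmx0 scaler0 subr0. Qed.

Lemma vertical_dot_nu : (e *m nu^T) 0 0 = N.
Proof. by rewrite NE nuE trmx_mul normal_proj_sym !mulmxA -[e *m P *m P]mulmxA normal_proj_idem. Qed.

Lemma tangent_dot_nu i : (row i J *m nu^T) 0 0 = 0.
Proof. by rewrite nuE trmx_mul normal_proj_sym mulmxA -row_mul tangent_normal_proj row0 mul0mx mxE. Qed.

Lemma vertical_dot_tangent i : (e *m J^T) 0 i = J i ord_max.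
Proof. by rewrite eE -rowE !mxE. Qed.

(** The decomposition of e into its normal part nu and its tangential part - W J / y. *)
Lemma vertical_decomposition : y^-1 *: e + y ^- 2 *: (W *m J) = y^-1 *: nu.
Proof.
rewrite nuE PE mulmxBr mulmx1 scalerBr; congr (_ + _).
rewrite WE wE !mulNmx scalerN -!scalemxAl -scalemxAr !scalerA !mulmxA.
by rewrite mulrC.
Qed.

(** N is one minus the square of the length of grad b. *)
Lemma normal_length_sqr : N = 1 - (W *m w^T) 0 0.
Proof.
rewrite -vertical_dot_nu nuE trmx_mul normal_proj_sym PE mulmxA mulmxBr mulmx1 mulmxBl [LHS]mxE [(e *m e^T) 0 0](_ : _ = 1); last first.
  by rewrite eE -rowE !mxE !eqxx.
congr (1 + _); rewrite [LHS]mxE; congr (- _).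
have wT : w^T = - (y^-1 *: (J *m e^T)).
  by rewrite wE linearN /= linearZ /= trmx_mul trmxK.
congr (fun_of_matrix _ 0 0); rewrite WE wT wE !mulNmx mulmxN opprK.
rewrite -!scalemxAl -!scalemxAr -!scalemxAl !scalerA !mulmxA; congr (_ *: _).
by rewrite -expr2 exprVn.
Qed.

Lemma normal_length_le1 : N <= 1.
Proof.
rewrite normal_length_sqr lerBlDr lerDl.
have -> : W *m w^T = y ^- 2 *: ((W *m J) *m (W *m J)^T).
  rewrite trmx_mul !mulmxA -[W *m J *m J^T]mulmxA scalemxAl scalemxAr -gE.
  by rewrite {3}WE trmx_mul inv_gram_sym -!mulmxA [g *m _]mulmxA gram_mul_inv mul1mx.
by rewrite mxE mulr_ge0 ?mulmx_tr_ge0// invr_ge0 exprn_ge0// ltW.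
Qed.

Lemma trace_gram_derive i : \tr (h *m dg i) = - (2 * J i ord_max / y) * n%:R + 2 * y ^- 2 * \tr (h *m J *m (Q i)^T).
Proof.
rewrite dgE mulmxDr -!scalemxAr mxtraceD !mxtraceZ inv_gram_mul mxtrace1; congr (_ + _).
rewrite mulmxDr mxtraceD mulmxA -[\tr (h *m Q i *m J^T)]mxtrace_tr !trmx_mul trmxK inv_gram_sym.
rewrite mulmxA mxtrace_mulC !mulmxA; ring.
Qed.

(** This is where the symmetry of second derivatives enters: it exchanges the direction of
    differentiation with the coordinate field, turning the contraction into a trace. *)
Lemma sum_trace_hess : \sum_i (W *m Q i *m J^T *m h) 0 i = \sum_i W 0 i * \tr (h *m J *m (Q i)^T).
Proof.
transitivity (\sum_i \sum_b W 0 b * (Q b *m (J^T *m h)) i i).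
  apply: eq_bigr => i _; rewrite -!mulmxA mxE; apply: eq_bigr => b _; congr (_ * _).
  rewrite mxE [RHS]mxE; apply: eq_bigr => c _; congr (_ * _).
  by have := congr1 (fun r : 'rV[R]_m.+1 => r 0 c) (Qsym i b); rewrite !mxE.
rewrite exchange_big /=; apply: eq_bigr => b _; rewrite -mulr_sumr; congr (_ * _).
rewrite -[LHS]/(\tr _) -[LHS]mxtrace_tr !trmx_mul trmxK inv_gram_sym.
by [].
Qed.

(** The summand is the i-th term of the divergence of W: the logarithmic derivative of sqrt(det g)
    applied to W, plus the derivative of w h. By [sum_trace_hess] two of the terms in Q
    cancel in the sum; the other two combine into the one in nu by [vertical_decomposition]. *)
Lemma divergence_pointwise :
  \sum_i (2^-1 * \tr (h *m dg i) * W 0 i + (dw i *m h - W *m dg i *m h) 0 i) =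
  (n%:R - 1) * (1 - N) - y^-1 * \sum_i (nu *m (Q i)^T *m h) 0 i.
Proof.
have yn0 : y != 0 by rewrite gt_eqF.
have E i : 2^-1 * \tr (h *m dg i) * W 0 i + (dw i *m h - W *m dg i *m h) 0 i =
   (1 - n%:R) * (J i ord_max / y * W 0 i) 
   + y ^- 2 * (W 0 i * \tr (h *m J *m (Q i)^T)) - y ^- 2 * (W *m Q i *m J^T *m h) 0 i
   - (y^-1 * (nu *m (Q i)^T *m h) 0 i).
  have -> : y^-1 * (nu *m (Q i)^T *m h) 0 i =
     y^-1 * (e *m (Q i)^T *m h) 0 i + y ^- 2 * (W *m J *m (Q i)^T *m h) 0 i.
    transitivity (((y^-1 *: nu) *m (Q i)^T *m h) 0 i).
      by rewrite -!scalemxAl [in RHS]mxE.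
    by rewrite -vertical_decomposition !mulmxDl mxE -!scalemxAl [X in X + _]mxE [X in _ + X]mxE.
  rewrite trace_gram_derive dwE dgE mulmxBl mulNmx -!scalemxAl mulmxDr mulmxDl -!scalemxAr -!scalemxAl.
  rewrite -WE -[W *m g *m h]mulmxA gram_mul_inv mulmx1 mulmxDr mulmxDl !mulmxA.
  move: (e *m (Q i)^T *m h) (W *m Q i *m J^T *m h) (W *m J *m (Q i)^T *m h) => A B C.
  move: (\tr _) (J i ord_max) => t j.
  have -> : (- (y^-1 *: A) - j / y *: W - (- (2 * j / y) *: W + y ^- 2 *: (B + C))) 0 i =
     - (y^-1 * A 0 i) - j / y * W 0 i - (- (2 * j / y) * W 0 i + y ^- 2 * (B 0 i + C 0 i)).
    by rewrite !mxE.
  move: (A 0 i) (B 0 i) (C 0 i) (W 0 i) => a b c Wi.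
  exact: divergence_pointwise_scalars.
under eq_bigr do rewrite E.
rewrite !big_split /= -!mulr_sumr !sumrN -!mulr_sumr sum_trace_hess addrK.
congr (_ - _).
have -> : \sum_i J i ord_max / y * W 0 i = - (W *m w^T) 0 0.
  rewrite mxE -sumrN; apply: eq_bigr => i _; rewrite [w^T i 0]mxE wE !mxE -vertical_dot_tangent mxE; ring.
rewrite normal_length_sqr; ring.
Qed.

End Pointwise.

Section MeanCurvature.
Context {R : realType} {m : nat}.

(** The metric is conformal to the Euclidean one with factor y^-2, so the symbols only see the
    derivative of y^-2 in the vertical direction. *)
Lemma christoffel_hyp (z : 'rV[R]_m.+1) (l a b : 'I_m.+1) : 0 < z 0 ord_max ->
  christoffel hyp_metric z l a b = - (z 0 ord_max)^-1 *
    ((a == ord_max)%:R * (b == l)%:R + (b == ord_max)%:R * (a == l)%:R - (l == ord_max)%:R * (a == b)%:R).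
Proof.
move=> z0; have zn0 : z 0 ord_max != 0 by rewrite gt_eqF.
have dG (i b' c : 'I_m.+1) : partial i (fun y : 'rV[R]_m.+1 => hyp_metric y b' c) z =
    - (2 * (z 0 ord_max) ^- 3) * (i == ord_max)%:R * (b' == c)%:R.
  have -> : (fun y : 'rV[R]_m.+1 => hyp_metric y b' c) = (fun y => (y 0 ord_max * y 0 ord_max)^-1 * (b' == c)%:R).
    by apply/funext => y; rewrite /hyp_metric mxE mulr_natr -expr2.
  have [dc ec] := coord_is_diff (ord_max : 'I_m.+1) z.
  have ic : is_derive z (delta_mx 0 i : 'rV[R]_m.+1) (fun y : 'rV[R]_m.+1 => y 0 ord_max) (i == ord_max)%:R.
    split; first exact: diff_derivable.
    by rewrite deriveE// ec mxE eqxx eq_sym.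
  have z2 : z 0 ord_max * z 0 ord_max != 0 by rewrite mulf_neq0.
  have [_ E] := is_derive_mulr (@is_derive_invr _ _ (fun y : 'rV[R]_m.+1 => y 0 ord_max * y 0 ord_max) _ _ _ z2 (is_derive_mulr ic ic)) (is_derive_cst ((b' == c)%:R : R) z (delta_mx 0 i)).
  rewrite /partial E /cst mulr0 add0r.
  move: (z 0 ord_max) zn0 ((b' == c)%:R : R) ((i == ord_max)%:R : R) => y yn0 u v.
  by clear -yn0; field.
rewrite /christoffel; under eq_bigr do rewrite !dG.
have iG : invmx (hyp_metric z) = ((z 0 ord_max) ^+ 2)%:M.
  by rewrite /hyp_metric invmx_scalar invrK.
rewrite iG (bigD1 l)//= big1 => [|c cl]; last first.
  by rewrite mxE eq_sym (negbTE cl) mulr0n mul0r.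
rewrite addr0 mxE eqxx mulr1n.
move: (z 0 ord_max) zn0 => y yn0.
move: ((a == ord_max)%:R : R) ((b == l)%:R : R) ((b == ord_max)%:R : R) ((a == l)%:R : R) ((l == ord_max)%:R : R) ((a == b)%:R : R).
by clear -yn0 => *; field.
Qed.

End MeanCurvature.

(** * The divergence of grad b in a chart *)

Lemma first_form_hyp (R : realType) (n m : nat) (Y : 'rV[R]_n -> 'rV[R]_m.+1) (x : 'rV[R]_n) :
  first_form hyp_metric Y x = (Y x 0 ord_max) ^- 2 *: (jacobian Y x *m (jacobian Y x)^T).
Proof. by rewrite /first_form /hyp_metric mul_mx_scalar -scalemxAl. Qed.

Lemma trmx_entry (R : Type) (m n : nat) (A : 'M[R]_(m, n)) i j : A^T i j = A j i.
Proof. by rewrite mxE. Qed.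

Lemma mulmx_entry (R : realType) (m n p : nat) (A : 'M[R]_(m, n)) (B : 'M[R]_(n, p)) i j :
  (A *m B) i j = \sum_k A i k * B k j.
Proof. by rewrite mxE. Qed.

Lemma row_entry (R : Type) (m n : nat) (A : 'M[R]_(m, n)) i j : row i A 0 j = A i j.
Proof. by rewrite mxE. Qed.

Lemma derive_gram_scalars (R : realType) (y j s t : R) : y != 0 ->
  (y * y)^-1 * s + t * (- (y * y) ^- 2 * (y * j + y * j)) =
  - (2 * j / y) * ((y * y)^-1 * t) + y ^- 2 * s.
Proof. by move=> y0; field. Qed.

Lemma derive_weight_scalars (R : realType) (y j q k : R) : y != 0 ->
  - (y^-1 * q + k * (- y ^- 2 * j)) = - (y^-1 * q) - j / y * - (y^-1 * k).
Proof. by move=> y0; field. Qed.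

Lemma cov_deriv_scalars (R : realType) (y j1 j2 g N : R) : y != 0 ->
  - (y^-1 * (j1 * 0 + j2 * 0 - y ^+ 2 * g * N)) = y * g * N.
Proof. by move=> y0; field. Qed.

Section Chart.
Context {R : realType} {n m : nat}.
Variables (Y : 'rV[R]_n -> 'rV[R]_m.+1) (U : set 'rV[R]_n).
Hypotheses (oU : open U) (sY : Ck_on 2 U Y) (posY : forall x, U x -> 0 < Y x 0 ord_max)
  (fJ : forall x, U x -> row_free (jacobian Y x)).

Local Notation J x := (jacobian Y x).
Local Notation e := (delta_mx 0 ord_max : 'rV[R]_m.+1).

Lemma chart_differentiable x : U x -> differentiable Y x.
Proof. by case: sY => d _; exact: d. Qed.

Lemma C1_at_partial x v : U x -> C1_at ('D_v Y) x.
Proof. by case: sY => _ H; move: x; apply/C1_onP => //; exact: H. Qed.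

Lemma C1_at_chart x : U x -> C1_at Y x.
Proof.
move=> Ux; split=> [|v]; last exact: C1_at_continuous (C1_at_partial v Ux).
have := open_nbhs_nbhs (conj oU Ux); apply: filterS; exact: chart_differentiable.
Qed.

Lemma jacobian_derive x i a : U x -> J x i a = ('D_(delta_mx 0 i) Y x) 0 a.
Proof. by move=> Ux; rewrite (deriveEjacobian _ (chart_differentiable Ux)) -rowE row_entry. Qed.

Lemma jacobian_coord x i a : U x -> J x i a = 'D_(delta_mx 0 i) (fun y => Y y 0 a) x.
Proof. by move=> Ux; rewrite (derive_coord _ _ (chart_differentiable Ux)) jacobian_derive. Qed.

Lemma near_open x : U x -> \forall y \near x, U y.
Proof. by move=> Ux; exact: open_nbhs_nbhs. Qed.

Lemma C1_at_jacobian x i a : U x -> C1_at (fun y => J y i a) x.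
Proof.
move=> Ux; apply: (@C1_at_near _ _ _ (fun y => ('D_(delta_mx 0 i) Y y) 0 a)).
  by apply: filterS (near_open Ux) => y Uy; rewrite jacobian_derive.
exact: C1_at_coord (C1_at_partial _ Ux).
Qed.

Definition hess x i : 'M[R]_(n, m.+1) :=
  \matrix_(a, c) 'D_(delta_mx 0 i) (fun y => jacobian Y y a c) x.

Lemma hessE x i a c : hess x i a c = 'D_(delta_mx 0 i) (fun y => jacobian Y y a c) x.
Proof. by rewrite [LHS]mxE. Qed.

Lemma hess_partial x i a c : U x -> (partial i (partial a Y) x) 0 c = hess x i a c.
Proof.
move=> Ux; rewrite hessE /partial.
have d : differentiable ('D_(delta_mx 0 a) Y) x.
  by have [/nbhs_singleton] := C1_at_partial (delta_mx 0 a) Ux.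
rewrite -(derive_coord _ _ d); apply: near_eq_derive.
by apply: filterS (near_open Ux) => y Uy; rewrite -jacobian_derive.
Qed.

Lemma is_derive_jacobian x i a c : U x ->
  is_derive x (delta_mx 0 i) (fun y => J y a c) (hess x i a c).
Proof. by move=> Ux; rewrite hessE; apply/derivableP/C1_at_derivable/C1_at_jacobian. Qed.

Lemma hess_sym x i j : U x -> row j (hess x i) = row i (hess x j).
Proof.
move=> Ux; apply/rowP => c.
apply: (etrans (etrans (row_entry _ _ _) (hessE x i j c))); apply: esym.
apply: (etrans (etrans (row_entry _ _ _) (hessE x j i c))); apply: esym.
pose f y := Y y 0 c.
have Ef k : \forall y \near x, 'D_(delta_mx 0 k) f y = J y k c.
  by apply: filterS (near_open Ux) => y Uy; rewrite jacobian_coord.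
have C1f k : C1_at ('D_(delta_mx 0 k) f) x.
  apply: (C1_at_near _ (C1_at_jacobian k c Ux)).
  by apply: filterS (Ef k) => y ->.
transitivity ('D_(delta_mx 0 i) ('D_(delta_mx 0 j) f) x).
  by apply/esym/near_eq_derive.
transitivity ('D_(delta_mx 0 j) ('D_(delta_mx 0 i) f) x); last exact: near_eq_derive.
apply: schwarz.
- apply: filterS (near_open Ux) => y Uy.
  by have C := C1_at_coord c (C1_at_chart Uy); split; exact: C1_at_derivable.
- have [di _] := C1f i; have [dj _] := C1f j.
  apply: filterS (filterI di dj) => y [diy djy]; split; exact: diff_derivable.
- by have [_] := C1f j; exact.
- by have [_] := C1f i; exact.
Qed.

Lemma C1_at_height x : U x -> C1_at (fun y => Y y 0 ord_max) x.
Proof. by move=> Ux; exact: C1_at_coord (C1_at_chart Ux). Qed.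

Lemma is_derive_height x i : U x ->
  is_derive x (delta_mx 0 i) (fun y => Y y 0 ord_max) (J x i ord_max).
Proof.
by move=> Ux; rewrite jacobian_coord//; apply/derivableP/C1_at_derivable/C1_at_height.
Qed.

(** The gradient on the submanifold of b = - ln(height), in chart coordinates. *)
Definition downward x : 'rV[R]_n :=
  (- ((Y x 0 ord_max)^-1 *: (e *m (J x)^T))) *m invmx (first_form hyp_metric Y x).

Definition volume_density x : R := Num.sqrt (\det (first_form hyp_metric Y x)).

Lemma first_form_unit x : U x -> first_form hyp_metric Y x \in unitmx.
Proof. by move=> Ux; exact: (gram_unit (posY Ux) (fJ Ux) (first_form_hyp Y x)). Qed.

Lemma first_form_det_gt0 x : U x -> 0 < \det (first_form hyp_metric Y x).
Proof. by move=> Ux; exact: (gram_det_gt0 (posY Ux) (fJ Ux) (first_form_hyp Y x)). Qed.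

Lemma first_form_entry y i j : first_form hyp_metric Y y i j =
  (Y y 0 ord_max * Y y 0 ord_max)^-1 * \sum_c J y i c * J y j c.
Proof.
rewrite first_form_hyp [LHS]mxE -expr2; congr (_ * _); rewrite mulmx_entry.
by apply: eq_bigr => c _; rewrite trmx_entry.
Qed.

Lemma C1_at_first_form x i j : U x -> C1_at (fun y => first_form hyp_metric Y y i j) x.
Proof.
move=> Ux; have -> : (fun y => first_form hyp_metric Y y i j) =
   (fun y => (Y y 0 ord_max * Y y 0 ord_max)^-1 * \sum_c J y i c * J y j c).
  by apply/funext => y; exact: first_form_entry.
apply: C1_atM.
  apply: C1_atV; first by rewrite mulf_neq0// gt_eqF// posY.
  exact: C1_atM (C1_at_height Ux) (C1_at_height Ux).
apply: C1_at_sum => c _; exact: C1_atM (C1_at_jacobian _ _ Ux) (C1_at_jacobian _ _ Ux).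
Qed.

Lemma C1_at_volume_density x : U x -> C1_at volume_density x.
Proof.
move=> Ux; apply: (@C1_at_comp1 _ _ Num.sqrt); first exact: C1_at_sqrt (first_form_det_gt0 Ux).
by apply: C1_at_det => i j; exact: C1_at_first_form.
Qed.

Lemma C1_at_inv_first_form x i j : U x -> C1_at (fun y => invmx (first_form hyp_metric Y y) i j) x.
Proof.
move=> Ux; apply: C1_at_invmx; last exact: first_form_unit.
by move=> a b; exact: C1_at_first_form.
Qed.

Lemma downward_entry y i : downward y 0 i =
  \sum_j (- ((Y y 0 ord_max)^-1 * J y j ord_max)) * invmx (first_form hyp_metric Y y) j i.
Proof.
rewrite /downward mulmx_entry; apply: eq_bigr => j _; congr (_ * _).
by rewrite [LHS]mxE [X in - X]mxE (vertical_dot_tangent (J y) erefl).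
Qed.

Lemma C1_at_downward x i : U x -> C1_at (fun y => downward y 0 i) x.
Proof.
move=> Ux; have -> : (fun y => downward y 0 i) = (fun y => \sum_j
  (- ((Y y 0 ord_max)^-1 * J y j ord_max)) * invmx (first_form hyp_metric Y y) j i).
  by apply/funext => y; exact: downward_entry.
apply: C1_at_sum => j _; apply: C1_atM (C1_at_inv_first_form _ _ Ux).
apply/C1_atN/C1_atM/(C1_at_jacobian _ _ Ux).
by apply: C1_atV (C1_at_height Ux); rewrite gt_eqF// posY.
Qed.

Lemma C1_at_flux x i : U x -> C1_at (fun y => volume_density y * downward y 0 i) x.
Proof. move=> Ux; exact: C1_atM (C1_at_volume_density Ux) (C1_at_downward _ Ux). Qed.

Section Divergence.
Variable x : 'rV[R]_n.
Hypothesis Ux : U x.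
Let y := Y x 0 ord_max.
Let g := first_form hyp_metric Y x.
Let h := invmx g.
Let w : 'rV[R]_n := - (y^-1 *: (e *m (J x)^T)).
Let dg i : 'M[R]_n := - (2 * J x i ord_max / y) *: g +
   y ^- 2 *: (hess x i *m (J x)^T + J x *m (hess x i)^T).
Let dw i : 'rV[R]_n := - (y^-1 *: (e *m (hess x i)^T)) - (J x i ord_max / y) *: w.
Let P : 'M[R]_m.+1 := 1%:M - y ^- 2 *: ((J x)^T *m h *m J x).
Let nu : 'rV[R]_m.+1 := e *m P.
Let N : R := (nu *m nu^T) 0 0.

Let y0 : 0 < y. Proof. exact: posY. Qed.
Let yn0 : y != 0. Proof. by rewrite gt_eqF. Qed.

Lemma is_derive_first_form i a b :
  is_derive x (delta_mx 0 i) (fun y => first_form hyp_metric Y y a b) (dg i a b).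
Proof.
have -> : (fun y => first_form hyp_metric Y y a b) =
   (fun y => (Y y 0 ord_max * Y y 0 ord_max)^-1 * \sum_c J y a c * J y b c).
  by apply/funext => z; exact: first_form_entry.
have y2 : y * y != 0 by rewrite mulf_neq0.
have dy := is_derive_height i Ux.
have d1 := @is_derive_invr _ _ (fun z => Y z 0 ord_max * Y z 0 ord_max) _ _ _ y2 (is_derive_mulr dy dy).
have d2 := @is_derive_bigsum _ _ _ (index_enum 'I_m.+1) _ _ x (delta_mx 0 i) (fun c =>
   is_derive_mulr (is_derive_jacobian i a c Ux) (is_derive_jacobian i b c Ux)).
apply: is_derive_eq (is_derive_mulr d1 d2) _.
rewrite /dg [RHS]mxE [X in _ = X + _]mxE [X in _ = _ + X]mxE /g first_form_entry.
rewrite [X in _ = _ + _ * X]mxE.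
have -> : (hess x i *m (J x)^T) a b + (J x *m (hess x i)^T) a b =
   \sum_c (J x a c * hess x i b c + J x b c * hess x i a c).
  rewrite big_split /= addrC; congr (_ + _); rewrite mulmx_entry; apply: eq_bigr => c _.
    by rewrite trmx_entry mulrC.
  by rewrite trmx_entry.
exact: derive_gram_scalars.
Qed.

Lemma is_derive_inv_first_form i a b :
  is_derive x (delta_mx 0 i) (fun y => invmx (first_form hyp_metric Y y) a b)
    ((- (h *m dg i *m h)) a b).
Proof.
have d a' b' : derivable (fun y => invmx (first_form hyp_metric Y y) a' b') x (delta_mx 0 i).
  exact: C1_at_derivable (C1_at_inv_first_form a' b' Ux).
split; first exact: d.
have uU : \forall y \near x, first_form hyp_metric Y y \in unitmx.
  by apply: filterS (near_open Ux) => z; exact: first_form_unit.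
by have /matrixP/(_ a b) <- := derive_invmx (is_derive_first_form i) uU d; rewrite [RHS]mxE.
Qed.

(** The square of the density is a determinant, to which Jacobi's formula applies. *)
Lemma is_derive_volume_density i :
  is_derive x (delta_mx 0 i) volume_density (volume_density x * (2^-1 * \tr (h *m dg i))).
Proof.
have d0 := first_form_det_gt0 Ux.
have dd := is_derive_det (is_derive_first_form i).
have C := C1_at_volume_density Ux.
have dv : is_derive x (delta_mx 0 i) volume_density _ := derivableP (C1_at_derivable C).
have sq z : U z -> volume_density z * volume_density z = \det (first_form hyp_metric Y z).
  move=> Uz; exact: (etrans (esym (expr2 _)) (sqr_sqrtr (ltW (first_form_det_gt0 Uz)))).
have dv2 := is_derive_mulr dv dv.
have [_ E1] : is_derive x (delta_mx 0 i) (fun z => \det (first_form hyp_metric Y z))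
    (volume_density x * 'D_(delta_mx 0 i) volume_density x + volume_density x * 'D_(delta_mx 0 i) volume_density x).
  by apply: near_eq_is_derive dv2; apply: filterS (near_open Ux) => z /sq.
have [_ E2] := dd; rewrite E1 in E2.
have v0 : 0 < volume_density x by rewrite sqrtr_gt0.
split; first exact: C1_at_derivable C.
have adjE : \adj (first_form hyp_metric Y x) = (volume_density x * volume_density x) *: h.
  rewrite sq// /h /g /invmx first_form_unit// scalerA mulfV ?scale1r//.
  by rewrite gt_eqF.
rewrite adjE -scalemxAl mxtraceZ in E2.
apply: (mulfI (lt0r_neq0 v0)); apply: (@mulIf _ 2); first by rewrite pnatr_eq0.
rewrite mulr_natr mulr2n {}E2; move: (volume_density x) (\tr _) => v t; by field.
Qed.

Lemma is_derive_downward i j :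
  is_derive x (delta_mx 0 i) (fun y => downward y 0 j) ((dw i *m h - w *m h *m dg i *m h) 0 j).
Proof.
have -> : (fun y => downward y 0 j) = (fun y => \sum_a
  (- ((Y y 0 ord_max)^-1 * J y a ord_max)) * invmx (first_form hyp_metric Y y) a j).
  by apply/funext => z; exact: downward_entry.
have dy := @is_derive_invr _ _ (fun z => Y z 0 ord_max) _ _ _ yn0 (is_derive_height i Ux).
have dn a := is_deriveN (is_derive_mulr dy (is_derive_jacobian i a ord_max Ux)).
have H := @is_derive_bigsum _ _ _ (index_enum 'I_n) _ _ x (delta_mx 0 i) (fun a =>
  is_derive_mulr (dn a) (is_derive_inv_first_form i a j)).
apply: is_derive_eq H _; rewrite big_split /= addrC [RHS]mxE; congr (_ + _).
  rewrite mulmx_entry; apply: eq_bigr => a _; rewrite mulrC; congr (_ * _).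
  rewrite /dw /w [RHS]mxE [X in _ = X + _]mxE [X in _ = - X + _]mxE [X in _ = _ + X]mxE.
  rewrite [X in _ = _ - X]mxE [X in _ = _ - _ * X]mxE [X in _ = _ - _ * - X]mxE.
  rewrite (vertical_dot_tangent (J x) erefl) (vertical_dot_tangent (hess x i) erefl) -/y.
  exact: derive_weight_scalars.
have -> : - (w *m h *m dg i *m h) = w *m (- (h *m dg i *m h)) by rewrite mulmxN !mulmxA.
rewrite mulmx_entry; apply: eq_bigr => a _; congr (_ * _).
by rewrite /w [RHS]mxE [X in _ = - X]mxE (vertical_dot_tangent (J x) erefl).
Qed.

(** The product rule, followed by [divergence_pointwise] for the matrices of the chart at x. *)
Lemma divergence_formula :
  \sum_i 'D_(delta_mx 0 i) (fun y => volume_density y * downward y 0 i) x =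
  volume_density x * ((n%:R - 1) * (1 - N) - y^-1 * \sum_i (nu *m (hess x i)^T *m h) 0 i).
Proof.
rewrite -(divergence_pointwise y0 (fJ Ux) (fun i j => hess_sym i j Ux) erefl (first_form_hyp Y x) erefl erefl
  erefl (fun i => erefl (dg i)) (fun i => erefl (dw i)) erefl erefl erefl).
rewrite -/w -/g -/h; apply: (etrans (eq_bigr _ _) (esym (mulr_sumr _ _ _ _))) => i _.
have [_ E] := is_derive_mulr (is_derive_volume_density i) (is_derive_downward i i).
rewrite {}E -[downward x]/(w *m h).
move: (volume_density x) ((w *m h) 0 i) (\tr _) ((dw i *m h - w *m h *m dg i *m h) 0 i) => a b c d.
by ring.
Qed.

Lemma normal_part_hyp v : normal_part hyp_metric Y x v = v *m P.
Proof.
rewrite /normal_part /tangent_part /hyp_metric mul_mx_scalar -/y -/g -/h /P mulmxBr mulmx1.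
by rewrite -scalemxAr !mulmxA -!scalemxAl.
Qed.

(** Against nu the coordinate fields vanish, so the Christoffel terms of the form (vertical component)
    times (coordinate field) drop out; the remaining one is y g i j times the vertical vector. *)
Lemma cov_deriv_nu i j : (cov_deriv hyp_metric Y x i j *m nu^T) 0 0 =
  (row j (hess x i) *m nu^T) 0 0 + y * g i j * N.
Proof.
have -> : cov_deriv hyp_metric Y x i j = row j (hess x i) - y^-1 *: (J x i ord_max *: row j (J x)
   + J x j ord_max *: row i (J x) - (y ^+ 2 * g i j) *: e).
  apply/rowP => l; rewrite /cov_deriv [LHS]mxE (hess_partial i j l Ux) [RHS]mxE row_entry; congr (_ + _).
  rewrite [LHS]mxE.
  transitivity (\sum_a \sum_b - y^-1 * ((a == ord_max)%:R * (b == l)%:R + (b == ord_max)%:R * (a == l)%:R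
      - (l == ord_max)%:R * (a == b)%:R) * J x i a * J x j b).
    by apply: eq_bigr => a _; apply: eq_bigr => b _; rewrite (christoffel_hyp _ _ _ (posY Ux)).
  have S1 (F : 'I_m.+1 -> R) (k : 'I_m.+1) : \sum_a (a == k)%:R * F a = F k.
    rewrite (bigD1 k)//= eqxx mul1r big1 ?addr0// => a /negbTE ->; exact: mul0r.
  transitivity (- y^-1 * (J x i ord_max * J x j l + J x j ord_max * J x i l
     - (l == ord_max)%:R * \sum_a J x i a * J x j a)).
    rewrite mulrBr mulrDr.
    have -> : J x i ord_max * J x j l = \sum_a \sum_b (a == ord_max)%:R * (b == l)%:R * J x i a * J x j b.
      transitivity (\sum_a (a == ord_max)%:R * (J x i a * J x j l)); first by rewrite S1.
      apply: eq_bigr => a _; rewrite -(S1 (fun b => J x j b) l) mulr_sumr mulr_sumr.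
      by apply: eq_bigr => b _; rewrite -!mulrA; congr (_ * _); rewrite mulrCA.
    have -> : J x j ord_max * J x i l = \sum_a \sum_b (b == ord_max)%:R * (a == l)%:R * J x i a * J x j b.
      transitivity (\sum_a (a == l)%:R * (J x j ord_max * J x i a)); first by rewrite S1.
      apply: eq_bigr => a _; rewrite -(S1 (fun b => J x j b) ord_max) mulr_suml mulr_sumr.
      apply: eq_bigr => b _; rewrite !mulrA [_ * (a == l)%:R]mulrC -!mulrA.
      by congr (_ * (_ * _)); rewrite mulrC.
    have -> : (l == ord_max)%:R * (\sum_a J x i a * J x j a) =
        \sum_a \sum_b (l == ord_max)%:R * (a == b)%:R * J x i a * J x j b.
      rewrite mulr_sumr; apply: eq_bigr => a _; rewrite -(S1 (fun b => J x j b) a) !mulr_sumr.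
      apply: eq_bigr => b _; rewrite -!mulrA; congr (_ * _).
      by rewrite [b == a]eq_sym mulrCA.
    rewrite !mulr_sumr -big_split -sumrN -big_split; apply: eq_bigr => a _ /=.
    rewrite !mulr_sumr -big_split -sumrN -big_split; apply: eq_bigr => b _ /=.
    by rewrite !mulrBr !mulrDr !mulrBl !mulrDl !mulrA.
  rewrite [RHS]mxE mulNr; congr (- _); rewrite [RHS]mxE; congr (_ * _).
  rewrite [RHS]mxE [X in _ = X + _]mxE [X in _ = X + _ + _]mxE [X in _ = _ + X + _]mxE [X in _ = _ + X]mxE !row_entry.
  congr (_ - _); rewrite [RHS]mxE [X in _ = _ * X]mxE eqxx /= mulrC; congr (_ * _).
  rewrite /g first_form_entry -/y -expr2 mulrA mulfV ?expf_neq0// mul1r.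
  by [].
have Jn k := tangent_dot_nu y0 (fJ Ux) (first_form_hyp Y x) erefl erefl erefl k : (row k (J x) *m nu^T) 0 0 = 0.
have en : (e *m nu^T) 0 0 = N by exact: (vertical_dot_nu y0 (fJ Ux) (first_form_hyp Y x) erefl erefl erefl erefl).
rewrite mulmxBl [LHS]mxE; congr (_ + _).
rewrite [LHS]mxE -scalemxAl [in LHS]mxE mulmxBl mulmxDl [X in _ * X]mxE [X in _ * (X + _)]mxE.
rewrite [X in _ * (_ + X)]mxE -!scalemxAl [X in X + _ - _]mxE [X in _ + X - _]mxE [X in _ - X]mxE.
rewrite !Jn en; exact: cov_deriv_scalars.
Qed.

(** Trace of [cov_deriv_nu], as nu is fixed by the normal projection. *)
Lemma mean_curvature_nu : (mean_curvature hyp_metric Y x *m nu^T) 0 0 =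
  \sum_i (nu *m (hess x i)^T *m h) 0 i + y * n%:R * N.
Proof.
have PPE : P *m P = P by exact: (normal_proj_idem y0 (fJ Ux) (first_form_hyp Y x) erefl erefl).
have Psym : P^T = P by exact: (normal_proj_sym (first_form_hyp Y x) erefl erefl).
have Pnu : P *m nu^T = nu^T by rewrite /nu trmx_mul Psym mulmxA PPE.
have hgE : h *m g = 1%:M by exact: (inv_gram_mul y0 (fJ Ux) (first_form_hyp Y x) erefl).
have gsym : g^T = g by exact: (gram_sym (first_form_hyp Y x)).
have hsym : h^T = h by exact: (inv_gram_sym (first_form_hyp Y x) erefl).
have -> : (mean_curvature hyp_metric Y x *m nu^T) 0 0 =
   \sum_i \sum_j h i j * ((row j (hess x i) *m nu^T) 0 0 + y * g i j * N).
  rewrite /mean_curvature mulmx_suml summxE; apply: eq_bigr => i _.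
  rewrite mulmx_suml summxE; apply: eq_bigr => j _.
  rewrite -scalemxAl [LHS]mxE; congr (_ * _).
  by rewrite /second_form normal_part_hyp -mulmxA Pnu cov_deriv_nu.
under eq_bigr => i _ do under eq_bigr => j _ do rewrite mulrDr.
under eq_bigr => i _ do rewrite big_split /=.
rewrite big_split /=; congr (_ + _).
  apply: eq_bigr => i _; rewrite mulmx_entry; apply: eq_bigr => j _.
  have -> : h j i = h i j by rewrite -(trmx_entry h) hsym.
  rewrite mulrC; congr (_ * _).
  rewrite !mulmx_entry; apply: eq_bigr => c _.
  by rewrite row_entry !trmx_entry mulrC.
have : \tr (h *m g) = n%:R by rewrite hgE mxtrace1.
rewrite /mxtrace => <-; rewrite mulr_sumr mulr_suml; apply: eq_bigr => i _.
rewrite mulmx_entry mulr_sumr mulr_suml; apply: eq_bigr => j _.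
have -> : g j i = g i j by rewrite -(trmx_entry g) gsym.
by rewrite !mulrA; congr (_ * _ * _); rewrite mulrC.
Qed.

End Divergence.

Lemma cauchy_schwarz_row k (u v : 'rV[R]_k) :
  (u *m v^T) 0 0 <= Num.sqrt ((u *m u^T) 0 0) * Num.sqrt ((v *m v^T) 0 0).
Proof.
have uu := mulmx_tr_ge0 u; have vv := mulmx_tr_ge0 v.
have [v0|v0] := eqVneq v 0.
  by rewrite v0 trmx0 !mulmx0 mxE sqrtr0 mulr0.
have v1 := mulmx_tr_gt0 v0.
have E (b c : R) : ((b *: u - c *: v) *m (b *: u - c *: v)^T) 0 0 =
    b * b * (u *m u^T) 0 0 - b * c * 2 * (u *m v^T) 0 0 + c * c * (v *m v^T) 0 0.
  rewrite !mulmx_entry !mulr_sumr -sumrN -!big_split /=; apply: eq_bigr => i _.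
  by rewrite !trmx_entry !mxE; ring.
have H := mulmx_tr_ge0 (((v *m v^T) 0 0) *: u - ((u *m v^T) 0 0) *: v).
rewrite {}E in H; move: H uu vv v1.
move: ((u *m u^T) 0 0) ((v *m v^T) 0 0) ((u *m v^T) 0 0) => a b c H uu vv v1.
have H1 : c ^+ 2 <= a * b.
  rewrite -subr_ge0 -(pmulr_rge0 _ v1); apply: le_trans H _.
  by rewrite le_eqVlt; apply/orP; left; apply/eqP; ring.
rewrite -sqrtrM//; apply: le_trans (ler_norm _) _.
by rewrite -sqrtr_sqr ler_sqrt// (le_trans _ H1)// sqr_ge0.
Qed.

(** Pairing the hypothesis on the mean curvature with nu and using [mean_curvature_nu], the sum in
    [divergence_formula] is - <gphi, nu> - n y N in the Euclidean product. The divergence becomes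
    n - 1 + N + <gphi, nu> / y; here N >= 0, and |nu| <= 1 gives |<gphi, nu>| / y <= s. *)
Lemma divergence_ge (gphi : 'rV[R]_m.+1) (s : R) x : U x ->
  mean_curvature hyp_metric Y x + normal_part hyp_metric Y x gphi = 0 ->
  Defs.gnorm (hyp_metric (Y x)) gphi <= s ->
  (n%:R - 1 - s) * volume_density x <=
  \sum_i 'D_(delta_mx 0 i) (fun y => volume_density y * downward y 0 i) x.
Proof.
move=> Ux Hm Hs; rewrite divergence_formula//.
set y := Y x 0 ord_max; set h := invmx _; set P := 1%:M - _; set nu := e *m P.
set N := (nu *m nu^T) 0 0.
have y0 : 0 < y by exact: posY.
have Psym : P^T = P by exact: (normal_proj_sym (first_form_hyp Y x) erefl erefl).
have PPE : P *m P = P by exact: (normal_proj_idem y0 (fJ Ux) (first_form_hyp Y x) erefl erefl).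
have Pnu : P *m nu^T = nu^T by rewrite /nu trmx_mul Psym mulmxA PPE.
have N0 : 0 <= N by exact: mulmx_tr_ge0.
have N1 : N <= 1 by exact: (normal_length_le1 y0 (fJ Ux) erefl (first_form_hyp Y x) erefl erefl erefl erefl erefl erefl).
have E : \sum_i (nu *m (hess x i)^T *m h) 0 i = - ((gphi *m nu^T) 0 0) - y * n%:R * N.
  have E1 : (mean_curvature hyp_metric Y x *m nu^T) 0 0 =
     \sum_i (nu *m (hess x i)^T *m h) 0 i + y * n%:R * N by exact: mean_curvature_nu.
  have E0 : normal_part hyp_metric Y x gphi = gphi *m P by exact: normal_part_hyp.
  have E2 : normal_part hyp_metric Y x gphi *m nu^T = gphi *m nu^T.
    by rewrite E0 -[gphi *m P *m _]mulmxA Pnu.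
  have := congr1 (fun v : 'rV[R]_m.+1 => (v *m nu^T) 0 0) Hm.
  rewrite /= mulmxDl mul0mx [LHS]mxE [RHS]mxE E2 E1.
  move: (\sum_i _) (gphi *m nu^T) => a b H; rewrite -[LHS]addr0 -[in LHS]oppr0 -[in LHS]H.
  by ring.
rewrite E.
have cs : - (s * Num.sqrt N) <= y^-1 * (gphi *m nu^T) 0 0.
  rewrite lerNl -mulrN.
  have -> : - (gphi *m nu^T) 0 0 = ((- gphi) *m nu^T) 0 0 by rewrite mulNmx [RHS]mxE.
  have C := cauchy_schwarz_row (- gphi) nu.
  have -> : y^-1 * ((- gphi) *m nu^T) 0 0 = y^-1 * ((- gphi) *m nu^T) 0 0 by [].
  apply: (@le_trans _ _ (y^-1 * (Num.sqrt ((- gphi *m (- gphi)^T) 0 0) * Num.sqrt N))).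
    by rewrite ler_wpM2l// invr_ge0 ltW.
  rewrite mulrA ler_wpM2r ?sqrtr_ge0//; apply: le_trans Hs.
  have -> : Defs.gnorm (hyp_metric (Y x)) gphi = y^-1 * Num.sqrt ((- gphi *m (- gphi)^T) 0 0).
    rewrite /Defs.gnorm /inner /hyp_metric mul_mx_scalar -scalemxAl.
    have -> : (- gphi *m (- gphi)^T) = gphi *m gphi^T by rewrite linearN /= mulNmx mulmxN opprK.
    rewrite [X in Num.sqrt X = _]mxE sqrtrM ?invr_ge0 ?exprn_ge0 ?(ltW y0)//.
    by rewrite -exprVn sqrtr_sqr ger0_norm// invr_ge0 ltW.
  exact: lexx.
have v0 : 0 <= volume_density x by exact: sqrtr_ge0.
rewrite mulrC ler_wpM2l//.
have q0 := sqrtr_ge0 N; have q1 : Num.sqrt N <= 1 by rewrite -sqrtr1 ler_sqrt.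
have qq : N = Num.sqrt N ^+ 2 by rewrite sqr_sqrtr.
have s0 : 0 <= s by apply: le_trans Hs; exact: sqrtr_ge0.
have -> : (n%:R - 1) * (1 - N) - y^-1 * (- (gphi *m nu^T) 0 0 - y * n%:R * N) =
   n%:R - 1 + N + y^-1 * (gphi *m nu^T) 0 0.
  by have yn0 : y != 0 by [rewrite gt_eqF]; field.
rewrite -!addrA lerD2l lerD2l.
apply: le_trans (lerD N0 cs); rewrite add0r lerN2 -[leRHS]mulr1; exact: ler_wpM2l.
Qed.

End Chart.

(** * Transport of integrals by a chart *)

Section Transport.
Local Open Scope ereal_scope.
Context d1 d2 (S : measurableType d1) (T : measurableType d2) (R : realType).
Variables (mu : {measure set S -> \bar R}) (la : {measure set T -> \bar R}).
Variables (E : set S) (F : set T) (psi : T -> S) (dens : T -> R).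
Hypotheses (mE : measurable E) (mF : measurable F) (mpsi : measurable_fun F psi)
  (psiE : forall x, F x -> E (psi x)) (mdens : measurable_fun F dens)
  (dens0 : forall x, F x -> (0 <= dens x)%R)
  (muE : forall A, measurable A -> A `<=` E ->
     mu A = \int[la]_(x in F `&` psi @^-1` A) (dens x)%:E).

Import HBNNSimple.

(** The hypothesis on mu is the formula for indicator functions; linearity gives it for simple
    functions and monotone convergence for their limits. *)
Lemma ge0_integral_transport (h : S -> \bar R) : measurable_fun setT h ->
  (forall x, 0 <= h x) ->
  \int[mu]_(x in E) h x = \int[la]_(x in F) (h (psi x) * (dens x)%:E).
Proof.
move=> mh h0; pose g_ := nnsfun_approx measurableT mh.
have inv_gram_mul x : EFin \o g_ ^~ x @ \oo --> h x.
  by apply: cvg_nnsfun_approx => // y _; exact: h0.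
have mgpsi n : measurable_fun F (g_ n \o psi).
  by apply: (measurableT_comp (measurable_funP (g_ n)) mpsi).
have mdE : measurable_fun F (fun x => (dens x)%:E) by apply/measurable_EFinP.
have mgE n : measurable_fun F (fun x => (g_ n (psi x))%:E).
  by apply/measurable_EFinP; exact: mgpsi.
have mk n k : measurable (g_ n @^-1` [set k]) by exact: measurable_funPTI.
have miE n k : measurable_fun F (fun x => (\1_(g_ n @^-1` [set k]) (psi x) : R)%:E).
  by apply/measurable_EFinP; exact: (measurableT_comp (measurable_indic (mk n k)) mpsi).
transitivity (limn (fun n => \int[mu]_(x in E) (g_ n x)%:E)).
  rewrite -monotone_convergence//.
  - by apply: eq_integral => y _; apply/esym/cvg_lim => //; exact: inv_gram_mul.
  - by move=> n; apply/measurable_EFinP; apply: measurable_funTS; exact: measurable_funP.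
  - by move=> n y _; rewrite lee_fin.
  - by move=> y _ m n mn; rewrite lee_fin; exact/lefP/nd_nnsfun_approx.
transitivity (limn (fun n => \int[la]_(x in F) ((g_ n (psi x))%:E * (dens x)%:E))); last first.
  rewrite -monotone_convergence//.
  - apply: eq_integral => x /[!inE] Fx; apply/cvg_lim => //.
    apply: cvgeZr => //; exact: inv_gram_mul.
  - by move=> n; apply: emeasurable_funM; [exact: mgE|exact: mdE].
  - by move=> n x Fx; rewrite mule_ge0// lee_fin// dens0.
  - move=> x Fx m n mn; rewrite lee_wpmul2r// lee_fin; [exact: dens0|exact/lefP/nd_nnsfun_approx].
apply: (congr1 (fun u : nat -> \bar R => limn u)); apply/funext => n.
transitivity (\sum_(k \in range (g_ n)) \int[mu]_(x in E) (k * \1_(g_ n @^-1` [set k]) x)%:E).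
  under eq_integral do rewrite fimfunE -fsumEFin//.
  rewrite ge0_integral_fsum//.
  - by move=> y; exact/measurable_EFinP/measurable_funM.
  - by move=> y x _; rewrite nnfun_muleindic_ge0.
transitivity (\sum_(k \in range (g_ n)) \int[la]_(x in F) ((k * \1_(g_ n @^-1` [set k]) (psi x))%:E * (dens x)%:E)); last first.
  have mind k : measurable_fun F (fun x => (k * \1_(g_ n @^-1` [set k]) (psi x))%:E * (dens x)%:E).
    apply: emeasurable_funM; last exact: mdE.
    by under eq_fun do rewrite EFinM; exact: measurable_funeM.
  rewrite -ge0_integral_fsum//.
  - apply: eq_integral => x _; rewrite fimfunE -fsumEFin// ge0_mule_fsuml//.
    by move=> k; rewrite nnfun_muleindic_ge0.
  - by move=> k x Fx; apply: mule_ge0; [rewrite EFinM; exact: nnfun_muleindic_ge0|rewrite lee_fin; exact: dens0].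
apply: eq_fsbigr => k /set_mem [y _ gk]; have k0 : (0 <= k)%R by rewrite -gk.
rewrite integralZl_indic_nnsfun//.
under [RHS]eq_integral do rewrite EFinM -muleA.
rewrite ge0_integralZl//; last first.
- by move=> x Fx; rewrite mule_ge0// lee_fin ?dens0.
- by apply: emeasurable_funM; [exact: miE|exact: mdE].
congr (_ * _); rewrite integral_indic// muE; [|exact: measurableI|by move=> ? []].
rewrite [RHS]integral_mkcond [LHS]integral_mkcond; apply: eq_integral => x _.
rewrite /patch; case: (boolP (x \in F)) => [/set_mem Fx|/negP nFx]; last first.
  by case: ifPn => // /set_mem [Fx _]; exfalso; apply: nFx; rewrite mem_set.
case: ifPn => [/set_mem [_ [gx _]]|/negP H].
  by rewrite indicE mem_set// mul1e.
rewrite indicE memNset ?mul0e// => gx; apply: H; apply/mem_set; split=> //; split=> //.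
exact: psiE.
Qed.

Lemma integral_transport (h : S -> R) : measurable_fun setT h ->
  la.-integrable F (fun x => (h (psi x) * dens x)%:E) ->
  mu.-integrable E (EFin \o h) /\
  \int[mu]_(x in E) (h x)%:E = \int[la]_(x in F) (h (psi x) * dens x)%:E.
Proof.
move=> mh ih.
have mh' : measurable_fun setT (EFin \o h) by exact/measurable_EFinP.
split.
  apply/integrableP; split; first exact: measurable_funTS.
  rewrite (@ge0_integral_transport (fun x => `|(h x)%:E|))//; last exact: measurableT_comp.
  move/integrableP : ih => [_]; apply: le_lt_trans; rewrite le_eqVlt; apply/orP; left; apply/eqP.
  apply: eq_integral => x /[!inE] Fx; rewrite EFinM abseM [`|(dens x)%:E|]gee0_abs// lee_fin.
  exact: dens0.
have maxM (a : \bar R) b : (0 <= b)%R -> maxe (a * b%:E) 0 = maxe a 0 * b%:E.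
  by move=> b0; rewrite maxe_pMl ?mul0e.
rewrite integralE [RHS]integralE; congr (_ - _).
  rewrite (@ge0_integral_transport (EFin \o h)^\+)//; last exact: measurable_funepos.
  apply: eq_integral => x /[!inE] Fx; rewrite !funeposE EFinM maxM//; exact: dens0.
rewrite (@ge0_integral_transport (EFin \o h)^\-)//; last exact: measurable_funeneg.
by apply: eq_integral => x /[!inE] Fx; rewrite !funenegE EFinM -mulNe maxM// dens0.
Qed.

End Transport.

(** * C1 functions and gradients on the immersed manifold *)

Section ChartFacts.
Context {R : realType} {n : nat} {M : smooth_manifold R n}.
Variables (c : chart R n M) (ac : atlas c).

Lemma chart_dom_open : open (chart_dom c). Proof. by have [] := atlas_chart ac. Qed.

Lemma chart_img_open : open (chart_img c). Proof. by have [] := atlas_chart ac. Qed.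

Lemma chart_mapK q : chart_dom c q -> chart_inv c (chart_map c q) = q.
Proof. by have [_ _ H _ _] := atlas_chart ac; exact: H. Qed.

Lemma chart_img_map q : chart_dom c q -> chart_img c (chart_map c q).
Proof. by move=> dq; exists q. Qed.

Lemma chart_inv_dom x : chart_img c x -> chart_dom c (chart_inv c x).
Proof. by move=> [q dq <-]; rewrite chart_mapK. Qed.

Lemma chart_invK x : chart_img c x -> chart_map c (chart_inv c x) = x.
Proof. by move=> [q dq <-]; rewrite chart_mapK. Qed.

Lemma chart_map_continuous q : chart_dom c q -> {for q, continuous (chart_map c)}.
Proof. by have [_ _ _ H _] := atlas_chart ac; exact: H. Qed.

Lemma chart_inv_continuous x : chart_img c x -> {for x, continuous (chart_inv c)}.
Proof. by have [_ _ _ _ H] := atlas_chart ac; exact: H. Qed.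

Lemma chart_image_subset (A : set M) : A `<=` chart_dom c ->
  chart_map c @` A = chart_img c `&` chart_inv c @^-1` A.
Proof.
move=> AE; apply/seteqP; split=> [x [q Aq <-]|x [ix Ax]].
  by split; [exact/chart_img_map/AE|rewrite /= chart_mapK//; exact: AE].
by exists (chart_inv c x) => //; exact: chart_invK.
Qed.

Lemma chart_near_inv x (A : set M) : chart_img c x -> open A -> A (chart_inv c x) ->
  \forall y \near x, chart_img c y /\ A (chart_inv c y).
Proof.
move=> ix oA Ax; apply: filterI; first exact: open_nbhs_nbhs (conj chart_img_open ix).
exact: (chart_inv_continuous ix (open_nbhs_nbhs (conj oA Ax))).
Qed.

Lemma measurable_chart_dom : measurable (chart_dom c : set (borel M)).
Proof. by apply: sub_sigma_algebra; exact: chart_dom_open. Qed.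

Lemma measurable_chart_img : measurable (chart_img c : set (borelV R n)).
Proof. by apply: sub_sigma_algebra; exact: chart_img_open. Qed.

Lemma measurable_chart_inv :
  measurable_fun (chart_img c : set (borelV R n)) (chart_inv c : borelV R n -> borel M).
Proof.
apply: (@borel_continuous_measurable 'rV[R]_n M (chart_img c) (chart_inv c) chart_img_open).
by move=> x; exact: chart_inv_continuous.
Qed.

End ChartFacts.

(** The gradient does not depend on the chart: with J the Jacobian of the transition map, the
    differential, the Gram matrix and the tangent frame become d J^T, J g J^T and J A. *)
Lemma gradient_change_frame {R : realType} (n k : nat) (d : 'rV[R]_n) (g g' J : 'M[R]_n)
    (A : 'M[R]_(n, k)) : g' = J *m g *m J^T -> g \in unitmx -> g' \in unitmx ->
  d *m J^T *m invmx g' *m (J *m A) = d *m invmx g *m A.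
Proof.
move=> gE ug ug'.
have uJ : J \in unitmx by move: ug'; rewrite gE !unitmx_mul => /andP[/andP[]].
have K0 : J *m (g *m (J^T *m invmx g' *m J)) = J.
  rewrite [LHS](_ : _ = (J *m g *m J^T) *m invmx g' *m J); last by rewrite !mulmxA.
  by rewrite -gE mulmxV// mul1mx.
have K : g *m (J^T *m invmx g' *m J) = 1%:M by apply: (can_inj (mulKmx uJ)); rewrite K0 mulmx1.
have K2 : J^T *m invmx g' *m J = invmx g by rewrite -[LHS](mulKmx ug) K mulmx1.
by rewrite -K2 !mulmxA.
Qed.

Section Immersed.
Context {R : realType} {n m : nat} {M : smooth_manifold R n}.
Variables (X : M -> 'rV[R]_m.+1) (imX : immersion X half_space).

Local Notation Y c := (X \o chart_inv c).

Section OneChart.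
Variables (c : chart R n M) (ac : atlas c).

Lemma immersion_smooth2 : Ck_on 2 (chart_img c) (Y c).
Proof. by have [H _ _] := imX; exact: (H c ac 2%N). Qed.

Lemma immersion_height_gt0 q : 0 < X q 0 ord_max.
Proof. by have [_ H _] := imX; exact: H. Qed.

Lemma immersion_pos x : chart_img c x -> 0 < (Y c) x 0 ord_max.
Proof. by move=> _; exact: immersion_height_gt0. Qed.

Lemma immersion_free x : chart_img c x -> row_free (jacobian (Y c) x).
Proof. by have [_ _ H] := imX; exact: H. Qed.

Let oU := chart_img_open ac.
Let sY := immersion_smooth2.
Let pY := immersion_pos.
Let fY := immersion_free.

Local Notation vd := (volume_density (Y c)).

Lemma measurable_volume_density : measurable_fun (chart_img c : set (borelV R n)) vd.
Proof.
apply: (@borel_continuous_measurable_real R 'rV[R]_n (chart_img c) vd oU).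
move=> x ix; apply: C1_at_continuous; exact: (C1_at_volume_density oU sY pY fY ix).
Qed.

Variables (mu : {measure set (borel M) -> \bar R}).
Hypothesis vol : riemannian_volume hyp_metric X mu.

Lemma chart_volume (A : set (borel M)) : measurable A -> A `<=` chart_dom c ->
  mu A = (\int[lebV n]_(x in chart_img c `&` chart_inv c @^-1` A) (vd x)%:E)%E.
Proof.
move=> mA AE; rewrite (vol ac mA AE) (chart_image_subset ac AE).
have mB : measurable ((chart_img c `&` chart_inv c @^-1` A) : set (borelV R n)).
  by apply: (measurable_chart_inv ac) => //; exact: measurable_chart_img.
have E : (fun x => (\1_(chart_img c `&` chart_inv c @^-1` A) x *
    Num.sqrt (\det (first_form hyp_metric (Y c) x)))%:E) =
  (fun x => (vd x)%:E) \_ (chart_img c `&` chart_inv c @^-1` A).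
  apply/funext => x; rewrite /patch indicE; case: ifPn => _; by rewrite ?mul1r ?mul0r.
rewrite E leb_intE; first by rewrite [RHS]integral_mkcond.
  apply/(measurable_restrictT _ mB); apply/measurable_EFinP.
  by apply: measurable_funS measurable_volume_density => //; exact: measurable_chart_img.
by move=> x; rewrite /patch; case: ifPn => // _; rewrite lee_fin sqrtr_ge0.
Qed.

Lemma chart_integral (h : borel M -> R) : measurable_fun setT h ->
  (lebV n).-integrable (chart_img c) (fun x : borelV R n => (h (chart_inv c x) * vd x)%:E) ->
  mu.-integrable (chart_dom c) (EFin \o h) /\
  (\int[mu]_(q in chart_dom c) (h q)%:E =
   \int[lebV n]_(x in chart_img c) (h (chart_inv c x) * vd x)%:E)%E.
Proof.
move=> mh ih; apply: (@integral_transport _ _ (borel M) (borelV R n) R mu (lebV n)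
   (chart_dom c) (chart_img c) (chart_inv c) vd) => //.
- exact: measurable_chart_dom.
- exact: measurable_chart_img.
- exact: measurable_chart_inv.
- by move=> x; exact: chart_inv_dom.
- exact: measurable_volume_density.
- by move=> x _; exact: sqrtr_ge0.
- exact: chart_volume.
Qed.

End OneChart.

Definition C1M (f : M -> R) := forall c, atlas c -> forall x, chart_img c x ->
  C1_at (f \o chart_inv c) x.

Lemma smooth_C1M f : smooth_map f -> C1M f.
Proof.
move=> sf c ac x ix; have := sf c ac 1%N.
by move/(C1_onP _ (chart_img_open ac)); apply.
Qed.

Lemma C1M_continuous f : C1M f -> continuous f.
Proof.
move=> Cf q; have [c ac dq] := atlas_cover q.
have c1 := C1_at_continuous (Cf c ac _ (chart_img_map dq)).
have c2 := chart_map_continuous ac dq.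
apply: (@near_eq_continuous _ _ ((f \o chart_inv c) \o chart_map c)); last exact: (continuous_comp c2 c1).
have := open_nbhs_nbhs (conj (chart_dom_open ac) dq); apply: filterS => q' dq'.
by rewrite /= chart_mapK.
Qed.

(** The transition maps are smooth, so that one chart around q decides. *)
Lemma C1M_at_chart (f : M -> R) (g : 'rV[R]_n -> R) c q : atlas c -> chart_dom c q ->
  C1_at g (chart_map c q) -> (\forall q' \near q, f q' = g (chart_map c q')) ->
  forall c', atlas c' -> chart_dom c' q -> C1_at (f \o chart_inv c') (chart_map c' q).
Proof.
move=> ac dq Cg fg c' ac' dq'; set x' := chart_map c' q.
have ix' : chart_img c' x' by exact: chart_img_map.
have qE : chart_inv c' x' = q by exact: chart_mapK.
pose tau := chart_map c \o chart_inv c'.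
have Ctau : C1_at tau x'.
  have oD : open (chart_map c' @` (chart_dom c' `&` chart_dom c)).
    rewrite chart_image_subset//.
    rewrite openE => y [iy [d1 d2]].
    have := chart_near_inv ac' iy (openI (chart_dom_open ac') (chart_dom_open ac)) (conj d1 d2).
    by apply: filterS => z [iz [? ?]]; split.
  have := atlas_smooth ac' ac 1%N; move/(C1_onP _ oD); apply.
  by exists q.
apply: (@C1_at_near _ _ _ (g \o tau)); last first.
  by apply: C1_at_comp => //; rewrite /tau /= qE.
have ci := chart_inv_continuous ac' ix'; rewrite /prop_for /continuous_at qE in ci.
have H : \forall y \near x', f (chart_inv c' y) = g (chart_map c (chart_inv c' y)).
  exact: (ci [set q' | f q' = g (chart_map c q')] fg).
by apply: filterS H => y /= ->.
Qed.

Lemma C1MD f g : C1M f -> C1M g -> C1M (fun q => f q + g q).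
Proof. by move=> Cf Cg c ac x ix; exact: C1_atD (Cf c ac x ix) (Cg c ac x ix). Qed.

Lemma C1MM f g : C1M f -> C1M g -> C1M (fun q => f q * g q).
Proof. by move=> Cf Cg c ac x ix; exact: C1_atM (Cf c ac x ix) (Cg c ac x ix). Qed.

Lemma C1M_comp psi f : (forall t, C1_at psi t) -> C1M f -> C1M (fun q => psi (f q)).
Proof. by move=> Cp Cf c ac x ix; exact: C1_at_comp1 (Cp _) (Cf c ac x ix). Qed.

Lemma chart_atP (q : M) : atlas (chart_at q) /\ chart_dom (chart_at q) q.
Proof. by rewrite /chart_at; case: (cid2 (atlas_cover q)). Qed.

Definition differential (f : M -> R) (c : chart R n M) (x : 'rV[R]_n) : 'rV[R]_n :=
  \row_j partial j (f \o chart_inv c) x.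

Definition chart_grad (f : M -> R) (c : chart R n M) (x : 'rV[R]_n) : 'rV[R]_m.+1 :=
  differential f c x *m invmx (first_form hyp_metric (Y c) x) *m jacobian (Y c) x.

Lemma differentialE f c x j : differential f c x 0 j = 'D_(delta_mx 0 j) (f \o chart_inv c) x.
Proof. by rewrite mxE. Qed.

(** [grad] is computed in a chosen chart; by the chain rule and [gradient_change_frame] every chart
    gives the same vector. *)
Lemma gradE f c q : C1M f -> atlas c -> chart_dom c q ->
  grad hyp_metric X f q = chart_grad f c (chart_map c q).
Proof.
move=> Cf ac dq; have [ac' dq'] := chart_atP q; move: ac' dq'; set c' := chart_at q => ac' dq'.
rewrite -[LHS]/(chart_grad f c' (chart_map c' q)).
set x' := chart_map c' q; set x := chart_map c q.
have ix' : chart_img c' x' by exact: chart_img_map.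
have ix : chart_img c x by exact: chart_img_map.
have qE : chart_inv c' x' = q by exact: chart_mapK.
pose tau := chart_map c \o chart_inv c'.
have tx : tau x' = x by rewrite /tau /= qE.
have dtau : differentiable tau x'.
  have [+ _] := atlas_smooth ac' ac 1%N; apply.
  by exists q.
have nE : \forall y \near x', chart_inv c' y = chart_inv c (tau y).
  have : chart_dom c (chart_inv c' x') by rewrite qE.
  move=> H; have := chart_near_inv ac' ix' (chart_dom_open ac) H.
  by apply: filterS => y [_ dy]; rewrite /tau /= chart_mapK.
pose J := \matrix_(i, k) 'D_(delta_mx 0 i) (fun y => tau y 0 k) x'.
have chain (f1 : M -> R) i : C1_at (f1 \o chart_inv c) x ->
    'D_(delta_mx 0 i) (f1 \o chart_inv c') x' = \sum_k J i k * 'D_(delta_mx 0 k) (f1 \o chart_inv c) x.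
  move=> C1; transitivity ('D_(delta_mx 0 i) ((f1 \o chart_inv c) \o tau) x').
    by apply: near_eq_derive; apply: filterS nE => y /= ->.
  have [/nbhs_singleton d _] := C1.
  rewrite derive_comp_rV ?tx//; apply: eq_bigr => k _; congr (_ * _); by rewrite mxE.
have dE : differential f c' x' = differential f c x *m J^T.
  apply/rowP => i; rewrite differentialE chain; last exact: Cf.
  by rewrite mulmx_entry; apply: eq_bigr => k _; rewrite trmx_entry differentialE mulrC.
have JE : jacobian (Y c') x' = J *m jacobian (Y c) x.
  apply/matrixP => i a.
  rewrite (jacobian_coord (immersion_smooth2 ac') i a ix').
  rewrite -[LHS]/('D_(delta_mx 0 i) ((fun q => X q 0 a) \o chart_inv c') x') chain.
    rewrite mulmx_entry; apply: eq_bigr => k _; congr (_ * _).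
    by rewrite (jacobian_coord (immersion_smooth2 ac) k a ix).
  exact: (C1_at_coord a (C1_at_chart (chart_img_open ac) (immersion_smooth2 ac) ix)).
have YE : (Y c') x' = (Y c) x by rewrite /= qE /x chart_mapK.
have gE : first_form hyp_metric (Y c') x' = J *m first_form hyp_metric (Y c) x *m J^T.
  by rewrite /first_form JE YE trmx_mul !mulmxA.
have ug' := first_form_unit (immersion_pos (c := c')) (immersion_free ac') ix'.
have ug := first_form_unit (immersion_pos (c := c)) (immersion_free ac) ix.
rewrite /chart_grad dE JE; exact: (gradient_change_frame _ _ gE ug ug').
Qed.

Lemma grad_continuous f : C1M f -> continuous (grad hyp_metric X f).
Proof.
move=> Cf q; have [c ac dq] := atlas_cover q.
set x := chart_map c q; have ix : chart_img c x by exact: chart_img_map.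
have oU := chart_img_open ac.
apply: (@near_eq_continuous _ _ (chart_grad f c \o chart_map c)).
  have := open_nbhs_nbhs (conj (chart_dom_open ac) dq); apply: filterS => q' dq'.
  by rewrite (gradE Cf ac dq').
apply: (continuous_comp (chart_map_continuous ac dq)).
apply: continuous_rV => a.
have E : (fun y => chart_grad f c y 0 a) = (fun y => \sum_j (\sum_i 'D_(delta_mx 0 i) (f \o chart_inv c) y *
    invmx (first_form hyp_metric (Y c) y) i j) * jacobian (Y c) y j a).
  apply/funext => y; rewrite /chart_grad mulmx_entry; apply: eq_bigr => j _; congr (_ * _).
  by rewrite mulmx_entry; apply: eq_bigr => i _; rewrite differentialE.
rewrite E; apply: continuous_sum => j _.
have c1 : {for x, continuous (fun y => jacobian (Y c) y j a)}.
  exact: C1_at_continuous (C1_at_jacobian oU (immersion_smooth2 ac) j a ix).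
have c2 : {for x, continuous (fun y => \sum_i 'D_(delta_mx 0 i) (f \o chart_inv c) y *
    invmx (first_form hyp_metric (Y c) y) i j)}.
  apply: continuous_sum => i _.
  have [_ c3] := Cf c ac x ix.
  have c4 := C1_at_continuous (C1_at_inv_first_form oU (immersion_smooth2 ac)
     (immersion_pos (c := c)) (immersion_free ac) i j ix).
  exact: (continuousM (c3 (delta_mx 0 i)) c4).
exact: (continuousM c2 c1).
Qed.

(** The product of grad h with grad b, b = - ln(height): minus the vertical component of grad h over
    the height, as grad h is tangent and the ambient gradient of b is minus the height times the
    vertical vector. *)
Definition radial (h : M -> R) (q : M) : R := - grad hyp_metric X h q 0 ord_max / X q 0 ord_max.

Lemma X_continuous : continuous X.
Proof.
move=> q; have [c ac dq] := atlas_cover q.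
have ix : chart_img c (chart_map c q) by exact: chart_img_map.
apply: (@near_eq_continuous _ _ (Y c \o chart_map c)).
  have := open_nbhs_nbhs (conj (chart_dom_open ac) dq); apply: filterS => q' dq'.
  by rewrite /= chart_mapK.
apply: (continuous_comp (chart_map_continuous ac dq)).
exact: C1_at_continuous (C1_at_chart (chart_img_open ac) (immersion_smooth2 ac) ix).
Qed.

Lemma height_continuous : continuous (fun q => X q 0 ord_max).
Proof.
by move=> q; apply: (@continuous_comp _ _ _ X (fun N : 'rV[R]_m.+1 => N 0 ord_max) q (@X_continuous q)); exact: coord_continuous.
Qed.

Lemma radial_continuous h : C1M h -> continuous (radial h).
Proof.
move=> Ch q; have c1 : {for q, continuous (fun q => grad hyp_metric X h q 0 ord_max)}.
  by apply: (@continuous_comp _ _ _ (grad hyp_metric X h) (fun N : 'rV[R]_m.+1 => N 0 ord_max) q (@grad_continuous h Ch q)); exact: coord_continuous.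
have c2 : {for q, continuous (fun q => (X q 0 ord_max)^-1)}.
  apply: (@continuousV _ _ (fun q => X q 0 ord_max)); last exact: height_continuous.
  by rewrite gt_eqF// immersion_height_gt0.
exact: (continuousM (continuousN c1) c2).
Qed.

Lemma radialE h c x : C1M h -> atlas c -> chart_img c x ->
  radial h (chart_inv c x) = \sum_i 'D_(delta_mx 0 i) (h \o chart_inv c) x * downward (Y c) x 0 i.
Proof.
move=> Ch ac ix; rewrite /radial (gradE Ch ac (chart_inv_dom ac ix)) chart_invK// /chart_grad.
have hs : (invmx (first_form hyp_metric (Y c) x))^T = invmx (first_form hyp_metric (Y c) x).
  exact: (inv_gram_sym (first_form_hyp (Y c) x) erefl).
rewrite -[X in - X / _](_ : (differential h c x *m (invmx (first_form hyp_metric (Y c) x) *m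
    (jacobian (Y c) x *m (delta_mx 0 ord_max : 'rV[R]_m.+1)^T))) 0 0 = _); last first.
  by rewrite !mulmxA -trmx_entry trmx_mul trmxK -rowE row_entry trmx_entry.
rewrite mulmx_entry mulNr mulr_suml -sumrN; apply: eq_bigr => i _.
rewrite differentialE -mulrA -mulrN; congr (_ * _).
rewrite /downward mulNmx [RHS]mxE; congr (- _).
rewrite -!scalemxAl [RHS]mxE mulrC; congr (_ * _).
by rewrite -[LHS]trmx_entry trmx_mul hs trmx_mul trmxK.
Qed.

Lemma radialD h1 h2 q : C1M h1 -> C1M h2 ->
  radial (fun q => h1 q + h2 q) q = radial h1 q + radial h2 q.
Proof.
move=> C1 C2; have [c ac dq] := atlas_cover q.
have ix := chart_img_map dq; rewrite -(chart_mapK ac dq).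
rewrite !radialE//; last exact: C1MD.
rewrite -big_split /=; apply: eq_bigr => i _; rewrite -mulrDl; congr (_ * _).
exact: (deriveD (C1_at_derivable (C1 _ ac _ ix)) (C1_at_derivable (C2 _ ac _ ix))).
Qed.

Lemma grad_comp (psi dpsi : R -> R) (f : M -> R) q : (forall t, C1_at psi t) ->
    (forall t, 'D_1 psi t = dpsi t) -> C1M f ->
  grad hyp_metric X (fun q => psi (f q)) q = dpsi (f q) *: grad hyp_metric X f q.
Proof.
move=> Cp dp Cf; have [c ac dq] := atlas_cover q.
have ix := chart_img_map dq.
rewrite (gradE (C1M_comp Cp Cf) ac dq) (gradE Cf ac dq) /chart_grad.
suff -> : differential (fun q => psi (f q)) c (chart_map c q) =
    dpsi (f q) *: differential f c (chart_map c q) by rewrite -!scalemxAl.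
apply/rowP => j; rewrite [RHS]mxE !differentialE.
have [/nbhs_singleton df _] := Cf c ac _ ix.
have [/nbhs_singleton dps _] := Cp (f (chart_inv c (chart_map c q))).
have dc := @differentiable_comp _ _ _ _ (f \o chart_inv c) psi _ df dps.
have E1 : 'D_(delta_mx 0 j) (psi \o (f \o chart_inv c)) (chart_map c q) =
    'd psi (f q) ('D_(delta_mx 0 j) (f \o chart_inv c) (chart_map c q)).
  by rewrite (deriveE _ dc) (diff_comp df dps) /= (deriveE _ df) chart_mapK.
rewrite -[LHS]/('D_(delta_mx 0 j) (psi \o (f \o chart_inv c)) (chart_map c q)) E1.
move: ('D_(delta_mx 0 j) _ _) => t; rewrite chart_mapK// in dps.
rewrite -dp (deriveE _ dps) -[in LHS](mulr1 t) -[t * 1]/(t *: (1 : R)) linearZ.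
exact: mulrC.
Qed.

End Immersed.

(** * Extension by zero and cutoff functions *)

Section ZeroExtension.
Context {R : realType} {n : nat}.
Implicit Types (U K : set 'rV[R]_n) (g : 'rV[R]_n -> R).

Definition zero_ext U g : 'rV[R]_n -> R := fun x => if x \in U then g x else 0.

Lemma zero_ext_in U g x : U x -> zero_ext U g x = g x.
Proof. by move=> Ux; rewrite /zero_ext mem_set. Qed.

(** When the support of g is a closed part K of the open set U, the extension by zero is as regular
    as g: near any point it is either g or 0. *)
Section Compact.
Variables (U K : set 'rV[R]_n) (g : 'rV[R]_n -> R).
Hypotheses (oU : open U) (cK : closed K) (KU : K `<=` U)
  (g0 : forall x, U x -> ~ K x -> g x = 0).

Lemma zero_ext_out x : ~ K x -> zero_ext U g x = 0.
Proof. by move=> Kx; rewrite /zero_ext; case: ifPn => // /set_mem Ux; exact: g0. Qed.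

Lemma near_zero_ext x :
  (U x /\ \forall y \near x, g y = zero_ext U g y) \/ (\forall y \near x, 0 = zero_ext U g y).
Proof.
have [Ux|nUx] := pselect (U x); [left|right].
  by split=> //; apply: filterS (open_nbhs_nbhs (conj oU Ux)) => y Uy; rewrite zero_ext_in.
have nK : ~ K x by move=> /KU.
have oK : open (~` K) by exact: closed_openC.
by apply: filterS (open_nbhs_nbhs (conj oK nK)) => y /zero_ext_out.
Qed.

Lemma continuous_zero_ext : (forall x, U x -> {for x, continuous g}) -> continuous (zero_ext U g).
Proof.
move=> cg x; have [[Ux H]|H] := near_zero_ext x.
  exact: (near_eq_continuous H (cg _ Ux)).
exact: (near_eq_continuous H (@cst_continuous _ _ (0 : R) x)).
Qed.

Lemma C1_at_zero_ext : (forall x, U x -> C1_at g x) -> forall x, C1_at (zero_ext U g) x.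
Proof.
move=> Cg x; have [[Ux H]|H] := near_zero_ext x; first exact: (C1_at_near H (Cg _ Ux)).
exact: (C1_at_near H (C1_at_cst _ _)).
Qed.

Lemma derive_zero_ext_in x v : U x -> 'D_v (zero_ext U g) x = 'D_v g x.
Proof.
move=> Ux; apply: near_eq_derive.
by apply: filterS (open_nbhs_nbhs (conj oU Ux)) => y Uy; rewrite zero_ext_in.
Qed.

Lemma derive_zero_ext_out x v : ~ U x -> 'D_v (zero_ext U g) x = 0.
Proof.
move=> Ux; have [[//]|H] := near_zero_ext x.
have -> : 'D_v (zero_ext U g) x = 'D_v (cst 0) x; last exact: derive_cst.
apply: near_eq_derive.
by apply: filterS H => y ->.
Qed.

End Compact.

End ZeroExtension.

Section RealC1.
Context {R : realType}.

Lemma C1_at_real (psi dpsi : R -> R) : (forall t, is_derive t (1 : R) psi (dpsi t)) ->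
  continuous dpsi -> forall t, C1_at psi t.
Proof.
move=> D c t; apply: (@C1_at_intro R R R psi (fun y v : R => v * dpsi y)).
  near=> y; have [d e] := D y.
  have df : differentiable psi y by apply/derivable1_diffP.
  split=> // v; rewrite (deriveE _ df) -[v in LHS]mulr1 -[v * 1]/(v *: (1 : R)) linearZ /=.
  by rewrite -(deriveE _ df) e.
move=> v; exact: (continuousM (@cst_continuous _ _ v t) (c t)).
Unshelve. all: by end_near. Qed.

(** At the origin it is enough that the function is o(|t|). *)
Lemma is_derive_at0 (psi w : R -> R) : psi 0 = 0 -> (forall t, `|psi t| <= `|t| * w t) ->
  w t @[t --> 0^'] --> (0 : R) -> is_derive 0 (1 : R) psi 0.
Proof.
move=> p0 pw w0.
have H : (fun h : R => h^-1 *: ((psi \o shift 0) (h *: (1 : R)) - psi 0)) @ 0^' --> (0 : R).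
  apply/norm_cvg0P; apply: (@squeeze_cvgr _ _ _ _ (cst 0) w); [|exact: cvg_cst|exact: w0].
  near=> h; rewrite /= normr_ge0 /= p0 subr0 addr0 [h *: 1]mulr1 normrZ normfV.
  have h0 : h != 0 by near: h; exact: nbhs_dnbhs_neq.
  by rewrite ler_pdivrMl ?normr_gt0.
split; first by apply/cvg_ex; exists 0.
by apply/cvg_lim.
Unshelve. all: by end_near. Qed.

Definition pos_sqr (t : R) : R := Num.max 0 t ^+ 2.
Definition pos_part2 (t : R) : R := 2 * Num.max 0 t.

Lemma is_derive_pos_sqr t : is_derive t (1 : R) pos_sqr (pos_part2 t).
Proof.
have [t0|t0|->] := ltrgtP t 0.
- apply: (@near_eq_is_derive R R R (fun=> 0) pos_sqr); last first.
    by rewrite /pos_part2 max_l ?mulr0 ?ltW//; exact: is_derive_cst.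
  have : \forall y \near t, y < 0 by by apply: open_nbhs_nbhs; split; [exact: open_lt|].
  by apply: filterS => y y0; rewrite /pos_sqr max_l ?expr0n// ltW.
- apply: (@near_eq_is_derive R R R (fun y : R => y * y) pos_sqr); last first.
    rewrite /pos_part2 max_r ?ltW//.
    by apply: is_derive_eq (is_derive_mulr (is_derive_id t 1) (is_derive_id t 1)) _; rewrite mulr1 mulr_natl.
  have : \forall y \near t, 0 < y by by apply: open_nbhs_nbhs; split; [exact: open_gt|].
  by apply: filterS => y y0; rewrite /pos_sqr max_r ?expr2// ltW.
rewrite /pos_part2 maxxx mulr0; apply: (@is_derive_at0 _ (fun t => `|t|)).
- by rewrite /pos_sqr maxxx expr0n.
- move=> s; rewrite /pos_sqr; have [s0|s0] := leP s 0.
    by rewrite expr0n normr0 mulr_ge0.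
  by rewrite normrX expr2.
- have H : `|t| @[t --> (0 : R)] --> `|0 : R| by exact: norm_continuous.
  by rewrite normr0 in H => A /H; exact: nbhs_dnbhs.
Qed.

Lemma C1_at_pos_sqr t : C1_at pos_sqr t.
Proof.
apply: C1_at_real => [s|]; first exact: is_derive_pos_sqr.
move=> s; have c : {for s, continuous (Num.max (0 : R))}.
  exact: (@continuous_max R R (cst 0) id s (@cst_continuous _ _ _ s) (@cvg_id _ _)).
exact: (continuousM (@cst_continuous _ _ (2 : R) s) c).
Qed.

End RealC1.

Section Cutoff.
Context {R : realType}.

(** A C1 step built from [pos_sqr] alone: it is 1 for s <= 1/2, where pos_sqr (1 - s) >= 1/4, and 0 for
    s >= 1. *)
Definition cutoff (s : R) : R := 1 - pos_sqr (1 - 4 * pos_sqr (1 - s)).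

Lemma pos_sqr_ge0 (t : R) : 0 <= pos_sqr t.
Proof. exact: sqr_ge0. Qed.

Lemma pos_sqr_npos (t : R) : t <= 0 -> pos_sqr t = 0.
Proof. by move=> t0; rewrite /pos_sqr max_l// expr0n. Qed.

Lemma pos_sqr_nneg (t : R) : 0 <= t -> pos_sqr t = t ^+ 2.
Proof. by move=> t0; rewrite /pos_sqr max_r. Qed.

Lemma cutoff_ge0 s : 0 <= cutoff s.
Proof.
rewrite /cutoff; have := pos_sqr_ge0 (1 - s); move: (pos_sqr _) => a a0.
have [t0|t0] := leP (1 - 4 * a) 0; first by rewrite pos_sqr_npos// subr0.
rewrite pos_sqr_nneg ?(ltW t0)//; nra.
Qed.

Lemma cutoff_le1 s : cutoff s <= 1.
Proof. by rewrite /cutoff lerBlDr lerDl pos_sqr_ge0. Qed.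

Lemma cutoff_eq1 s : s <= 2^-1 -> cutoff s = 1.
Proof.
move=> s1; rewrite /cutoff [X in _ - X]pos_sqr_npos ?subr0// pos_sqr_nneg; first nra.
lra.
Qed.

Lemma cutoff_eq0 s : 1 <= s -> cutoff s = 0.
Proof.
move=> s1; rewrite /cutoff (@pos_sqr_npos (1 - s)) ?mulr0 ?subr0; last lra.
by rewrite pos_sqr_nneg// expr1n subrr.
Qed.

Lemma C1_at_cutoff s : C1_at cutoff s.
Proof.
apply: C1_atB; first exact: C1_at_cst.
apply: (@C1_at_comp1 _ _ pos_sqr); first exact: C1_at_pos_sqr.
apply: C1_atB; first exact: C1_at_cst.
apply: C1_atZ; apply: (@C1_at_comp1 _ _ pos_sqr); first exact: C1_at_pos_sqr.
by apply: C1_atB; [exact: C1_at_cst|exact: C1_at_id].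
Qed.

End Cutoff.

Section Bump.
Context {R : realType} {n : nat}.

(** Euclidean rather than the sup norm of row vectors, for smoothness. *)
Definition sqr_dist (x0 x : 'rV[R]_n) : R := \sum_i (x 0 i - x0 0 i) * (x 0 i - x0 0 i).

Lemma C1_at_sqr_dist x0 x : C1_at (sqr_dist x0) x.
Proof.
apply: C1_at_sum => i _.
have H : C1_at (fun x : 'rV[R]_n => x 0 i - x0 0 i) x.
  by apply: C1_atB; [apply: (@C1_at_coord _ _ _ id); exact: C1_at_id|exact: C1_at_cst].
exact: C1_atM.
Qed.

Lemma norm_le_sqr_dist x0 x d : 0 <= d -> sqr_dist x0 x <= d ^+ 2 -> `|x - x0| <= d.
Proof.
move=> d0 H; have [->//|/mx_norm_neq0 [[i j] /= E]] := eqVneq `|x - x0| 0.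
rewrite [leLHS]E !ord1 !mxE.
rewrite -(ler_pXn2r (n := 2)) ?nnegrE// real_normK ?num_real//; apply: le_trans H.
rewrite /sqr_dist (bigD1 j)//= expr2 lerDl; apply: sumr_ge0 => k _; exact: sqr_ge0.
Qed.

Definition bump (x0 : 'rV[R]_n) (d : R) (x : 'rV[R]_n) : R := cutoff (sqr_dist x0 x / d ^+ 2).

Lemma C1_at_bump x0 d x : C1_at (bump x0 d) x.
Proof.
apply: (@C1_at_comp1 _ _ cutoff); first exact: C1_at_cutoff.
apply: C1_atM; [exact: C1_at_sqr_dist|exact: C1_at_cst].
Qed.

Lemma bump_support x0 d x : 0 < d -> bump x0 d x != 0 -> `|x - x0| <= d.
Proof.
move=> d0; have [H _|H] := leP `|x - x0| d => //.
rewrite /bump cutoff_eq0 ?eqxx// ler_pdivlMr ?exprn_gt0// mul1r leNgt; apply/negP => /ltW.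
by move/(norm_le_sqr_dist (ltW d0)); rewrite leNgt H.
Qed.

Lemma bump_near1 x0 d : 0 < d -> \forall x \near x0, bump x0 d x = 1.
Proof.
move=> d0; have c : {for x0, continuous (sqr_dist x0)} by exact: C1_at_continuous (C1_at_sqr_dist x0 x0).
have z : sqr_dist x0 x0 = 0 by rewrite /sqr_dist big1// => i _; rewrite subrr mul0r.
have H : \forall x \near x0, sqr_dist x0 x < d ^+ 2 / 2.
  apply: (c [set t | t < d ^+ 2 / 2]); rewrite z; apply: open_nbhs_nbhs; split; first exact: open_lt.
  by rewrite /= divr_gt0// exprn_gt0.
apply: filterS H => x H; rewrite /bump cutoff_eq1// ler_pdivrMr ?exprn_gt0// mulrC; exact: ltW.
Qed.

End Bump.

Section ChartBump.
Context {R : realType} {n : nat} {M : smooth_manifold R n}.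
Variables (c : chart R n M) (ac : atlas c).

Lemma chart_compact_closed (K : set 'rV[R]_n) : compact K -> K `<=` chart_img c ->
  closed (chart_inv c @` K).
Proof.
move=> cK KU; apply: compact_closed; first exact: manifold_hausdorff.
apply: continuous_compact => //; apply: continuous_in_subspaceT => x /set_mem Kx.
exact: (chart_inv_continuous ac (KU _ Kx)).
Qed.

(** The bump is supported in the preimage K of a closed ball contained in the chart image. Compactness
    makes this preimage closed in the Hausdorff space M, hence the extension by zero is C1. *)
Lemma chart_bump q0 : chart_dom c q0 -> exists (beta : M -> R) (K : set 'rV[R]_n),
  [/\ C1M beta, (forall q, 0 <= beta q <= 1), (\forall q \near q0, beta q = 1),
      compact K /\ K `<=` chart_img c &
      forall q, beta q != 0 -> chart_dom c q /\ K (chart_map c q)].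
Proof.
move=> d0; set x0 := chart_map c q0.
have /nbhs_normP[r /= r0 rU] : nbhs x0 (chart_img c).
  by apply: open_nbhs_nbhs; split; [exact: chart_img_open ac|exact: chart_img_map].
pose d := r / 2; have dp : 0 < d by rewrite divr_gt0.
pose K := [set x : 'rV[R]_n | `|x - x0| <= d].
pose beta q := if q \in chart_dom c then bump x0 d (chart_map c q) else 0.
have cK : compact K.
  have -> : K = (fun x => x + x0) @` [set x : 'rV[R]_n | `|x| <= d].
    apply/seteqP; split=> [x Kx|_ [x Kx <-]]; last by rewrite /K /= addrK.
    by exists (x - x0) => //; rewrite subrK.
  have cs : continuous (fun x : 'rV[R]_n => x + x0).
    move=> x; exact: (continuousD (f := fun x : 'rV[R]_n => x) (g := fun=> x0) (@cvg_id _ _) (@cst_continuous _ _ x0 x)).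
  apply: continuous_compact; last exact: closed_norm_le.
  exact: continuous_subspaceT.
have KU : K `<=` chart_img c.
  move=> x Kx; apply: rU; rewrite /ball_ /= distrC.
  by apply: le_lt_trans Kx _; rewrite /d ltr_pdivrMr// ltr_pMr// ltr1n.
have bE q : chart_dom c q -> beta q = bump x0 d (chart_map c q) by move=> dq; rewrite /beta mem_set.
have b0 q : beta q != 0 -> chart_dom c q /\ K (chart_map c q).
  rewrite /beta; case: ifPn => [/set_mem dq|_]; last by rewrite eqxx.
  by move/(bump_support dp).
exists beta, K; split=> //.
- move=> c' ac' x ix'; rewrite -(chart_invK ac' ix').
  have dq' : chart_dom c' (chart_inv c' x) by exact: chart_inv_dom.
  set q := chart_inv c' x in dq' *; have [dq|ndq] := pselect (chart_dom c q).
    apply: (C1M_at_chart ac dq (C1_at_bump x0 d _)) => //.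
    by apply: filterS (open_nbhs_nbhs (conj (chart_dom_open ac) dq)) => q' /bE.
  have nK : ~ (chart_inv c @` K) q by move=> [y Ky yq]; apply: ndq; rewrite -yq; exact/(chart_inv_dom ac)/KU.
  have [c'' ac'' dq''] := atlas_cover q.
  apply: (C1M_at_chart ac'' dq'' (C1_at_cst 0 _)) => //.
  have oK : open (~` (chart_inv c @` K)) by exact/closed_openC/chart_compact_closed.
  apply: filterS (open_nbhs_nbhs (conj oK nK)) => q' nq'.
  apply/eqP/negPn/negP => /b0 [dq1 Kq1]; apply: nq'; exists (chart_map c q') => //.
  exact: chart_mapK.
- move=> q; rewrite /beta; case: ifPn => _; last by rewrite lexx ler01.
  by rewrite cutoff_ge0 cutoff_le1.
- have cm := chart_map_continuous ac d0.
  have H : \forall q \near q0, bump x0 d (chart_map c q) = 1.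
    exact: (cm [set x | bump x0 d x = 1] (bump_near1 x0 dp)).
  apply: filterS2 H (open_nbhs_nbhs (conj (chart_dom_open ac) d0)) => q H dq.
  by rewrite bE.
Qed.

End ChartBump.

(** * The drift inequality for compactly supported functions *)

Section IntegralHelpers.
Context d (T : measurableType d) {R : realType} (mu : {measure set T -> \bar R}).
Implicit Types (f g h r : T -> R).

Lemma integrableD_fin f g : mu.-integrable setT (EFin \o f) -> mu.-integrable setT (EFin \o g) ->
  mu.-integrable setT (EFin \o (fun x => f x + g x)).
Proof.
move=> fi gi; rewrite (_ : EFin \o _ = (EFin \o f) \+ (EFin \o g))%E//.
exact: integrableD.
Qed.

Lemma integrableZ_fin (a : R) f : mu.-integrable setT (EFin \o f) ->
  mu.-integrable setT (EFin \o (fun x => a * f x)).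
Proof.
move=> fi; rewrite (_ : EFin \o _ = (fun x => a%:E * (EFin \o f) x)%E)//.
exact: integrableZl.
Qed.

Lemma integralD_fin_le0 f g : mu.-integrable setT (EFin \o f) -> mu.-integrable setT (EFin \o g) ->
  (\int[mu]_x (f x)%:E <= 0)%E -> (\int[mu]_x (g x)%:E <= 0)%E ->
  (\int[mu]_x (f x + g x)%:E <= 0)%E.
Proof.
move=> fi gi f0 g0; under eq_integral do rewrite EFinD.
by rewrite integralD//; exact: adde_le0.
Qed.

Lemma drift_integralD (a : R) h1 r1 h2 r2 :
  [/\ mu.-integrable setT (EFin \o h1), mu.-integrable setT (EFin \o r1) &
      (\int[mu]_x (a * h1 x + r1 x)%:E <= 0)%E] ->
  [/\ mu.-integrable setT (EFin \o h2), mu.-integrable setT (EFin \o r2) &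
      (\int[mu]_x (a * h2 x + r2 x)%:E <= 0)%E] ->
  [/\ mu.-integrable setT (EFin \o (fun x => h1 x + h2 x)),
      mu.-integrable setT (EFin \o (fun x => r1 x + r2 x)) &
      (\int[mu]_x (a * (h1 x + h2 x) + (r1 x + r2 x))%:E <= 0)%E].
Proof.
move=> [i1 j1 d1] [i2 j2 d2]; split; [exact: integrableD_fin|exact: integrableD_fin|].
have -> : (fun x => (a * (h1 x + h2 x) + (r1 x + r2 x))%:E) =
          (fun x => ((a * h1 x + r1 x) + (a * h2 x + r2 x))%:E).
  by apply/funext => q; rewrite mulrDr addrACA.
by apply: integralD_fin_le0 => //; apply: integrableD_fin => //; exact: integrableZ_fin.
Qed.

End IntegralHelpers.

Lemma sum_product_rule (R : realType) (n : nat) (D F K W : 'I_n -> R) (a v : R) :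
  (forall i, D i = a * F i + v * W i * K i) ->
  \sum_i D i = a * (\sum_i F i) + v * (\sum_i K i * W i).
Proof.
move=> H; rewrite !mulr_sumr -big_split /=; apply: eq_bigr => i _.
by rewrite H -mulrA [W i * _]mulrC.
Qed.

Section Drift.
Context {R : realType} {n m : nat} {M : smooth_manifold R n}.
Variables (X : M -> 'rV[R]_m.+1) (imX : immersion X half_space).
Variables (mu : {measure set (borel M) -> \bar R}) (c0 : R).
Hypothesis vol : riemannian_volume hyp_metric X mu.

Local Notation Y c := (X \o chart_inv c).

Lemma grad_near0 k q : C1M k -> (\forall q' \near q, k q' = 0) -> grad hyp_metric X k q = 0.
Proof.
move=> Ck k0; have [c ac dq] := atlas_cover q.
have ix : chart_img c (chart_map c q) by exact: chart_img_map.
have ci := chart_inv_continuous ac ix; rewrite /prop_for /continuous_at chart_mapK// in ci.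
have H : \forall x \near chart_map c q, (k \o chart_inv c) x = cst 0 x.
  exact: (ci [set q' | k q' = 0] k0).
rewrite (gradE imX Ck ac dq) /chart_grad.
suff -> : differential k c (chart_map c q) = 0 by rewrite !mul0mx.
apply/rowP => i; rewrite differentialE [RHS]mxE.
have -> : 'D_(delta_mx 0 i) (k \o chart_inv c) (chart_map c q) =
          'D_(delta_mx 0 i) (cst 0) (chart_map c q) by exact: near_eq_derive.
exact: derive_cst.
Qed.

Lemma radial_near0 k q : C1M k -> (\forall q' \near q, k q' = 0) -> radial X k q = 0.
Proof. by move=> Ck k0; rewrite /radial grad_near0// mxE oppr0 mul0r. Qed.

(** The weak form of div (grad b) >= c0 tested against h. Integrability is part of it, to make it
    additive in h. *)
Definition drift_le0 (h : M -> R) := [/\ mu.-integrable setT (EFin \o (h : borel M -> R)),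
  mu.-integrable setT (EFin \o (radial X h : borel M -> R)) &
  (\int[mu]_q (c0 * h q + radial X h q)%:E <= 0)%E].

Lemma drift_le0D h1 h2 : C1M h1 -> C1M h2 -> drift_le0 h1 -> drift_le0 h2 ->
  drift_le0 (fun q => h1 q + h2 q).
Proof.
move=> C1 C2 d1 d2; rewrite /drift_le0.
have -> : radial X (fun q => h1 q + h2 q) = fun q => radial X h1 q + radial X h2 q.
  by apply/funext => q; exact: radialD.
exact: (drift_integralD d1 d2).
Qed.

Section Local.
Variables (c : chart R n M) (ac : atlas c).
Hypothesis Hdiv : forall x, chart_img c x -> c0 * volume_density (Y c) x <=
  \sum_i 'D_(delta_mx 0 i) (fun y => volume_density (Y c) y * downward (Y c) y 0 i) x.
Variables (K : set 'rV[R]_n) (cK : compact K) (KU : K `<=` chart_img c).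

Local Notation U := (chart_img c).
Local Notation vd := (volume_density (Y c)).

Lemma compact_norm_le : exists r : R, forall x, K x -> `|x| <= r.
Proof.
have [r [_ H]] := compact_bounded cK; exists (`|r| + 1) => x Kx.
by apply: (H (`|r| + 1)) => //; rewrite ltr_pwDr// ler_norm.
Qed.

Lemma integrable_zero_ext (g : 'rV[R]_n -> R) :
  (lebV n).-integrable setT (EFin \o zero_ext U g : borelV R n -> _) ->
  (lebV n).-integrable U (EFin \o g : borelV R n -> _) /\
  (\int[lebV n]_(x in U) (g x)%:E = \int[lebV n]_x (zero_ext U g x)%:E)%E.
Proof.
have E : (fun x : borelV R n => (zero_ext U g x)%:E) = (EFin \o g) \_ U.
  by apply/funext => x; rewrite /zero_ext /patch; case: ifPn.
have mU := measurable_chart_img ac.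
by move=> ig; split; [rewrite (integrable_mkcond _ mU) -E|rewrite integral_mkcond -E].
Qed.

(** In the chart the integrand is continuous with compact support, which gives the integrability. *)
Lemma integral_chart_support (h : M -> R) : continuous h ->
  (forall q, h q != 0 -> chart_dom c q /\ K (chart_map c q)) ->
  let g := zero_ext U (fun x => h (chart_inv c x) * vd x) in
  [/\ mu.-integrable setT (EFin \o (h : borel M -> R)),
      (lebV n).-integrable setT (EFin \o g : borelV R n -> _) &
      (\int[mu]_q (h q)%:E = \int[lebV n]_x (g x)%:E)%E].
Proof.
move=> ch hK g.
have oU := chart_img_open ac.
have cKc : closed K by apply: compact_closed => //; exact: norm_hausdorff.
have g0 x : U x -> ~ K x -> h (chart_inv c x) * vd x = 0.
  move=> Ux nK; apply/eqP; rewrite mulf_eq0; apply/orP; left; apply/negPn/negP => /hK [_].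
  by rewrite chart_invK.
have cg : continuous g.
  apply: (continuous_zero_ext oU cKc KU g0) => x Ux.
  have c1 : {for x, continuous (h \o chart_inv c)}.
    exact: (continuous_comp (chart_inv_continuous ac Ux) (ch (chart_inv c x))).
  have c2 := C1_at_continuous (C1_at_volume_density oU (immersion_smooth2 imX ac)
    (immersion_pos imX (c := c)) (immersion_free imX ac) Ux).
  exact: (continuousM c1 c2).
have [r Hr] := compact_norm_le.
have ig : (lebV n).-integrable setT (EFin \o g : borelV R n -> _).
  apply: (continuous_compact_support_integrable cg (r := r)) => x rx.
  apply: (zero_ext_out g0) => /Hr; rewrite leNgt rx//.
have [ig1 E1] := integrable_zero_ext ig.
have mh : measurable_fun setT (h : borel M -> R).
  by apply: (@borel_continuous_measurable_real R M setT h openT) => q _; exact: ch.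
have [ih E2] := chart_integral imX ac vol mh ig1.
have EM : (EFin \o (h : borel M -> R)) \_ (chart_dom c) = EFin \o (h : borel M -> R).
  apply/funext => q; rewrite /patch; case: ifPn => // /negP nq /=.
  apply/esym/eqP; rewrite eqe; apply/negPn/negP => /hK [dq _]; apply: nq; exact/mem_set.
split=> //.
  by move: ih; rewrite (integrable_mkcond _ (measurable_chart_dom ac)) EM.
by apply: (etrans _ E1); apply: (etrans _ E2); rewrite [RHS]integral_mkcond; congr (integral _ _ _); exact: esym EM.
Qed.

(** In the chart, the integral of the divergence of k (grad b) is zero and its integrand is
    <grad k, grad b> + k div (grad b), which is at least <grad k, grad b> + c0 k. *)
Lemma local_drift_le0 (k : M -> R) : C1M k -> (forall q, 0 <= k q) ->
  (forall q, k q != 0 -> chart_dom c q /\ K (chart_map c q)) -> drift_le0 k.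
Proof.
move=> Ck k0 kK.
have oU := chart_img_open ac.
have cKc : closed K by apply: compact_closed => //; exact: norm_hausdorff.
have clK := chart_compact_closed ac cK KU.
have Kinv q : (chart_inv c @` K) q -> chart_dom c q /\ K (chart_map c q).
  by move=> [x Kx <-]; have Ux := KU Kx; rewrite chart_invK//; split=> //; exact: (chart_inv_dom ac).
have near0 q : ~ (chart_dom c q /\ K (chart_map c q)) -> \forall q' \near q, k q' = 0.
  move=> nq; have nK : ~ (chart_inv c @` K) q by move=> /Kinv.
  have oK : open (~` (chart_inv c @` K)) by exact: closed_openC.
  apply: filterS (open_nbhs_nbhs (conj oK nK)) => q' nq'.
  apply/eqP/negPn/negP => /kK [dq' Kq']; apply: nq'; exists (chart_map c q') => //.
  exact: chart_mapK.
have rK q : radial X k q != 0 -> chart_dom c q /\ K (chart_map c q).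
  move=> r0; apply: contrapT => nq; move/eqP : r0; apply.
  exact: (radial_near0 Ck (near0 q nq)).
have dK q : c0 * k q + radial X k q != 0 -> chart_dom c q /\ K (chart_map c q).
  have [k0q|/kK//] := eqVneq (k q) 0; rewrite k0q mulr0 add0r; exact: rK.
have ck := C1M_continuous Ck; have cr := radial_continuous imX Ck.
have cd : continuous (fun q => c0 * k q + radial X k q).
  move=> q; exact: (continuousD (continuousM (@cst_continuous _ _ c0 q) (ck q)) (cr q)).
have [ik _ _] := integral_chart_support ck kK.
have [ir _ _] := integral_chart_support cr rK.
have [_ ig Ed] := integral_chart_support cd dK.
split=> //; rewrite [X in (X <= _)%E]Ed.
pose V i := zero_ext U (fun x => k (chart_inv c x) * (vd x * downward (Y c) x 0 i)).
have Vg0 i x : U x -> ~ K x -> k (chart_inv c x) * (vd x * downward (Y c) x 0 i) = 0.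
  move=> Ux nK; apply/eqP; rewrite mulf_eq0; apply/orP; left; apply/negPn/negP => /kK [_].
  by rewrite chart_invK.
have CF i x : U x -> C1_at (fun y => vd y * downward (Y c) y 0 i) x.
  exact: (C1_at_flux oU (immersion_smooth2 imX ac) (immersion_pos imX (c := c)) (immersion_free imX ac) i).
have CV i x : C1_at (V i) x.
  apply: (C1_at_zero_ext oU cKc KU (@Vg0 i)) => {}x Ux.
  exact: (C1_atM (Ck c ac x Ux) (CF i x Ux)).
have [r Hr] := compact_norm_le.
have HV i : (lebV n).-integrable setT (fun x : borelV R n => ('D_(delta_mx 0 i) (V i) x)%:E) /\
  (\int[lebV n]_x ('D_(delta_mx 0 i) (V i) x)%:E = 0)%E.
  apply: (@integral_derive_eq0 R n (V i) (delta_mx 0 i) r).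
  - by move=> x; exact: C1_at_continuous (CV i x).
  - by move=> x; exact: C1_at_derivable (CV i x).
  - by move=> x; have [_ H] := CV i x; exact: H.
  - by move=> x rx; apply: (zero_ext_out (@Vg0 i)) => /Hr; rewrite leNgt rx.
have iS : (lebV n).-integrable setT (fun x : borelV R n => \sum_(i < n) ('D_(delta_mx 0 i) (V i) x)%:E)%E.
  by apply: integrable_sum => // i _; have [] := HV i.
have -> : (0 = \int[lebV n]_x (\sum_(i < n) ('D_(delta_mx 0 i) (V i) x)%:E))%E.
  rewrite integral_sum//; last by move=> i; have [] := HV i.
  by rewrite big1// => i _; have [] := HV i.
apply: le_integral => // x _; rewrite /= sumEFin lee_fin.
have [Ux|nUx] := pselect (U x); last first.
  rewrite /zero_ext memNset//; apply: sumr_ge0 => i _.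
  by rewrite (derive_zero_ext_out oU cKc KU (@Vg0 i)).
rewrite zero_ext_in// (radialE imX Ck ac Ux).
apply: (@le_trans _ _ (k (chart_inv c x) * (c0 * vd x) + vd x *
   \sum_i 'D_(delta_mx 0 i) (k \o chart_inv c) x * downward (Y c) x 0 i)).
  by rewrite mulrDl [c0 * _]mulrC -mulrA [(\sum_i _) * _]mulrC.
have -> : \sum_(i < n) 'D_(delta_mx 0 i) (V i) x =
    k (chart_inv c x) * (\sum_i 'D_(delta_mx 0 i) (fun y => vd y * downward (Y c) y 0 i) x) +
    vd x * \sum_i 'D_(delta_mx 0 i) (k \o chart_inv c) x * downward (Y c) x 0 i.
  apply: sum_product_rule => i; rewrite derive_zero_ext_in//.
  have d1 : is_derive x (delta_mx 0 i : 'rV[R]_n) (k \o chart_inv c) ('D_(delta_mx 0 i) (k \o chart_inv c) x).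
    exact/derivableP/C1_at_derivable/(Ck c ac x Ux).
  have d2 := derivableP (C1_at_derivable (v := delta_mx 0 i) (CF i x Ux)).
  by have [_ ->] := is_derive_mulr d1 d2.
rewrite lerD2r; apply: ler_wpM2l => //; exact: Hdiv.
Qed.

End Local.

Hypothesis Hdiv : forall c, atlas c -> forall x, chart_img c x -> c0 * volume_density (Y c) x <=
  \sum_i 'D_(delta_mx 0 i) (fun y => volume_density (Y c) y * downward (Y c) y 0 i) x.

Definition local_cutoff (beta : M -> R) := [/\ C1M beta, (forall q, 0 <= beta q <= 1) &
  forall h, C1M h -> (forall q, 0 <= h q) -> drift_le0 (fun q => beta q * h q)].

Lemma local_cutoff_exists q0 : exists beta, local_cutoff beta /\ (\forall q \near (q0 : M), beta q = 1).
Proof.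
have [c ac dq] := atlas_cover q0.
have [beta [K [Cb b01 bn [cK KU] bK]]] := chart_bump ac dq.
exists beta; split=> //; split=> // h Ch h0; apply: (local_drift_le0 ac (Hdiv ac) cK KU).
- exact: C1MM.
- by move=> q; rewrite mulr_ge0//; have /andP[] := b01 q.
- by move=> q; rewrite mulf_eq0 negb_or => /andP[/bK].
Qed.

(** Write h = beta h + (1 - beta) h for each cutoff beta in turn. What remains at the end is h times the
    product of all 1 - beta, which is zero if at each point of the support some beta equals 1. *)
Lemma drift_le0_cutoffs (s : seq (M -> R)) h : C1M h -> (forall q, 0 <= h q) ->
  (forall i, (i < size s)%N -> local_cutoff (nth (fun=> 0) s i)) ->
  (forall q, h q != 0 -> exists2 i, (i < size s)%N & nth (fun=> 0) s i q = 1) -> drift_le0 h.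
Proof.
elim: s h => [|b s IH] h Ch h0 Hs Hh.
  have hE : h = fun=> 0.
    by apply/funext => q; apply/eqP/negPn/negP => /Hh [].
  have rE : radial X h = fun=> 0.
    by apply/funext => q; apply: radial_near0 => //; near=> q'; rewrite hE.
  split; rewrite ?rE ?hE; [exact: integrable0|exact: integrable0|].
  by under eq_integral do rewrite mulr0 addr0; rewrite integral0.
have [Cb b01 Hb] := Hs 0%N isT.
have C1b : C1M (fun q => 1 - b q).
  move=> c ac x Ux; exact: C1_atB (C1_at_cst 1 x) (Cb c ac x Ux).
have -> : h = fun q => b q * h q + (1 - b q) * h q.
  by apply/funext => q; rewrite -mulrDl addrC subrK mul1r.
apply: drift_le0D; [exact: C1MM|exact: C1MM|exact: Hb|].
apply: IH; first exact: C1MM.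
- by move=> q; rewrite mulr_ge0// subr_ge0; have /andP[] := b01 q.
- by move=> i si; exact: (Hs i.+1).
- move=> q; rewrite mulf_eq0 negb_or subr_eq0 => /andP[b1 /Hh [[|i] si /= Hi]].
    by rewrite Hi eqxx in b1.
  by exists i.
Unshelve. all: by end_near. Qed.

Lemma drift_le0_compact h : C1M h -> (forall q, 0 <= h q) ->
  compact (closure [set q | h q != 0]) -> drift_le0 h.
Proof.
move=> Ch h0 cS.
pose beta q0 : M -> R := sval (cid (local_cutoff_exists q0)).
have Hb q0 : local_cutoff (beta q0) /\ \forall q \near q0, beta q0 q = 1.
  by rewrite /beta; case: cid.
move: cS; rewrite compact_cover => cS.
have [|q _|D0 _ HD] := cS M setT (fun q0 => (interior [set q | beta q0 q = 1])).
- by move=> q _; exact: open_interior.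
- by exists q => //; have [_ H] := Hb q.
pose D : seq M := finmap.enum_fset D0.
refine (@drift_le0_cutoffs [seq beta q | q <- D] h Ch h0 _ _).
- move=> i; rewrite size_map => si; rewrite (nth_map point)//.
  by have [] := Hb (nth point D i).
- move=> q hq; have [|q0 q0D /interior_subset /= E] := HD q; first exact: subset_closure.
  exists (index q0 D); rewrite ?size_map ?index_mem//.
  by rewrite (nth_map point) ?index_mem// nth_index.
Qed.

End Drift.

(** * Power functions and inequalities *)

Section PowerFunction.
Context {R : realType}.
Implicit Types (p t a b : R).

Definition abs_pow p t : R := `|t| `^ p.
Definition abs_pow' p t : R := p * Num.sg t * `|t| `^ (p - 1).

Lemma abs_powR_cvg0 (r : R) : 0 < r -> `|t| `^ r @[t --> (0 : R)] --> (0 : R).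
Proof.
move=> r0; apply/cvgrPdist_le => e e0.
have H : \forall t \near (0 : R), `|t| < e `^ r^-1.
  by apply: (nbhs0_lt (e := e `^ r^-1)); rewrite powR_gt0.
apply: filterS H => t te; rewrite sub0r normrN ger0_norm ?powR_ge0//.
rewrite -[leRHS](powRr1 (ltW e0)) -(mulVf (x := r)) ?gt_eqF// powRrM.
by apply: ge0_ler_powR => //; rewrite ?nnegrE ?powR_ge0 ?normr_ge0 ?ltW.
Qed.

Lemma is_derive_abs_pow p t : 1 < p -> is_derive t (1 : R) (abs_pow p) (abs_pow' p t).
Proof.
move=> p1; have p0 : 0 < p by exact: lt_trans p1.
have [t0|t0|->] := ltrgtP t 0.
- rewrite /abs_pow' ltr0_sg// ltr0_norm// mulrN1 mulNr.
  apply: (@near_eq_is_derive R R R (fun y : R => (- y) `^ p) (abs_pow p)); last first.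
    have d1 : is_derive t (1 : R) (fun y : R => - y) (-1) by exact: is_deriveN.
    have d2 : is_derive (- t) (1 : R) ((@powR R)^~ p) (p * (- t) `^ (p - 1)).
      by apply: is_derive1_powR; rewrite oppr_gt0.
    by have [d3 e3] := is_derive1_comp d2 d1; split; rewrite ?e3 ?mulrN1.
  have : \forall y \near t, y < 0 by apply: open_nbhs_nbhs; split; [exact: open_lt|].
  by apply: filterS => y y0; rewrite /abs_pow ltr0_norm.
- rewrite /abs_pow' gtr0_sg// gtr0_norm// mulr1.
  apply: (@near_eq_is_derive R R R ((@powR R)^~ p) (abs_pow p)); last exact: is_derive1_powR.
  have : \forall y \near t, 0 < y by apply: open_nbhs_nbhs; split; [exact: open_gt|].
  by apply: filterS => y y0; rewrite /abs_pow gtr0_norm.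
rewrite /abs_pow' sgr0 mulr0 mul0r.
apply: (@is_derive_at0 _ _ (fun t => `|t| `^ (p - 1))).
- by rewrite /abs_pow normr0 powR0// gt_eqF.
- by move=> s; rewrite /abs_pow ger0_norm ?powR_ge0// mulr_powRB1.
- have H := @abs_powR_cvg0 (p - 1); rewrite subr_gt0 in H.
  by move=> A /(H p1); exact: nbhs_dnbhs.
Qed.

Lemma abs_pow'_continuous p : 1 < p -> continuous (abs_pow' p).
Proof.
move=> p1 t; have p0 : 0 < p by exact: lt_trans p1.
have dc (s : R) : 0 < s -> {for s, continuous (fun y : R => y `^ (p - 1))}.
  move=> s0; have [d _] := is_derive1_powR (p - 1) s0.
  by apply: differentiable_continuous; apply/derivable1_diffP.
have [t0|t0|->] := ltrgtP t 0.
- apply: (@near_eq_continuous _ _ (fun y : R => - p * (- y) `^ (p - 1))).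
    have : \forall y \near t, y < 0 by apply: open_nbhs_nbhs; split; [exact: open_lt|].
    by apply: filterS => y y0; rewrite /abs_pow' ltr0_sg// ltr0_norm// mulrN1.
  have c1 : {for t, continuous (fun y : R => (- y) `^ (p - 1))}.
    apply: (@continuous_comp _ _ _ (fun y : R => - y) (fun y : R => y `^ (p - 1))).
      exact: continuousN.
    by apply: dc; rewrite oppr_gt0.
  exact: (continuousM (@cst_continuous _ _ (- p) t) c1).
- apply: (@near_eq_continuous _ _ (fun y : R => p * y `^ (p - 1))).
    have : \forall y \near t, 0 < y by apply: open_nbhs_nbhs; split; [exact: open_gt|].
    by apply: filterS => y y0; rewrite /abs_pow' gtr0_sg// gtr0_norm// mulr1.
  exact: (continuousM (@cst_continuous _ _ p t) (dc t t0)).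
rewrite /prop_for /continuous_at {2}/abs_pow' sgr0 mulr0 mul0r.
apply/norm_cvg0P; apply: (@squeeze_cvgr _ _ _ _ (cst 0) (fun t => p * `|t| `^ (p - 1))).
- near=> s; rewrite /= normr_ge0 /= /abs_pow' !normrM (ger0_norm (powR_ge0 _ _)) (gtr0_norm p0).
  apply: ler_wpM2r; first exact: powR_ge0.
  by apply: ler_piMr; [exact: ltW|rewrite normr_sg; case: (s == 0)].
- exact: cvg_cst.
- rewrite -[X in _ --> X](mulr0 p); apply: cvgMl_tmp; apply: abs_powR_cvg0.
  by rewrite subr_gt0.
Unshelve. all: by end_near. Qed.

Lemma C1_at_abs_pow p t : 1 < p -> C1_at (abs_pow p) t.
Proof.
move=> p1; apply: (@C1_at_real _ _ (abs_pow' p)); last exact: abs_pow'_continuous.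
by move=> s; exact: is_derive_abs_pow.
Qed.

(** Young's inequality for a^(p-1) and b with the exponents p / (p - 1) and p, multiplied by p. *)
Lemma young_powR p a b : 1 < p -> 0 <= a -> 0 <= b ->
  p * a `^ (p - 1) * b <= (p - 1) * a `^ p + b `^ p.
Proof.
move=> p1 a0 b0.
have p0 : 0 < p by exact: lt_trans p1.
have q0 : 0 < p - 1 by rewrite subr_gt0.
pose q := p / (p - 1); have qp : 0 < q by rewrite divr_gt0.
have pq : q^-1 + p^-1 = 1 by rewrite /q; field; rewrite !gt_eqF.
have := @conjugate_powR R (a `^ (p - 1)) b q p.
rewrite powR_ge0 b0 => /(_ isT isT qp p0 pq).
rewrite -powRrM.
have -> : (p - 1) * q = p by rewrite /q mulrCA mulfV ?mulr1// gt_eqF.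
rewrite -(ler_pM2l p0) mulrA mulrDr => H; apply: le_trans H _.
rewrite le_eqVlt; apply/orP; left; apply/eqP.
have qE : p / q = p - 1 by rewrite /q; field; rewrite !gt_eqF.
by rewrite mulrCA qE [X in _ + X]mulrCA mulfV ?gt_eqF// mulr1; congr (_ + _); rewrite mulrC.
Qed.

(** If b <= d a with (1 + d)^p = k, the factor k absorbs b; otherwise a is at most b / d. *)
Lemma powR_add_le p k : 0 < p -> 1 < k -> exists2 L, 0 <= L &
  forall a b, 0 <= a -> 0 <= b -> (a + b) `^ p <= k * a `^ p + L * b `^ p.
Proof.
move=> p0 k1; have k0 : 0 < k by exact: lt_trans k1.
pose d := k `^ p^-1 - 1.
have d0 : 0 < d.
  have k1p : 1 `^ p^-1 = 1 :> R by rewrite powR1.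
   rewrite subr_gt0 -[ltLHS]k1p; apply: gt0_ltr_powR => //; rewrite ?invr_gt0 ?nnegrE//.
  exact: ltW.
exists ((1 + d^-1) `^ p); first exact: powR_ge0.
move=> a b a0 b0; have [bd|bd] := leP b (d * a).
  apply: (@le_trans _ _ (k * a `^ p)); last by rewrite lerDl mulr_ge0 ?powR_ge0.
  have -> : k = (1 + d) `^ p.
    by rewrite /d addrC subrK -powRrM mulVf ?gt_eqF// powRr1// ltW.
  rewrite -powRM//; last by rewrite addr_ge0// (ltW d0).
  have d1 : 0 <= 1 + d by rewrite addr_ge0// (ltW d0).
  apply: ge0_ler_powR; rewrite ?nnegrE ?(ltW p0) ?(addr_ge0 a0) ?(mulr_ge0 d1)//.
  by rewrite mulrDl mul1r lerD2l.
apply: (@le_trans _ _ ((1 + d^-1) `^ p * b `^ p)); last by rewrite lerDr mulr_ge0 ?powR_ge0 ?(ltW k0).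
have di : 0 <= d^-1 by rewrite invr_ge0 ltW.
rewrite -powRM ?addr_ge0//.
apply: ge0_ler_powR; rewrite ?nnegrE ?(ltW p0) ?addr_ge0// ?mulr_ge0 ?addr_ge0//.
by rewrite mulrDl mul1r addrC lerD2l -(ler_pM2l d0) mulrA mulfV ?gt_eqF// mul1r ltW.
Qed.

Lemma le_of_factors a b : 0 <= b -> (forall k, 1 < k -> a <= k * b) -> a <= b.
Proof.
move=> b0 H; rewrite leNgt; apply/negP => ba.
have [bz|bp] := eqVneq b 0.
  by have := H 2; rewrite bz mulr0 ltr1n => /(_ isT); rewrite leNgt -[X in X < _]bz ba.
have {}bp : 0 < b by rewrite lt_def bp.
have := H ((a + b) / (2 * b)); rewrite ltr_pdivlMr ?mulr_gt0// mul1r.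
have -> : (a + b) / (2 * b) * b = (a + b) / 2 by field; rewrite gt_eqF.
lra.
Qed.

End PowerFunction.

(** * Integrals of nonnegative functions over arbitrary sets *)

Section MeasureFacts.
Local Open Scope ereal_scope.
Context d (T : measurableType d) (R : realType) (mu : {measure set T -> \bar R}).
Implicit Types (A B Omega : set T) (f g h : T -> \bar R).

Import HBNNSimple.

Lemma ge0_integral_subset A B f : A `<=` B -> (forall x, 0 <= f x) ->
  \int[mu]_(x in A) f x <= \int[mu]_(x in B) f x.
Proof.
move=> AB f0; rewrite !ge0_integralE//; apply: ge_ereal_sup => _ [s/= sA <-].
apply: ereal_sup_ubound; exists s => //= x; apply: le_trans (sA x) _.
rewrite /patch; case: ifPn => [/set_mem Ax|_]; first by rewrite mem_set//; exact: AB.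
by case: ifPn.
Qed.

(** The integral over an arbitrary set is defined from simple functions below the integrand, hence
    is already attained on a countable union of level sets of such functions. *)
Lemma ge0_integral_carrier Omega f : (forall x, 0 <= f x) ->
  \int[mu]_(x in Omega) f x < +oo ->
  exists A, [/\ measurable A, A `<=` Omega & \int[mu]_(x in Omega) f x <= \int[mu]_(x in A) f x].
Proof.
move=> f0 foo.
have ffin : \int[mu]_(x in Omega) f x \is a fin_num.
  by rewrite ge0_fin_numE//; exact: integral_ge0.
have step (k : nat) : exists s : {nnsfun T >-> R}, (forall x, (s x)%:E <= (f \_ Omega) x) /\
    \int[mu]_(x in Omega) f x - (k.+1%:R^-1)%:E < sintegral mu s.
  have k0 : (0 < k.+1%:R^-1 :> R)%R by rewrite invr_gt0.
  move: ffin; rewrite ge0_integralE// => ffin.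
  have [_ [s /= sf <-] H] := ub_ereal_sup_adherent k0 ffin.
  by exists s.
pose s k := sval (cid (step k)).
have [sf sI] : (forall k x, (s k x)%:E <= (f \_ Omega) x) /\
    (forall k, \int[mu]_(x in Omega) f x - (k.+1%:R^-1)%:E < sintegral mu (s k)).
  by split=> k; rewrite /s; case: cid => ? [].
pose A := \bigcup_k (s k @^-1` [set y : R | (0 < y)%R]).
have sA k x : s k x != 0%R -> A x.
  move=> sx; exists k => //=; rewrite lt_def sx; exact: fun_ge0.
have mpos : measurable ([set y | (0 < y)%R] : set (measurableTypeR R)) by apply: open_measurable; exact: open_gt.
exists A; split.
- by apply: bigcup_measurable => k _; apply: measurable_funPTI.
- move=> x [k _] /= s0; have := sf k x; rewrite /patch.
  by case: ifPn => [/set_mem//|_]; rewrite lee_fin leNgt s0.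
- apply/lee_addgt0Pr => e e0.
  have [k ke] := ltr_add_invr e0; rewrite add0r in ke.
  have H : sintegral mu (s k) <= \int[mu]_(x in A) f x.
    rewrite ge0_integralE//; apply: ereal_sup_ubound; exists (s k) => //= x.
    rewrite /patch; case: ifPn => [_|/negP nA].
      by apply: le_trans (sf k x) _; rewrite /patch; case: ifPn.
    have [->//|sx] := eqVneq (s k x) 0%R.
    by exfalso; apply: nA; exact/mem_set/(sA k).
  have := ltW (lt_le_trans (sI k) H); rewrite leeBlDr// => H2; apply: le_trans H2 _.
  by rewrite leeD2l// lee_fin ltW.
Qed.

(** The function f1 - dr is integrable and bounded above by g, whose integral may be infinite. *)
Lemma integral_le_drift (f1 dr g : T -> R) :
  mu.-integrable setT (EFin \o f1) -> mu.-integrable setT (EFin \o dr) ->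
  \int[mu]_x (dr x)%:E <= 0 -> measurable_fun setT g -> (forall x, (0 <= g x)%R) ->
  (forall x, (f1 x <= dr x + g x)%R) -> \int[mu]_x (f1 x)%:E <= \int[mu]_x (g x)%:E.
Proof.
move=> i1 i2 d0 mg g0 fdg.
have iD : mu.-integrable setT (EFin \o (fun x => f1 x - dr x)%R).
  rewrite (_ : EFin \o _ = (EFin \o f1) \- (EFin \o dr))//; exact: integrableB.
have -> : \int[mu]_x (f1 x)%:E = \int[mu]_x (f1 x - dr x)%:E + \int[mu]_x (dr x)%:E.
  rewrite -integralD//; apply: eq_integral => x _; by rewrite -EFinD subrK.
apply: (@le_trans _ _ (\int[mu]_x (f1 x - dr x)%:E)); first by rewrite geeDl.
rewrite integralE; apply: (@le_trans _ _ (\int[mu]_x ((EFin \o (fun x => f1 x - dr x)%R)^\+ x))).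
  rewrite -[leRHS]sube0; apply: leeB => //; exact: integral_ge0.
apply: ge0_le_integral => //.
- by apply: measurable_funepos; have /integrableP[] := iD.
- exact/measurable_EFinP.
- move=> x _; rewrite funeposE /= ge_max !lee_fin g0 andbT lerBlDl; exact: fdg.
Qed.

Lemma ge0_integral_le_combination A (k L : R) (f1 g1 g2 : T -> R) : measurable A ->
  (0 <= k)%R -> (0 <= L)%R ->
  measurable_fun A f1 -> measurable_fun A g1 -> measurable_fun A g2 ->
  (forall x, (0 <= f1 x)%R) -> (forall x, (0 <= g1 x)%R) -> (forall x, (0 <= g2 x)%R) ->
  (forall x, (f1 x <= k * g1 x + L * g2 x)%R) ->
  \int[mu]_(x in A) (f1 x)%:E <=
    k%:E * \int[mu]_(x in A) (g1 x)%:E + L%:E * \int[mu]_(x in A) (g2 x)%:E.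
Proof.
move=> mA k0 L0 mf mg1 mg2 f0 g10 g20 H.
have [m0 m1 m2] : [/\ measurable_fun A (EFin \o f1), measurable_fun A (EFin \o g1) &
  measurable_fun A (EFin \o g2)] by split; apply/measurable_EFinP.
rewrite -!ge0_integralZl//; try by move=> x _; rewrite lee_fin.
have mk : measurable_fun A (fun x => k%:E * (g1 x)%:E) by exact: measurable_funeM.
have mL : measurable_fun A (fun x => L%:E * (g2 x)%:E) by exact: measurable_funeM.
rewrite -ge0_integralD//; try by move=> x _; rewrite mule_ge0// lee_fin.
apply: ge0_le_integral => //; first by move=> x _; rewrite lee_fin.
  exact: emeasurable_funD.
by move=> x _; rewrite -!EFinM -EFinD lee_fin.
Qed.

Lemma integral_supported A B f : A `<=` B -> (forall x, ~ A x -> f x = 0) ->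
  \int[mu]_(x in B) f x = \int[mu]_(x in A) f x.
Proof.
move=> AB f0; rewrite integral_mkcond [RHS]integral_mkcond; congr integral.
apply/funext => x; rewrite /patch; case: (boolP (x \in A)) => [/set_mem/AB Bx|/negP nA]; first by rewrite mem_set.
by case: ifPn => // _; apply: f0 => Ax; apply: nA; exact: mem_set.
Qed.

End MeasureFacts.

(** * The energy inequality for test functions *)

(** In the application below a = |u|^p, b = |u|^(p-1), g = |grad u|, g' = g^p, s = t^(p-1), and r is the
    radial derivative of |u|^p. The second bound is Young's inequality for t |u| and |grad u|. *)
Lemma energy_scalars (R : realType) (p a b g g' r s t : R) :
  - (p * b * g) <= r -> 0 <= s -> p * (s * b) * g <= (p - 1) * (s * t * a) + g' ->
  s * t * a <= s * (p * t * a + r) + g'.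
Proof.
move=> H1 H2 H3.
have H4 : 0 <= s * (r + p * b * g) by rewrite mulr_ge0//; lra.
lra.
Qed.

Section HyperbolicNorm.
Context {R : realType} {m : nat}.
Implicit Types (x v w : 'rV[R]_m.+1).

Lemma hyp_gnormE x v : 0 < x 0 ord_max ->
  Defs.gnorm (hyp_metric x) v = (x 0 ord_max)^-1 * Num.sqrt ((v *m v^T) 0 0).
Proof.
move=> x0; rewrite /Defs.gnorm /inner /hyp_metric mul_mx_scalar -scalemxAl.
rewrite [X in Num.sqrt X = _]mxE sqrtrM ?invr_ge0 ?exprn_ge0 ?(ltW x0)//.
by rewrite -exprVn sqrtr_sqr ger0_norm// invr_ge0 ltW.
Qed.

Lemma gnorm_ge0 (S : 'M[R]_m.+1) v : 0 <= Defs.gnorm S v.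
Proof. exact: sqrtr_ge0. Qed.

Lemma sqrt_mulmx_triangle v w :
  Num.sqrt (((v + w) *m (v + w)^T) 0 0) <=
  Num.sqrt ((v *m v^T) 0 0) + Num.sqrt ((w *m w^T) 0 0).
Proof.
have E : ((v + w) *m (v + w)^T) 0 0 = (v *m v^T) 0 0 + 2 * (v *m w^T) 0 0 + (w *m w^T) 0 0.
  rewrite !mulmx_entry mulr_sumr -!big_split /=; apply: eq_bigr => i _.
  by rewrite !trmx_entry !mxE; ring.
have C := cauchy_schwarz_row v w.
have a0 := mulmx_tr_ge0 v; have b0 := mulmx_tr_ge0 w.
rewrite -(ler_pXn2r (n := 2)) ?nnegrE ?addr_ge0 ?sqrtr_ge0// sqr_sqrtr ?mulmx_tr_ge0// E.
rewrite sqrrD !sqr_sqrtr// lerD2r lerD2l; move: C.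
move: ((v *m w^T) 0 0) (Num.sqrt _ * Num.sqrt _) => s t st; by rewrite mulr2n; lra.
Qed.

Lemma hyp_gnorm_triangle x v w : 0 < x 0 ord_max ->
  Defs.gnorm (hyp_metric x) (v + w) <= Defs.gnorm (hyp_metric x) v + Defs.gnorm (hyp_metric x) w.
Proof.
move=> x0; rewrite !hyp_gnormE// -mulrDr; apply: ler_wpM2l; first by rewrite invr_ge0 ltW.
exact: sqrt_mulmx_triangle.
Qed.

Lemma hyp_gnorm_last x v : 0 < x 0 ord_max ->
  `|v 0 ord_max| / x 0 ord_max <= Defs.gnorm (hyp_metric x) v.
Proof.
move=> x0; rewrite hyp_gnormE// mulrC; apply: ler_wpM2l; first by rewrite invr_ge0 ltW.
rewrite -sqrtr_sqr ler_sqrt ?mulmx_tr_ge0// mulmx_entry (bigD1 ord_max)//= trmx_entry expr2 lerDl.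
by apply: sumr_ge0 => i _; rewrite trmx_entry; exact: sqr_ge0.
Qed.

Lemma gnorm0 (S : 'M[R]_m.+1) : Defs.gnorm S 0 = 0.
Proof. by rewrite /Defs.gnorm /inner !mul0mx mxE sqrtr0. Qed.

End HyperbolicNorm.

Section Energies.
Context {R : realType} {n m : nat} {M : smooth_manifold R n}.
Variables (X : M -> 'rV[R]_m.+1) (imX : immersion X half_space).
Variables (mu : {measure set (borel M) -> \bar R}) (p : R) (p1 : 1 < p).

Let p0 : 0 < p. Proof. exact: lt_trans p1. Qed.

Local Notation nrm F q := (Defs.gnorm (hyp_metric (X q)) (F q)).
Local Notation Lf := (Lp_fun mu p).
Local Notation LF := (Lp_field hyp_metric X mu p).

Lemma continuous_borel_measurable (f : M -> R) : continuous f ->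
  measurable_fun setT (f : borel M -> R).
Proof.
by move=> cf; apply: (@borel_continuous_measurable_real R M setT f openT) => q _; exact: cf.
Qed.

Lemma measurable_nrm (F : M -> 'rV[R]_m.+1) :
  (forall i, measurable_fun setT (fun q : borel M => F q 0 i)) ->
  measurable_fun setT (fun q : borel M => nrm F q `^ p).
Proof.
move=> mF.
have mS : measurable_fun setT (fun q : borel M => \sum_i F q 0 i * F q 0 i).
  by apply: measurable_sum => i; exact: measurable_funM.
have msq : measurable_fun setT (@Num.sqrt R).
  by apply: continuous_measurable_fun; exact: sqrt_continuous.
have mV : measurable_fun setT (fun q : borel M => (X q 0 ord_max)^-1).
  apply: continuous_borel_measurable => q.
  apply: (@continuousV _ _ (fun q => X q 0 ord_max)); last exact: height_continuous.
  by rewrite gt_eqF// (immersion_height_gt0 imX).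
apply: (measurableT_comp (measurable_powR p)).
have -> : (fun q : borel M => nrm F q) = fun q => (X q 0 ord_max)^-1 * Num.sqrt (\sum_i F q 0 i * F q 0 i).
  apply/funext => q; rewrite hyp_gnormE ?(immersion_height_gt0 imX)// mulmx_entry; congr (_ * Num.sqrt _).
  by apply: eq_bigr => i _; rewrite trmx_entry.
apply: measurable_funM => //; exact: (measurableT_comp msq mS).
Qed.

Lemma measurable_abs_pow (f : M -> R) : measurable_fun setT (f : borel M -> R) ->
  measurable_fun setT (fun q : borel M => `|f q| `^ p).
Proof.
move=> mf; apply: (measurableT_comp (measurable_powR p)).
exact: (measurableT_comp (@normr_measurable R setT)).
Qed.

Section TestFunction.
Variables (Omega : set M) (u : M -> R) (tu : test_function Omega u).

Local Notation supp := (closure [set q | u q != 0]).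

Lemma test_C1M : C1M u.
Proof. by have [su _ _] := tu; exact: smooth_C1M. Qed.

Lemma test_measurable : measurable_fun setT (u : borel M -> R).
Proof. exact: (continuous_borel_measurable (C1M_continuous test_C1M)). Qed.

Lemma test_grad_measurable i :
  measurable_fun setT (fun q : borel M => grad hyp_metric X u q 0 i).
Proof.
apply: continuous_borel_measurable => q.
apply: (@continuous_comp _ _ _ (grad hyp_metric X u) (fun N : 'rV[R]_m.+1 => N 0 i) q).
  exact: (grad_continuous imX test_C1M).
exact: coord_continuous.
Qed.

Lemma measurable_support : measurable (supp : set (borel M)).
Proof.
rewrite -[supp]setCK; apply: measurableC; apply: sub_sigma_algebra.
exact/closed_openC/closed_closure.
Qed.

Lemma near_support0 q : ~ supp q -> \forall q' \near q, u q' = 0.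
Proof.
move=> nq; have oS : open (~` supp) by exact/closed_openC/closed_closure.
apply: filterS (open_nbhs_nbhs (conj oS nq)) => q' nq'.
by apply/eqP/negPn/negP => uq; apply: nq'; exact: subset_closure.
Qed.

Lemma test_out q : ~ supp q -> u q = 0.
Proof. by move/near_support0/nbhs_singleton. Qed.

Lemma grad_test_out q : ~ supp q -> grad hyp_metric X u q = 0.
Proof. by move=> nq; apply: (grad_near0 imX test_C1M); exact: near_support0. Qed.

Variables (c0 : R) (c0_gt0 : 0 < c0).
Hypothesis drift : forall h, C1M h -> (forall q, 0 <= h q) ->
  compact (closure [set q | h q != 0]) -> drift_le0 X mu c0 h.

(** The first term on the right is a multiple of the integrand of the drift inequality for |u|^p. Its
    radial part is at least - p |u|^(p-1) |grad u|, since grad b has length at most 1, and Young's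
    inequality applied to t |u| and |grad u| with t = c0 / p bounds the latter. *)
Lemma test_poincare_pointwise q :
  (c0 / p) `^ p * abs_pow p (u q) <= (c0 / p) `^ (p - 1) *
    (c0 * abs_pow p (u q) + radial X (fun q => abs_pow p (u q)) q) +
    nrm (grad hyp_metric X u) q `^ p.
Proof.
pose t := c0 / p; rewrite -/t; have t0 : 0 < t by rewrite divr_gt0.
have Cp s : C1_at (abs_pow p) s by exact: C1_at_abs_pow.
have dp s : 'D_1 (abs_pow p) s = abs_pow' p s by have [_] := is_derive_abs_pow s p1.
have y0 : 0 < X q 0 ord_max by exact: immersion_height_gt0.
have rE : `|radial X (fun q => abs_pow p (u q)) q| <=
    p * `|u q| `^ (p - 1) * nrm (grad hyp_metric X u) q.
  rewrite /radial (grad_comp imX q Cp dp test_C1M) mxE -mulrN -[X in `|X|]mulrA normrM.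
  apply: ler_pM => //.
    rewrite /abs_pow' !normrM (ger0_norm (powR_ge0 _ _)) (gtr0_norm p0).
    apply: ler_wpM2r; first exact: powR_ge0.
    by apply: ler_piMr; [exact: ltW|rewrite normr_sg; case: (u q == 0)].
  rewrite normrM normrN normfV (gtr0_norm y0); exact: hyp_gnorm_last.
have cE : c0 = p * t by rewrite /t mulrCA mulfV ?mulr1// gt_eqF.
clearbody t; have := young_powR p1 (mulr_ge0 (ltW t0) (normr_ge0 (u q))) (gnorm_ge0 (hyp_metric (X q)) (grad hyp_metric X u q)).
rewrite !powRM ?(ltW t0)// -/(abs_pow p (u q)).
have tp : t `^ p = t `^ (p - 1) * t by rewrite mulrC mulr_powRB1// ltW.
move: rE (powR_ge0 t (p - 1)); rewrite tp cE ler_norml => /andP[+ _].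
set r := radial _ _ q; set g := nrm _ q; set g' := g `^ p; set s := t `^ (p - 1).
set a := abs_pow p (u q); set b := `|u q| `^ (p - 1).
exact: energy_scalars.
Qed.

Lemma test_poincare A : measurable (A : set (borel M)) -> supp `<=` A ->
  (((c0 / p) `^ p)%:E * Lf A u <= LF A (grad hyp_metric X u))%E.
Proof.
move=> mA SA.
have Cp s : C1_at (abs_pow p) s by exact: C1_at_abs_pow.
have Ch := C1M_comp Cp test_C1M.
have h0 q : 0 <= abs_pow p (u q) by exact: powR_ge0.
have [|ih ir dr] := drift Ch h0.
  rewrite (_ : [set q | abs_pow p (u q) != 0] = [set q | u q != 0]); first by have [] := tu.
  apply/seteqP; split=> q /=; rewrite /abs_pow powR_eq0 normr_eq0 (gt_eqF p0) andbT//.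
have E1 : Lf A u = (\int[mu]_q (`|u q| `^ p)%:E)%E.
  apply/esym/(@integral_supported _ _ _ mu A setT) => // q nA.
  by rewrite test_out ?normr0 ?powR0// ?gt_eqF// => /SA.
have E2 : LF A (grad hyp_metric X u) = (\int[mu]_q (nrm (grad hyp_metric X u) q `^ p)%:E)%E.
  apply/esym/(@integral_supported _ _ _ mu A setT) => // q nA.
  by rewrite grad_test_out ?gnorm0 ?powR0// ?gt_eqF// => /SA.
rewrite E1 E2 -integralZl//.
under eq_integral do rewrite -EFinM.
apply: (@integral_le_drift _ _ _ mu (fun q => (c0 / p) `^ p * `|u q| `^ p)
   (fun q => (c0 / p) `^ (p - 1) * (c0 * abs_pow p (u q) + radial X (fun q => abs_pow p (u q)) q))).
- exact: (integrableZ_fin _ ih).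
- apply: integrableZ_fin; apply: integrableD_fin => //; exact: integrableZ_fin.
- under eq_integral do rewrite EFinM.
  rewrite integralZl//; last by apply: integrableD_fin => //; exact: integrableZ_fin.
  by rewrite mule_ge0_le0// lee_fin powR_ge0.
- exact: (measurable_nrm test_grad_measurable).
- by move=> q; exact: powR_ge0.
- by move=> q; exact: test_poincare_pointwise.
Qed.

End TestFunction.

End Energies.

(** * The first eigenvalue *)

Section NonnegativeLimits.
Local Open Scope ereal_scope.
Context {R : realType}.
Implicit Types (a b : \bar R) (e g u v : nat -> \bar R).

Lemma ge0_fin_fineK a : 0 <= a -> a < +oo -> (fine a)%:E = a.
Proof. by move=> a0 aoo; rewrite fineK// ge0_fin_numE. Qed.

Lemma cvg_squeeze0 u v : (forall j, 0 <= u j) -> (forall j, u j <= v j) ->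
  v @ \oo --> 0 -> u @ \oo --> 0.
Proof.
move=> u0 uv v0; apply: (@squeeze_cvge _ _ _ _ (cst 0) u v) => //; last exact: cvg_cst.
by near=> j; rewrite /= u0 uv.
Unshelve. all: by end_near. Qed.

Lemma le_of_null_errors a b e : b \is a fin_num -> e @ \oo --> 0 ->
  (forall j, a <= b + e j) -> a <= b.
Proof.
move=> bfin e0 H.
have cr : (fun j => b + e j) @ \oo --> b.
  rewrite -[X in _ --> X]adde0; apply: cvgeD => //; [|exact: cvg_cst].
  exact: fin_num_adde_defr.
rewrite -(cvg_lim _ cr)//; apply: lime_ge; first by apply/cvg_ex; eexists; exact: cr.
by near=> j.
Unshelve. all: by end_near. Qed.

(** Here a and b stand for the p-energies of a Sobolev function and of its gradient, u j and g j for
    those of the j-th approximating test function, e1 and e2 for the errors. *)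
Lemma combination_limit (C k L : R) a b u g e1 e2 :
  (0 <= C)%R -> (0 <= k)%R -> (0 <= L)%R -> 0 <= b -> b < +oo ->
  (forall j, 0 <= u j) -> (forall j, 0 <= e1 j) -> (forall j, 0 <= e2 j) ->
  e1 @ \oo --> 0 -> e2 @ \oo --> 0 ->
  (forall j, a <= k%:E * u j + L%:E * e1 j) ->
  (forall j, g j <= k%:E * b + L%:E * e2 j) ->
  (forall j, C%:E * u j <= g j) -> C%:E * a <= (k * k)%:E * b.
Proof.
move=> C0 k0 L0 b0 boo u0 e10 e20 c1 c2 S1 S2 S3.
have Z (x : R) (e : nat -> \bar R) : e @ \oo --> 0 -> (fun j => x%:E * e j) @ \oo --> 0.
  by move=> ce; rewrite -[X in _ --> X](mule0 x%:E); exact: cvgeZl.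
apply: (@le_of_null_errors _ _ (fun j => (k * L)%:E * e2 j + (C * L)%:E * e1 j)).
- by rewrite fin_numM// ge0_fin_numE.
- by rewrite -[X in _ --> X](adde0 0); apply: cvgeD => //; exact: Z.
- move=> j; apply: (@le_trans _ _ (C%:E * (k%:E * u j + L%:E * e1 j))).
    by rewrite lee_wpmul2l// lee_fin.
  rewrite ge0_muleDr ?mule_ge0 ?lee_fin//.
  rewrite addeA [C%:E * (L%:E * _)]muleA -EFinM leeD2r//.
  apply: (@le_trans _ _ (k%:E * (k%:E * b + L%:E * e2 j))).
    by rewrite muleCA lee_wpmul2l// ?lee_fin//; exact: le_trans (S3 j) (S2 j).
  by rewrite ge0_muleDr ?mule_ge0 ?lee_fin// !muleA -!EFinM.
Qed.

Lemma le_of_square_factors (C : R) a b : (0 <= C)%R -> 0 <= a -> a < +oo -> 0 <= b -> b < +oo ->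
  (forall k : R, (1 < k)%R -> C%:E * a <= (k * k)%:E * b) -> C%:E * a <= b.
Proof.
move=> C0 a0 aoo b0 boo; rewrite -(ge0_fin_fineK a0 aoo) -(ge0_fin_fineK b0 boo) => H.
rewrite -EFinM lee_fin; apply: le_of_factors => [|k k1]; first exact: fine_ge0.
have k0 : (0 <= k)%R by rewrite ltW// (lt_trans ltr01).
have := H (Num.sqrt k); rewrite -expr2 sqr_sqrtr// -!EFinM lee_fin; apply.
by rewrite -sqrtr1 ltr_sqrt// (lt_trans ltr01).
Qed.

End NonnegativeLimits.

Section Spectrum.
Context {R : realType} {n m : nat} {M : smooth_manifold R n}.
Variables (X : M -> 'rV[R]_m.+1) (imX : immersion X half_space).
Variables (mu : {measure set (borel M) -> \bar R}) (p : R) (p1 : 1 < p).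

Let p0 : 0 < p. Proof. exact: lt_trans p1. Qed.

Local Notation nrm F q := (Defs.gnorm (hyp_metric (X q)) (F q)).
Local Notation Lf := (Lp_fun mu p).
Local Notation LF := (Lp_field hyp_metric X mu p).
Local Notation W0 := (W0 hyp_metric X mu p).

Lemma Lf_subset (A B : set M) f : A `<=` B -> (Lf A f <= Lf B f)%E.
Proof. by move=> AB; apply: ge0_integral_subset => // q; rewrite lee_fin powR_ge0. Qed.

Lemma LF_subset (A B : set M) F : A `<=` B -> (LF A F <= LF B F)%E.
Proof. by move=> AB; apply: ge0_integral_subset => // q; rewrite lee_fin powR_ge0. Qed.

Lemma Lf_ge0 A f : (0 <= Lf A f)%E.
Proof. by apply: integral_ge0 => q _; rewrite lee_fin powR_ge0. Qed.

Lemma LF_ge0 A F : (0 <= LF A F)%E.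
Proof. by apply: integral_ge0 => q _; rewrite lee_fin powR_ge0. Qed.

Lemma Lf_carrier Omega f : (Lf Omega f < +oo)%E -> exists A,
  [/\ measurable (A : set (borel M)), A `<=` Omega & (Lf Omega f <= Lf A f)%E].
Proof.
have H (q : borel M) : (0%E <= (`|f q| `^ p)%:E)%E by rewrite lee_fin powR_ge0.
exact: (ge0_integral_carrier H).
Qed.

Lemma LF_carrier Omega F : (LF Omega F < +oo)%E -> exists A,
  [/\ measurable (A : set (borel M)), A `<=` Omega & (LF Omega F <= LF A F)%E].
Proof.
have H (q : borel M) : (0%E <= (nrm F q `^ p)%:E)%E by rewrite lee_fin powR_ge0.
exact: (ge0_integral_carrier H).
Qed.

Lemma Lf_supported A Omega f g : A `<=` Omega -> (forall q, A q -> f q = g q) ->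
  (forall q, ~ A q -> f q = 0) -> Lf Omega f = Lf A g.
Proof.
move=> AO fg f0.
have H (q : borel M) : ~ A q -> (`|f q| `^ p)%:E = 0%E by move/f0 ->; rewrite normr0 powR0// gt_eqF.
apply: (etrans (integral_supported mu AO H)); apply: eq_integral => q /set_mem Aq.
by rewrite fg.
Qed.

Lemma LF_supported A Omega F G : A `<=` Omega -> (forall q, A q -> F q = G q) ->
  (forall q, ~ A q -> F q = 0) -> LF Omega F = LF A G.
Proof.
move=> AO fg f0.
have H (q : borel M) : ~ A q -> (nrm F q `^ p)%:E = 0%E by move/f0 ->; rewrite gnorm0 powR0// gt_eqF.
apply: (etrans (integral_supported mu AO H)); apply: eq_integral => q /set_mem Aq.
by rewrite fg.
Qed.

Lemma Lf_le_combination A (k L : R) f g h : measurable (A : set (borel M)) -> 0 <= k -> 0 <= L ->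
  measurable_fun setT (f : borel M -> R) -> measurable_fun setT (g : borel M -> R) ->
  measurable_fun setT (h : borel M -> R) ->
  (forall q, `|f q| `^ p <= k * `|g q| `^ p + L * `|h q| `^ p) ->
  (Lf A f <= k%:E * Lf A g + L%:E * Lf A h)%E.
Proof.
move=> mA k0 L0 mf mg mh H.
have mm e : measurable_fun setT (e : borel M -> R) ->
    measurable_fun A (fun q : borel M => `|e q| `^ p).
  by move=> me; apply: measurable_funTS; exact: measurable_abs_pow.
have m0 (e : borel M -> R) q : 0 <= `|e q| `^ p by exact: powR_ge0.
exact: (ge0_integral_le_combination mu mA k0 L0 (mm f mf) (mm g mg) (mm h mh) (m0 f) (m0 g) (m0 h) H).
Qed.

Lemma LF_le_combination A (k L : R) (F G H : M -> 'rV[R]_m.+1) : measurable (A : set (borel M)) -> 0 <= k -> 0 <= L ->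
  (forall i, measurable_fun setT (fun q : borel M => F q 0 i)) ->
  (forall i, measurable_fun setT (fun q : borel M => G q 0 i)) ->
  (forall i, measurable_fun setT (fun q : borel M => H q 0 i)) ->
  (forall q, nrm F q `^ p <= k * nrm G q `^ p + L * nrm H q `^ p) ->
  (LF A F <= k%:E * LF A G + L%:E * LF A H)%E.
Proof.
move=> mA k0 L0 mF mG mH FGH.
have mm (E : M -> 'rV[R]_m.+1) : (forall i, measurable_fun setT (fun q : borel M => E q 0 i)) ->
    measurable_fun A (fun q : borel M => nrm E q `^ p).
  by move=> mE; apply: measurable_funTS; exact: (measurable_nrm imX).
have m0 (E : borel M -> 'rV[R]_m.+1) q : 0 <= nrm E q `^ p by exact: powR_ge0.
exact: (ge0_integral_le_combination mu mA k0 L0 (mm F mF) (mm G mG) (mm H mH) (m0 F) (m0 G) (m0 H) FGH).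
Qed.

Lemma measurable_subr_fun (f g : borel M -> R) : measurable_fun setT f -> measurable_fun setT g ->
  measurable_fun setT (fun q => f q - g q).
Proof. by move=> mf mg; exact: measurable_funB. Qed.

Lemma measurable_fun_if0 (A : set (borel M)) (f : borel M -> R) : measurable A ->
  measurable_fun setT f -> measurable_fun setT (fun q => if q \in A then f q else 0).
Proof.
move=> mA mf.
have -> : (fun q : borel M => if q \in A then f q else 0) = (fun q : borel M => f q * \1_A q).
  by apply/funext => q; rewrite indicE; case: ifPn => _; rewrite ?mulr1 ?mulr0.
by apply: measurable_funM => //; exact: measurable_indic.
Qed.

(** The part A is the union of carriers of the two integrals and of the supports of the approximating
    test functions. Then the test functions are admissible for A and the errors only decrease. *)
Lemma W0_measurable_part Omega f F : W0 Omega f F -> exists A,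
  [/\ measurable (A : set (borel M)), A `<=` Omega, W0 A f F,
      Lf A f = Lf Omega f & LF A F = LF Omega F].
Proof.
move=> [mf mF foo Foo [u tu [uf uF]]].
have [A1 [mA1 A1O H1]] : exists A, [/\ measurable (A : set (borel M)), A `<=` Omega & (Lf Omega f <= Lf A f)%E].
  exact: Lf_carrier.
have [A2 [mA2 A2O H2]] : exists A, [/\ measurable (A : set (borel M)), A `<=` Omega & (LF Omega F <= LF A F)%E].
  exact: LF_carrier.
pose A3 := \bigcup_j closure [set q | u j q != 0].
have mA3 : measurable (A3 : set (borel M)).
  by apply: bigcup_measurable => j _; exact: measurable_support.
have A3O : A3 `<=` Omega by move=> q [j _ Kq]; have [_ _] := tu j; apply.
pose A := A1 `|` A2 `|` A3.
have AO : A `<=` Omega by move=> q [[/A1O|/A2O]|/A3O].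
have A1A : A1 `<=` A by move=> q; left; left.
have A2A : A2 `<=` A by move=> q; left; right.
have mA : measurable (A : set (borel M)).
  by apply: measurableU mA3; exact: measurableU mA1 mA2.
have E1 : Lf A f = Lf Omega f.
  by apply: le_anti; rewrite (Lf_subset f AO) (le_trans H1 (Lf_subset f A1A)).
have E2 : LF A F = LF Omega F.
  by apply: le_anti; rewrite (LF_subset F AO) (le_trans H2 (LF_subset F A2A)).
exists A; split; [exact: mA|exact: AO| |exact: E1|exact: E2].
split; [exact: mf|exact: mF|by rewrite E1|by rewrite E2|].
exists u; first by move=> j; have [su cu Ku] := tu j; split=> [||q Kq]; [exact: su|exact: cu|right; exists j].
split.
- exact: (cvg_squeeze0 (fun j => Lf_ge0 _ _) (fun j => Lf_subset _ AO) uf).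
- exact: (cvg_squeeze0 (fun j => LF_ge0 _ _) (fun j => LF_subset _ AO) uF).
Qed.

Definition restrict_fun (A : set M) (f : M -> R) q := if q \in A then f q else 0.
Definition restrict_field (A : set M) (F : M -> 'rV[R]_m.+1) q := if q \in A then F q else 0.

Lemma restrict_field_entry A F i :
  (fun q => restrict_field A F q 0 i) = (fun q => if q \in A then F q 0 i else 0).
Proof. by apply/funext => q; rewrite /restrict_field; case: ifPn => // _; rewrite mxE. Qed.

(** Extension by zero; the approximating test functions already vanish outside A. *)
Lemma W0_extend A Omega f F : measurable (A : set (borel M)) -> A `<=` Omega -> W0 A f F ->
  [/\ W0 Omega (restrict_fun A f) (restrict_field A F),
      Lf Omega (restrict_fun A f) = Lf A f & LF Omega (restrict_field A F) = LF A F].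
Proof.
move=> mA AO [mf mF foo Foo [u tu [uf uF]]].
have fin q : A q -> restrict_fun A f q = f q by move=> Aq; rewrite /restrict_fun mem_set.
have fout q : ~ A q -> restrict_fun A f q = 0 by move=> Aq; rewrite /restrict_fun memNset.
have Fin q : A q -> restrict_field A F q = F q by move=> Aq; rewrite /restrict_field mem_set.
have Fout q : ~ A q -> restrict_field A F q = 0 by move=> Aq; rewrite /restrict_field memNset.
have E1 : Lf Omega (restrict_fun A f) = Lf A f by exact: Lf_supported.
have E2 : LF Omega (restrict_field A F) = LF A F by exact: LF_supported.
split; [|exact: E1|exact: E2]; split; [| |by rewrite E1|by rewrite E2|].
- exact: measurable_fun_if0.
- move=> i; rewrite (restrict_field_entry A F i); exact: measurable_fun_if0.
have uout j q : ~ A q -> ~ closure [set q | u j q != 0] q.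
  by move=> nA Kq; apply: nA; have [_ _] := tu j; apply.
exists u; first by move=> j; have [su cu Ku] := tu j; split; [exact: su|exact: cu|exact: subset_trans AO].
split.
- move: uf; apply: cvg_trans; apply: near_eq_cvg; near=> j; apply/esym.
  apply: (Lf_supported AO) => q Aq; first by rewrite (fin q Aq).
  rewrite (fout q Aq) subr0; exact: (test_out (uout j q Aq)).
- move: uF; apply: cvg_trans; apply: near_eq_cvg; near=> j; apply/esym.
  apply: (LF_supported AO) => q Aq; first by rewrite (Fin q Aq).
  rewrite (Fout q Aq) subr0; exact: (grad_test_out imX (tu j) (uout j q Aq)).
Unshelve. all: by end_near. Qed.

Lemma lambda1_antitone Omega Omega' : Omega `<=` Omega' ->
  (lambda1 hyp_metric X mu p Omega' <= lambda1 hyp_metric X mu p Omega)%E.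
Proof.
move=> OO; apply: ereal_inf_le_tmp => _ [f [F [WfF f0 ->]]].
have [A [mA AO WA EA1 EA2]] := W0_measurable_part WfF.
have [W' E1 E2] := W0_extend mA (subset_trans AO OO) WA.
exists (restrict_fun A f), (restrict_field A F).
split; [exact: W'|by rewrite E1 EA1|by rewrite E1 E2 EA1 EA2].
Qed.

Variables (c0 : R) (c0_gt0 : 0 < c0).
Hypothesis drift : forall h, C1M h -> (forall q, 0 <= h q) ->
  compact (closure [set q | h q != 0]) -> drift_le0 X mu c0 h.

(** The energy inequality passes from the test functions to f up to the factor k * k: one k for
    replacing f by a test function, one for replacing F by its gradient. Let k tend to 1. *)
Lemma W0_poincare A f F : measurable (A : set (borel M)) -> W0 A f F ->
  (((c0 / p) `^ p)%:E * Lf A f <= LF A F)%E.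
Proof.
move=> mA [mf mF foo Foo [u tu [uf uF]]].
have C0 : 0 <= (c0 / p) `^ p by exact: powR_ge0.
apply: (le_of_square_factors C0 (Lf_ge0 _ _) foo (LF_ge0 _ _) Foo) => k k1.
have k0 : 0 <= k by rewrite ltW// (lt_trans ltr01).
have [L L0 HL] := powR_add_le p0 k1.
have mu_ j := test_measurable (tu j).
have mg_ j := test_grad_measurable imX (tu j).
pose e1 j := Lf A (fun q => u j q - f q).
pose e2 j := LF A (fun q => grad hyp_metric X (u j) q - F q).
have S1 j : (Lf A f <= k%:E * Lf A (u j) + L%:E * e1 j)%E.
  apply: (Lf_le_combination mA k0 L0 mf (mu_ j) (measurable_subr_fun (mu_ j) mf)).
  move=> q; apply: le_trans (HL _ _ (normr_ge0 (u j q)) (normr_ge0 (u j q - f q))).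
  apply: ge0_ler_powR; rewrite ?nnegrE ?(ltW p0) ?addr_ge0//.
  by rewrite -{1}(subKr (u j q) (f q)) (le_trans (ler_normB _ _)).
have S2 j : (LF A (grad hyp_metric X (u j)) <= k%:E * LF A F + L%:E * e2 j)%E.
  apply: (LF_le_combination mA k0 L0 (mg_ j) mF).
    move=> i; rewrite (_ : (fun q => _) = (fun q : borel M => grad hyp_metric X (u j) q 0 i - F q 0 i)).
      exact: measurable_subr_fun.
    by apply/funext => q; rewrite !mxE.
  move=> q; apply: le_trans (HL _ _ (gnorm_ge0 _ (F q)) (gnorm_ge0 _ _)).
  apply: ge0_ler_powR; rewrite ?nnegrE ?(ltW p0) ?addr_ge0 ?gnorm_ge0//.
  apply: le_trans (hyp_gnorm_triangle _ _ (immersion_height_gt0 imX q)).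
  by rewrite addrC subrK.
have S3 j : (((c0 / p) `^ p)%:E * Lf A (u j) <= LF A (grad hyp_metric X (u j)))%E.
  apply: (test_poincare imX p1 (tu j) c0_gt0 drift mA); by have [_ _] := tu j.
exact: (combination_limit C0 k0 L0 (LF_ge0 _ _) Foo (fun j => Lf_ge0 _ _) (fun j => Lf_ge0 _ _)
  (fun j => LF_ge0 _ _) uf uF S1 S2 S3).
Qed.

Lemma lambda1_lower_bound Omega : (((c0 / p) `^ p)%:E <= lambda1 hyp_metric X mu p Omega)%E.
Proof.
apply: le_ereal_inf_tmp => _ [f [F [WfF f0 ->]]].
have [A [mA AO WA EA1 EA2]] := W0_measurable_part WfF.
have := W0_poincare mA WA; rewrite EA1 EA2.
have [_ _ foo Foo _] := WfF.
have fE := ge0_fin_fineK (Lf_ge0 Omega f) foo.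
have FE := ge0_fin_fineK (LF_ge0 Omega F) Foo.
have a0 : 0 < fine (Lf Omega f) by rewrite -lte_fin fE lt_def f0 Lf_ge0.
by rewrite -{1}fE -{1}FE -EFinM !lee_fin ler_pdivlMr.
Qed.

(** As the eigenvalue is antitone in the domain, its limit over growing balls exists and is an
    infimum. *)
Lemma lambda1_total_lower_bound q :
  (((c0 / p) `^ p)%:E <= lambda1_total hyp_metric X mu p q)%E.
Proof.
have H : {homo (fun l => lambda1 hyp_metric X mu p (geodesic_ball hyp_metric X q l)) :
    l l' / l <= l' >-> (l' <= l)%E}.
  move=> l l' ll'; apply: lambda1_antitone => q' /= ql.
  by apply: lt_le_trans ql _; rewrite lee_fin.
have c := nonincreasing_cvge H.
rewrite /lambda1_total (cvg_lim _ c)//; apply: le_ereal_inf_tmp => _ [l _ <-].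
exact: lambda1_lower_bound.
Qed.

End Spectrum.

Lemma sup_grad_bound (R : realType) (n m : nat) (M : smooth_manifold R n)
    (X : M -> 'rV[R]_m.+1) (phi : 'rV[R]_m.+1 -> R) (a : R) :
  (sup_grad hyp_metric X phi < a%:E)%E ->
  fine (sup_grad hyp_metric X phi) < a /\
  forall q, Defs.gnorm (hyp_metric (X q)) (gradient hyp_metric phi (X q)) <=
    fine (sup_grad hyp_metric X phi).
Proof.
move=> Ha.
have ub q : ((Defs.gnorm (hyp_metric (X q)) (gradient hyp_metric phi (X q)))%:E <=
    sup_grad hyp_metric X phi)%E by apply: ereal_sup_ubound; exists q.
have E : sup_grad hyp_metric X phi = (fine (sup_grad hyp_metric X phi))%:E.
  rewrite fineK// ge0_fin_numE; first exact: lt_trans Ha (ltry _).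
  by apply: le_trans (ub point); rewrite lee_fin gnorm_ge0.
by split=> [|q]; [rewrite -lte_fin -E|rewrite -lee_fin -E].
Qed.
Unset Implicit Arguments.
Set Strict Implicit.

Theorem theorem5p2 (R : realType) (m n : nat) (phi : 'rV[R]_m.+1 -> R) (p : R)
    (M : smooth_manifold R n) (X : M -> 'rV[R]_m.+1)
    (mu : {measure set (borel M) -> \bar R})
    (phi_smooth : smooth_on half_space phi)
    (p_gt1 : 1 < p)
    (n_ge2 : (2 <= n)%N)
    (X_immersion : immersion X half_space)
    (M_complete : riem_complete hyp_metric X)
    (M_noncompact : ~ compact [set: M])
    (M_phi_minimal : phi_minimal hyp_metric X phi)
    (mu_volume : riemannian_volume hyp_metric X mu)
    (sup_lt : (sup_grad hyp_metric X phi < (n%:R - 1)%:E)%E) :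
  let C := ((n%:R - 1 - fine (sup_grad hyp_metric X phi)) / p) `^ p in
  (forall q : M, (C%:E <= lambda1_total hyp_metric X mu p q)%E) /\ 0 < C.
Proof.
have [s_lt grad_le] := sup_grad_bound sup_lt.
set s := fine _ in s_lt grad_le *.
have c0_gt0 : 0 < n%:R - 1 - s by rewrite subr_gt0.
split; last by rewrite powR_gt0// divr_gt0// (lt_trans ltr01).
have Hdiv c (ac : atlas c) x (ix : chart_img c x) :=
  divergence_ge (chart_img_open ac) (immersion_smooth2 X_immersion ac)
    (immersion_pos X_immersion (c := c)) (immersion_free X_immersion ac) ix
    (M_phi_minimal c ac x ix) (grad_le (chart_inv c x)).
move=> q; apply: (lambda1_total_lower_bound X_immersion p_gt1 c0_gt0).
exact: (drift_le0_compact X_immersion mu_volume Hdiv).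
Qed.
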